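(* (a) There is a grading-preserving unitary isomorphism of $\mathfrak{sl}_2$-modules between $(L_{0,1},\deg_H)$ and $(H_\Pi,\deg_r)$, where $H_\Pi$ is the space of the serpentine representation $\Pi$ of the infinite symmetric group. (b) The serpentine representation is the unique Schur--Weyl representation with this property, in the following sense. Let $\{\alpha_N\}_{N=0,2,4,\dots}$ be a chain of Schur--Weyl embeddings such that each $\alpha_N$ maps vectors homogeneous of degree $d$ for $r_N$ to vectors homogeneous of degree $d$ for $r_{N+2}$ (so that the gradings $r_N$ induce a grading on the inductive limit of the chain), and such that the resulting graded space $\varinjlim((\mathbb C^2)^{\otimes N},\alpha_N)$ admits a grading-preserving unitary isomorphism of $\mathfrak{sl}_2$-modules with $(L_{0,1},\deg_H)$. Then the representation of the infinite symmetric group in this inductive limit is unitarily equivalent to the serpentine representation $\Pi$.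
   Context: Finite level. Let $N=2n$ be even. By Schur--Weyl duality $(\mathbb C^2)^{\otimes N}=\bigoplus_{k=0}^n M_{2k+1}\otimes H_{\pi_k}$ as a module over $\mathfrak{sl}_2$ (or $SL(2,\mathbb C)$) and $\mathfrak S_N$, where $M_{2k+1}$ is the $(2k+1)$-dimensional irreducible $\mathfrak{sl}_2$-module (with $SU(2)$-invariant inner product) and $H_{\pi_k}$ is the irreducible unitary $\mathfrak S_N$-module with Young diagram $(n+k,n-k)$. $H_{\pi_k}$ has an orthonormal Gelfand--Tsetlin (Young orthogonal form) basis indexed by the standard Young tableaux of shape $(n+k,n-k)$. $T_N$ is the set of standard Young tableaux with $N$ cells and at most two rows. Schur--Weyl embeddings and representations. A Schur--Weyl embedding is an isometric embedding $(\mathbb C^2)^{\otimes N}\hookrightarrow(\mathbb C^2)^{\otimes (N+2)}$ equivariant with respect to the actions of $SL(2,\mathbb C)$ and $\mathfrak S_N$. A Schur--Weyl representation is the representation of the infinite symmetric group $\mathfrak S_{\mathbb N}=\bigcup_N\mathfrak S_N$ in the inductive limit of a chain $(\mathbb C^2)^{\otimes 0}\stackrel{\alpha_0}{\hookrightarrow}(\mathbb C^2)^{\otimes 2}\stackrel{\alpha_2}{\hookrightarrow}(\mathbb C^2)^{\otimes 4}\stackrel{\alpha_4}{\hookrightarrow}\cdots$ of Schur--Weyl embeddings. Inductive limits are algebraic (no completion). Serpentine representation. For $\tau\in T_N$ let $i_N(\tau)\in T_{N+2}$ be obtained from $\tau$ by adding the entry $N+1$ to the first row and the entry $N+2$ to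 the second row. Acting as the identity on each $M_{2k+1}$ and as $\tau\mapsto i_N(\tau)$ on tableaux, this defines a Schur--Weyl embedding, also denoted $i_N$. The serpentine representation $\Pi$ is the Schur--Weyl representation in $H_\Pi=\varinjlim((\mathbb C^2)^{\otimes N},i_N)$. One has $H_\Pi=\bigoplus_{k\ge0}M_{2k+1}\otimes H_{\Pi_k}$, where $H_{\Pi_k}$ has orthonormal basis $\mathcal T_k$, the set of infinite standard two-row Young tableaux tail-equivalent to $\tau_k$. Here $\tau_k$ is the infinite tableau with $1,2,\dots,2k,2k+1,2k+3,2k+5,\dots$ in the first row and $2k+2,2k+4,\dots$ in the second row, and two infinite tableaux are tail-equivalent if, for all sufficiently large $l$, their parts formed by the entries $\le l$ have the same shape and entries $>l$ lie in the same positions. Gradings. For $\tau\in T_N$, the major index is $\operatorname{maj}(\tau)=\sum i$, the sum over all $i\le N-1$ such that $i+1$ lies in a lower row of $\tau$ than $i$. For $N=2n$ put $r_N(\tau)=n^2-\operatorname{maj}(\tau)$; this defines a grading on $H_{\pi_k}$ and on $(\mathbb C^2)^{\otimes N}$ (a vector $u\otimes\tau\in M_{2k+1}\otimes H_{\pi_k}$ has degree $r_N(\tau)$). One has $r_{N+2}(i_N(\tau))=r_N(\tau)$. For $\tau\in\bigcup_k\mathcal T_k$ the stable major index is $r(\tau)=\lim_{n\to\infty}(n^2-\operatorname{maj}([\tau]_{2n}))$, where $[\tau]_l$ is formed by the cells of $\tau$ with entries $\le l$. The grading $\deg_r$ on $H_\Pi$ is given by $\deg_r(u\otimes\tau)=r(\tau)$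 for $u\in M_{2k+1}$, $\tau\in\mathcal T_k$. Affine side. $\widehat{\mathfrak{sl}_2}=\mathfrak{sl}_2\otimes\mathbb C[t,t^{-1}]\oplus\mathbb Cc\oplus\mathbb Cd$; $L_{0,1}$ is its basic module (irreducible level $1$ highest weight module with vacuum vector annihilated by $\mathfrak{sl}_2\otimes\mathbb C[t]$), with its standard invariant Hermitian inner product. $\deg_H$ is the homogeneous grading: the vacuum has degree $0$ and $x\otimes t^{-m}$ ($x\in\mathfrak{sl}_2$) raises the degree by $m$. $\mathfrak{sl}_2$ acts on $L_{0,1}$ via $x\mapsto x\otimes 1$, and on the inductive limits through the actions on $(\mathbb C^2)^{\otimes N}$. ''Unitary isomorphism'' means a bijective linear isometry. *)

(* Defs.v *)
From HB Require Import structures.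
From mathcomp Require Import all_boot all_order all_algebra.
From mathcomp Require Import boolp classical_sets complex.

Set Implicit Arguments.
Unset Strict Implicit.
Unset Printing Implicit Defensive.

Import Order.TTheory GRing.Theory Num.Theory.
Local Open Scope ring_scope.
Local Open Scope quotient_scope.

(* ** Two-row tableaux *)

(* A tableau with at most two rows is recorded by the row of each entry, true  *)
(* being the second row: position i holds the row of the entry i.+1, and the   *)
(* column is then the number of smaller entries in the same row.               *)
Definition filling := nat -> bool.

Definition nrow (t : filling) (b : bool) (l : nat) : nat :=
  (\sum_(i < l) (t i == b))%N.

Definition standard (N : nat) (t : filling) : bool :=
  [forall l : 'I_N.+1, (nrow t true l <= nrow t false l)%N].

(* T_N *)
Definition stab (N : nat) : finType :=
  {t : N.-tuple bool | standard N (nth false t)}.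

Definition rows (N : nat) (t : stab N) : filling := nth false (val t).

Definition cell (t : filling) (i : nat) : nat * nat :=
  (nat_of_bool (t i), nrow t (t i) i).

Definition content (t : filling) (i : nat) : int :=
  (cell t i).2%:Z - (cell t i).1%:Z.

Definition same_upto (N : nat) (s t : filling) : bool :=
  [forall i : 'I_N, s i == t i].

(* 2k, for the shape (n + k, n - k) with N = 2n *)
Definition spin2 (N : nat) (t : filling) : nat :=
  (nrow t false N - nrow t true N)%N.

Definition maj (N : nat) (t : filling) : nat :=
  (\sum_(1 <= i < N | ~~ t i.-1 && t i) i)%N.

(* r_N for N = 2n *)
Definition rgrade (n : nat) (t : filling) : int :=
  (n ^ 2)%N%:Z - (maj n.*2 t)%:Z.

Definition add_two (N : nat) (t : filling) : filling :=
  fun i => if (i < N)%N then t i else i == N.+1.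

Definition inf_standard (t : filling) : Prop := forall N, standard N t.

Definition tau (k : nat) : filling := fun i => (k.*2 < i)%N && odd i.

Definition tail_equivalent (s t : filling) : Prop :=
  exists l0, forall l, (l0 <= l)%N ->
    (forall b, nrow s b l = nrow t b l) /\
    (forall i, (l <= i)%N -> cell s i = cell t i).

(* the set \mathcal T_k *)
Definition tail_class (k : nat) (t : filling) : Prop :=
  inf_standard t /\ tail_equivalent t (tau k).

(* r(t) = d; a convergent sequence of integers is eventually constant *)
Definition stable_rgrade (t : filling) (d : int) : Prop :=
  exists n0, forall n, (n0 <= n)%N -> rgrade n t = d.

(* ** Permutations *)

(* Permutations act on positions counted from 0. *)
Record finperm := FinPerm {
  finperm_fun :> nat -> nat;
  _ : bijective finperm_fun;
  _ : exists N, forall i, (N <= i)%N -> finperm_fun i = i }.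

(* the subgroup S_N of S_infinity *)
Definition in_sym (N : nat) (s : finperm) : Prop :=
  forall i, (N <= i)%N -> s i = i.

Definition adj_transp (i : nat) : nat -> nat :=
  [fun j => j with i |-> i.+1, i.+1 |-> i].

Inductive lspan (C : pzRingType) (V : lmodType C) (S : V -> Prop) : V -> Prop :=
| lspan0 : lspan S 0
| lspanD a u v : S u -> lspan S v -> lspan S (a *: u + v).

Section Finite.
Variable C : numClosedFieldType.

Definition hdot (I : finType) (u v : {ffun I -> C^o}) : C :=
  \sum_i u i * (v i)^*.

(* (C^2)^{\otimes N}, in coordinates for the basis of words in e_0, e_1 *)
Definition tensor (N : nat) : vectType C := {ffun N.-tuple 'I_2 -> C^o}.

Definition SL2_tensor N (g : 'M[C]_2) (v : tensor N) : tensor N :=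
  [ffun w : N.-tuple 'I_2 =>
     \sum_(w' : N.-tuple 'I_2) (\prod_(i < N) g (tnth w i) (tnth w' i)) * v w'].

Definition sl2_tensor N (x : 'M[C]_2) (v : tensor N) : tensor N :=
  [ffun w : N.-tuple 'I_2 =>
     \sum_(i < N) \sum_(b < 2)
       x (tnth w i) b * v [tuple (if j == i then b else tnth w j) | j < N]].

Definition perm_tensor N (s : nat -> nat) (v : tensor N) : tensor N :=
  [ffun w : N.-tuple 'I_2 => v [tuple nth ord0 w (s i) | i < N]].

(* M_{d+1}, in coordinates for the orthonormal weight basis u_0, ..., u_d with *)
(* h u_j = (d - 2j) u_j, f u_j = sqrt ((j+1)(d-j)) u_{j+1}                     *)
Definition irrep (d : nat) : vectType C := {ffun 'I_d.+1 -> C^o}.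

Definition irrep_coef (d : nat) (x : 'M[C]_2) (i j : nat) : C :=
  if i == j then x 0 0 * (d%:R - (j.*2)%:R)
  else if i == j.+1 then x 1 0 * sqrtC (i * (d - j))%N%:R
  else if j == i.+1 then x 0 1 * sqrtC (j * (d - i))%N%:R
  else 0.

(* \bigoplus_k M_{2k+1} \otimes H_{\pi_k}, in coordinates for the orthonormal  *)
(* basis u_j \otimes t                                                         *)
Definition sw_index (N : nat) : finType :=
  {t : stab N & 'I_(spin2 N (rows t)).+1}.
Definition sw_sum (N : nat) : vectType C := {ffun sw_index N -> C^o}.

Definition tab N (p : sw_index N) : stab N := tag p.
Definition wt N (p : sw_index N) : nat := tagged p.

Definition sl2_sw N (x : 'M[C]_2) (v : sw_sum N) : sw_sum N :=
  [ffun p : sw_index N =>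
     \sum_(q : sw_index N | tab q == tab p)
       irrep_coef (spin2 N (rows (tab p))) x (wt p) (wt q) * v q].

(* Young's orthogonal form: the coefficient of t in s_i t', where s_i          *)
(* exchanges the entries in positions i and i.+1; r is the axial distance.     *)
Definition young_coef N (i : nat) (t t' : stab N) : C :=
  let r := (content (rows t') i.+1 - content (rows t') i)%:~R in
  if t == t' then r^-1
  else if same_upto N (rows t) (rows t' \o adj_transp i)
  then sqrtC (1 - r ^- 2)
  else 0.

Definition transp_sw N (i : nat) (v : sw_sum N) : sw_sum N :=
  [ffun p : sw_index N =>
     \sum_(q : sw_index N | wt q == wt p) young_coef i (tab p) (tab q) * v q].

Record schur_weyl_iso N (phi : 'Hom(tensor N, sw_sum N)) : Prop := {
  swi_bij : bijective phi;
  swi_isometry : forall u v, hdot (phi u) (phi v) = hdot u v;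
  swi_sl2 : forall x v, \tr x = 0 -> phi (sl2_tensor x v) = sl2_sw x (phi v);
  swi_sym : forall i v, (i.+1 < N)%N ->
    phi (perm_tensor (adj_transp i) v) = transp_sw i (phi v) }.

(* u \otimes [t]_N *)
Definition pure_sw N d (u : irrep d) (t : filling) : sw_sum N :=
  [ffun p : sw_index N =>
     \sum_(j < d.+1 | same_upto N (rows (tab p)) t && (j == wt p :> nat)) u j].

Definition serp_fun N (v : sw_sum N) : sw_sum N.+2 :=
  [ffun p : sw_index N.+2 =>
     \sum_(q : sw_index N |
        same_upto N.+2 (rows (tab p)) (add_two N (rows (tab q))) &&
        (wt q == wt p)) v q].

Lemma serp_fun_is_linear N : linear (@serp_fun N).
Proof.
move=> a u v; apply/ffunP=> p; rewrite !ffunE scaler_sumr -big_split /=.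
by apply: eq_bigr => q _; rewrite !ffunE.
Qed.

HB.instance Definition _ N :=
  GRing.isLinear.Build C (sw_sum N) (sw_sum N.+2) _ (@serp_fun N)
    (@serp_fun_is_linear N).

(* u \otimes t |-> u \otimes i_N(t) *)
Definition serp_sw N : 'Hom(sw_sum N, sw_sum N.+2) := linfun (@serp_fun N).

Definition sw_homog n (d : int) (v : sw_sum n.*2) : Prop :=
  lspan (fun w => exists k (u : irrep k.*2) (t : stab n.*2),
    [/\ spin2 n.*2 (rows t) = k.*2, rgrade n (rows t) = d
      & w = pure_sw n.*2 u (rows t)]) v.

Record schur_weyl_embedding N (a : 'Hom(tensor N, tensor N.+2)) : Prop := {
  swe_isometry : forall u v, hdot (a u) (a v) = hdot u v;
  swe_SL2 : forall g v, \det g = 1 -> a (SL2_tensor g v) = SL2_tensor g (a v);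
  swe_sym : forall (s : finperm) v, in_sym N s ->
    a (perm_tensor s v) = perm_tensor s (a v) }.

Definition chain := forall n, 'Hom(tensor n.*2, tensor n.+1.*2).

Definition schur_weyl_family := forall n, 'Hom(tensor n.*2, sw_sum n.*2).

(* the embedding i_{2n}, transported to the tensor powers *)
Definition serpentine (phi : schur_weyl_family) : chain :=
  fun n => ((phi n.+1)^-1 \o serp_sw n.*2 \o phi n)%VF.

(* the grading r_{2n} on the tensor power *)
Definition tensor_homog (phi : schur_weyl_family) n (d : int)
    (v : tensor n.*2) : Prop :=
  sw_homog d (phi n v).

End Finite.

(* ** The algebraic inductive limit of a chain                                 *)
(* It is realized as the space of eventually compatible sequences modulo       *)
(* eventual equality: v in the n-th space is sent to the class of any sequence *)
(* that takes the value v at n and is compatible from n on.                    *)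

Section IndLim.
Variables (C : numClosedFieldType) (a : chain C).

Definition tseq := forall n, tensor C n.*2.

Definition compatible (x : tseq) : Prop :=
  exists n0, forall n, (n0 <= n)%N -> x n.+1 = a n (x n).

Record thread := Thread { thread_seq : tseq; threadP : compatible thread_seq }.

HB.instance Definition _ := gen_eqMixin thread.
HB.instance Definition _ := gen_choiceMixin thread.

Definition ev_eq (x y : tseq) : Prop :=
  exists n0, forall n, (n0 <= n)%N -> x n = y n.

Definition thread_eq (x y : thread) : bool :=
  `[< ev_eq (thread_seq x) (thread_seq y) >].

Lemma ev_eq_refl x : ev_eq x x.
Proof. by exists 0. Qed.

Lemma ev_eq_sym x y : ev_eq x y -> ev_eq y x.
Proof. by move=> [n0 h]; exists n0 => n /h ->. Qed.

Lemma ev_eq_trans y x z : ev_eq x y -> ev_eq y z -> ev_eq x z.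
Proof.
move=> [n0 h] [n1 h']; exists (maxn n0 n1) => n.
by rewrite geq_max => /andP[/h -> /h' ->].
Qed.

Lemma thread_eq_equiv : equiv_class_of thread_eq.
Proof.
split.
- by move=> x; apply/asboolP; exact: ev_eq_refl.
- by move=> x y; apply/asboolP/asboolP; exact: ev_eq_sym.
- move=> y x z /asboolP h1 /asboolP h2; apply/asboolP.
  exact: ev_eq_trans h1 h2.
Qed.

Canonical thread_equiv := EquivRelPack thread_eq_equiv.

Definition indlim : Type := {eq_quot thread_eq}.
HB.instance Definition _ := Choice.on indlim.

Lemma compatible0 : compatible (fun=> 0).
Proof. by exists 0 => n _; rewrite linear0. Qed.

(* the class of a sequence, 0 if it is not eventually compatible *)
Definition germ (x : tseq) : indlim :=
  if pselect (compatible x) is left h then \pi_({eq_quot thread_eq}) (Thread h)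
  else \pi_({eq_quot thread_eq}) (Thread compatible0).

(* a representative *)
Definition seq_of (q : indlim) : tseq :=
  thread_seq (repr (q : {eq_quot thread_eq})).

Lemma seq_ofP q : compatible (seq_of q).
Proof. exact: threadP. Qed.

Lemma germ_eq x y : compatible x -> ev_eq x y -> germ x = germ y.
Proof.
move=> cx e.
have cy : compatible y.
  case: cx => n0 h; case: e => n1 h'; exists (maxn n0 n1) => n.
  by rewrite geq_max => /andP[/h hn hn1]; rewrite -!h' ?hn // ltnW.
rewrite /germ; case: pselect => // hx; case: pselect => // hy.
by apply/eqmodP/asboolP.
Qed.

Lemma seq_ofK q : germ (seq_of q) = q.
Proof.
rewrite /germ; case: pselect => [h|/(_ (seq_ofP q))] //.
rewrite -[RHS]reprK; apply/eqmodP/asboolP; exact: ev_eq_refl.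
Qed.

Lemma germK x : compatible x -> ev_eq (seq_of (germ x)) x.
Proof.
move=> cx; rewrite /germ; case: pselect => // h.
rewrite /seq_of.
have /eqmodP/asboolP := reprK (\pi_({eq_quot thread_eq}) (Thread h)).
exact.
Qed.

Definition lim_add (p q : indlim) : indlim :=
  germ (fun n => seq_of p n + seq_of q n).
Definition lim_opp (p : indlim) : indlim := germ (fun n => - seq_of p n).
Definition lim_scale (c : C) (p : indlim) : indlim :=
  germ (fun n => c *: seq_of p n).

Lemma compatibleD x y : compatible x -> compatible y ->
  compatible (fun n => x n + y n).
Proof.
move=> [n0 h] [n1 h']; exists (maxn n0 n1) => n.
by rewrite geq_max linearD => /andP[/h -> /h' ->].
Qed.

Lemma compatibleN x : compatible x -> compatible (fun n => - x n).
Proof. by move=> [n0 h]; exists n0 => n /h ->; rewrite linearN. Qed.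

Lemma compatibleZ c x : compatible x -> compatible (fun n => c *: x n).
Proof. by move=> [n0 h]; exists n0 => n /h ->; rewrite linearZ. Qed.

Lemma germD x y : compatible x -> compatible y ->
  germ (fun n => x n + y n) = lim_add (germ x) (germ y).
Proof.
move=> cx cy; apply: germ_eq; first exact: compatibleD.
have [n0 h] := germK cx; have [n1 h'] := germK cy.
exists (maxn n0 n1) => n.
by rewrite geq_max => /andP[/h -> /h' ->].
Qed.

Lemma germN x : compatible x -> germ (fun n => - x n) = lim_opp (germ x).
Proof.
move=> cx; apply: germ_eq; first exact: compatibleN.
by have [n0 h] := germK cx; exists n0 => n /h ->.
Qed.

Lemma germZ c x : compatible x ->
  germ (fun n => c *: x n) = lim_scale c (germ x).
Proof.
move=> cx; apply: germ_eq; first exact: compatibleZ.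
by have [n0 h] := germK cx; exists n0 => n /h ->.
Qed.

Let eq_germ (x y : tseq) : (forall n, x n = y n) -> germ x = germ y.
Proof. by move=> e; congr germ; apply: functional_extensionality_dep. Qed.

Lemma lim_addA : associative lim_add.
Proof.
move=> p q r; rewrite -(seq_ofK p) -(seq_ofK q) -(seq_ofK r).
rewrite -!germD; try by do ?apply: compatibleD; apply: seq_ofP.
by apply: eq_germ => n; rewrite addrA.
Qed.

Lemma lim_addC : commutative lim_add.
Proof. by move=> p q; apply: eq_germ => n; rewrite addrC. Qed.

Lemma lim_add0 : left_id (germ (fun=> 0)) lim_add.
Proof.
move=> p; rewrite -[in LHS](seq_ofK p) -germD; [|exact: compatible0|exact: seq_ofP].
by rewrite -[RHS]seq_ofK; apply: eq_germ => n; rewrite add0r.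
Qed.

Lemma lim_addN : left_inverse (germ (fun=> 0)) lim_opp lim_add.
Proof.
move=> p; rewrite -(seq_ofK p) -germN; last exact: seq_ofP.
rewrite -germD; try by do ?apply: compatibleN; apply: seq_ofP.
by apply: eq_germ => n; rewrite addNr.
Qed.

HB.instance Definition _ :=
  GRing.isZmodule.Build indlim lim_addA lim_addC lim_add0 lim_addN.

Lemma lim_scaleA b c p : lim_scale b (lim_scale c p) = lim_scale (b * c) p.
Proof.
rewrite -(seq_ofK p) -!germZ; try by do ?apply: compatibleZ; apply: seq_ofP.
by apply: eq_germ => n; rewrite scalerA.
Qed.

Lemma lim_scale1 : left_id 1 lim_scale.
Proof.
by move=> p; rewrite -[RHS]seq_ofK; apply: eq_germ => n; rewrite scale1r.
Qed.

Lemma lim_scaleDr : right_distributive lim_scale +%R.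
Proof.
move=> c p q; rewrite -(seq_ofK p) -(seq_ofK q).
change (lim_scale c (lim_add (germ (seq_of p)) (germ (seq_of q))) =
  lim_add (lim_scale c (germ (seq_of p))) (lim_scale c (germ (seq_of q)))).
have [cp cq] := (seq_ofP p, seq_ofP q).
rewrite -germD // -!germZ //; last exact: compatibleD.
rewrite -germD; [|exact: compatibleZ|exact: compatibleZ].
by apply: eq_germ => n; rewrite scalerDr.
Qed.

Lemma lim_scaleDl p : {morph lim_scale^~ p : b c / b + c}.
Proof.
move=> b c /=; rewrite -(seq_ofK p); have cp := seq_ofP p.
change (lim_scale (b + c) (germ (seq_of p)) =
  lim_add (lim_scale b (germ (seq_of p))) (lim_scale c (germ (seq_of p)))).
rewrite -!germZ // -germD; [|exact: compatibleZ|exact: compatibleZ].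
by apply: eq_germ => n; rewrite scalerDl.
Qed.

HB.instance Definition _ :=
  GRing.Zmodule_isLmodule.Build C indlim
    lim_scaleA lim_scale1 lim_scaleDr lim_scaleDl.

(* the common value of the inner products far enough in the chain *)
Definition lim_dot (p q : indlim) : C :=
  xget 0 (fun c => exists n0, forall n, (n0 <= n)%N ->
            hdot (seq_of p n) (seq_of q n) = c).

Definition lim_sl2 (x : 'M[C]_2) (p : indlim) : indlim :=
  germ (fun n => sl2_tensor x (seq_of p n)).

Definition lim_perm (s : finperm) (p : indlim) : indlim :=
  germ (fun n => perm_tensor s (seq_of p n)).

(* the grading induced by the r_{2n}, when the chain preserves them *)
Definition lim_homog (phi : schur_weyl_family C) (d : int) (p : indlim) : Prop :=
  exists x : tseq, [/\ compatible x, p = germ x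
    & exists n0, forall n, (n0 <= n)%N -> tensor_homog phi d (x n)].

End IndLim.

(* deg_r on H_\Pi *)
Definition serp_homog (C : numClosedFieldType) (phi : schur_weyl_family C)
    (d : int) (p : indlim (serpentine phi)) : Prop :=
  lspan (fun q => exists k (u : irrep C k.*2) (t : filling),
    [/\ tail_class k t, stable_rgrade t d
      & q = germ (serpentine phi)
              (fun n => (phi n)^-1%VF (pure_sw n.*2 u t))]) p.

(* ** The affine Lie algebra and its basic module *)

Definition bracket (C : comNzRingType) (x y : 'M[C]_2) : 'M[C]_2 :=
  x *m y - y *m x.

(* loop x m is the action of x \otimes t^m; only traceless x matter. *)
Record affine_module (C : numClosedFieldType) (L : lmodType C) := {
  loop : 'M[C]_2 -> int -> {linear L -> L};
  cen : {linear L -> L};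
  der : {linear L -> L};
  loop_linear : forall c x y m v, \tr x = 0 -> \tr y = 0 ->
    loop (c *: x + y) m v = c *: loop x m v + loop y m v;
  loop_bracket : forall x y m n v, \tr x = 0 -> \tr y = 0 ->
    loop x m (loop y n v) - loop y n (loop x m v) =
    loop (bracket x y) (m + n) v +
    (if m + n == 0 then (m%:~R * \tr (x *m y)) *: cen v else 0);
  cen_loop : forall x m v, \tr x = 0 -> cen (loop x m v) = loop x m (cen v);
  cen_der : forall v, cen (der v) = der (cen v);
  der_loop : forall x m v, \tr x = 0 ->
    der (loop x m v) - loop x m (der v) = m%:~R *: loop x m v }.

Section Affine.
Variables (C : numClosedFieldType) (L : lmodType C) (A : affine_module L).

Definition submodule (W : L -> Prop) : Prop :=
  [/\ W 0, forall c u v, W u -> W v -> W (c *: u + v),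
      forall x m v, \tr x = 0 -> W v -> W (loop A x m v),
      forall v, W v -> W (cen A v)
    & forall v, W v -> W (der A v)].

Definition irreducible_module : Prop :=
  forall W, submodule W -> (forall v, W v -> v = 0) \/ (forall v, W v).

Record basic_module (vac : L) : Prop := {
  vac_neq0 : vac != 0;
  basic_irreducible : irreducible_module;
  basic_level : forall v, cen A v = v;
  vac_loop : forall x m, \tr x = 0 -> 0 <= m -> loop A x m vac = 0;
  vac_der : der A vac = 0 }.

Record invariant_form (form : {dot L for Num.conj}) (vac : L) : Prop := {
  form_loop : forall x m u v, \tr x = 0 ->
    form (loop A x m u) v = form u (loop A (map_mx Num.conj x^T) (- m) v);
  form_cen : forall u v, form (cen A u) v = form u (cen A v);
  form_der : forall u v, form (der A u) v = form u (der A v);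
  form_vac : form vac vac = 1 }.

(* x_1 \otimes t^{-m_1} ... x_r \otimes t^{-m_r} vac, of degree               *)
(* m_1 + ... + m_r                                                             *)
Inductive loop_word (vac : L) : int -> L -> Prop :=
| word_vac : loop_word vac 0 vac
| word_loop x m d v : \tr x = 0 -> loop_word vac d v ->
    loop_word vac (m + d) (loop A x (- m) v).

(* deg_H *)
Definition affine_homog (vac : L) (d : int) : L -> Prop :=
  lspan (loop_word vac d).

End Affine.

Record graded_unitary_iso (C : numClosedFieldType) (U V : lmodType C)
    (dotU : U -> U -> C) (sl2U : 'M[C]_2 -> U -> U) (degU : int -> U -> Prop)
    (dotV : V -> V -> C) (sl2V : 'M[C]_2 -> V -> V) (degV : int -> V -> Prop)
    (F : {linear U -> V}) : Prop := {
  gui_bij : bijective F;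
  gui_isometry : forall u v, dotV (F u) (F v) = dotU u v;
  gui_sl2 : forall x u, \tr x = 0 -> F (sl2U x u) = sl2V x (F u);
  gui_grading : forall d u, degU d u <-> degV d (F u) }.

Record unitary_intertwiner (C : numClosedFieldType) (a b : chain C)
    (T : {linear indlim a -> indlim b}) : Prop := {
  ui_bij : bijective T;
  ui_isometry : forall u v, lim_dot (T u) (T v) = lim_dot u v;
  ui_sym : forall (s : finperm) u, T (lim_perm s u) = lim_perm s (T u) }.

(* Main.v *)
Require Import Defs.
From HB Require Import structures.
From mathcomp Require Import all_boot all_order all_algebra.
From mathcomp Require Import zify ring.
From mathcomp Require Import boolp classical_sets reals complex.

Set Implicit Arguments.
Unset Strict Implicit.
Unset Printing Implicit Defensive.

Import Order.TTheory GRing.Theory Num.Theory.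
Local Open Scope ring_scope.

(** Part (a). Both sides are compared through their graded sl2-structure.

    The basic module. Let v_m be the image of the vacuum under the m-th
    translation of the affine Weyl group: a unit vector of weight 2m and degree
    m^2, annihilated by e_j for j >= -2m, by f_j for j >= 2m and by h_j for j > 0.
    Level 1 and positivity of the form give the identity vertex_relation, which
    expresses every e_j v_m by the operators h_(-k) applied to v_(m+1). So the
    span of the monomials in the h_(-k) applied to the v_m is stable under all
    currents, and is the whole module by irreducibility (fock_spans). These
    monomials are orthogonal. Hence the space of weight 2m and degree d has as its
    dimension the number of partitions of d - m^2, and the multiplicity of spin k
    in degree d is the difference mult k d of two such numbers. Choosing
    orthonormal highest weight vectors and applying f gives an orthonormal basis
    vec of the module (form_vec, wspace_vec_span).

    The tableaux. Two-row words are counted by their major index letter by letter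
    (nballotsE). The count of tableaux of spin k and degree d with 2n cells is a
    difference of two numbers of partitions in a box (size_tabs), and it equals
    mult k d once n is large. The embedding i_N preserves spin and degree, so the
    lists tabs of these tableaux can be chosen to extend each other; the position
    in the list numbers the infinite tableaux of spin k and degree d by the
    integers below mult k d. Sending u_j (x) t to the string vector with that
    number is compatible with the chain, isometric, equivariant and onto, and its
    inverse is the isomorphism (serp_iso).

    Part (b). In the coordinates u_j (x) t, a homogeneous Schur-Weyl embedding
    commutes with the Jucys-Murphy elements, which act on tableaux by contents
    (jmE), so the image of u_j (x) t involves only tableaux that extend t by two
    cells. Among the at most four extensions only i_N(t) has the degree of t
    (maj_add_two_inv). Commuting with one element of the torus, the embedding
    preserves j. So it is i_N up to a phase on each basis vector (betaE), and the
    phase depends on the shape and on j only, because any two tableaux of the same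
    shape are linked by exchanges of consecutive entries (swap_connected).
    Multiplying by the inverse of the accumulated phases commutes with the
    symmetric groups and turns the given chain into the serpentine one
    (tw_chain). *)

(** * Linear spans *)

Section Span.
Variables (C : pzRingType) (V : lmodType C).
Implicit Types (S T : V -> Prop).

Lemma lspan_mem S u : S u -> lspan S u.
Proof. by move=> Su; have := lspanD 1 Su (lspan0 S); rewrite scale1r addr0. Qed.

Lemma lspan_add S u v : lspan S u -> lspan S v -> lspan S (u + v).
Proof.
move=> + Sv; elim=> [|a x y Sx _ IH]; first by rewrite add0r.
by rewrite -addrA; apply: lspanD.
Qed.

Lemma lspan_scale S c u : lspan S u -> lspan S (c *: u).
Proof.
elim=> [|a x y Sx _ IH]; first by rewrite scaler0; apply: lspan0.
by rewrite scalerDr scalerA; apply: lspanD.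
Qed.

Lemma lspan_opp S u : lspan S u -> lspan S (- u).
Proof. by rewrite -scaleN1r; apply: lspan_scale. Qed.

Lemma lspan_sub S u v : lspan S u -> lspan S v -> lspan S (u - v).
Proof. by move=> Su Sv; apply: lspan_add (lspan_opp Sv). Qed.

Lemma lspan_sum S (I : Type) (r : seq I) (P : pred I) (F : I -> V) :
  (forall i, P i -> lspan S (F i)) -> lspan S (\sum_(i <- r | P i) F i).
Proof.
move=> SF; elim/big_rec: _ => [|i x Pi Sx]; first exact: lspan0.
exact: lspan_add (SF i Pi) Sx.
Qed.

End Span.

Lemma lspan_map (C : pzRingType) (U V : lmodType C) (g : {linear U -> V})
    (S : U -> Prop) (T : V -> Prop) u :
  (forall w, S w -> lspan T (g w)) -> lspan S u -> lspan T (g u).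
Proof.
move=> ST; elim=> [|a x y Sx _ IH]; first by rewrite linear0; apply: lspan0.
by rewrite linearP; apply: lspan_add IH; apply/lspan_scale/ST.
Qed.

(** * Extremal vectors and their Fock spaces *)

Definition opp_h (C : numClosedFieldType) (L : lmodType C)
    (h : int -> {linear L -> L}) : int -> {linear L -> L} := fun m => \- h m.
Arguments opp_h : simpl never.

Section Level1.
Variables (C : numClosedFieldType) (L : lmodType C).
Variable form : {dot L for Num.conj}.
Implicit Types (e f h : int -> {linear L -> L}).

Lemma dot_conj u v : form u v = (form v u)^*.
Proof. by rewrite hermC expr0 mul1r. Qed.

Lemma dotZl c u v : form (c *: u) v = c * form u v.
Proof. exact: linearZl_LR. Qed.

Lemma dotZr c u v : form u (c *: v) = c^* * form u v.
Proof. exact: linearZr_LR. Qed.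

Lemma dotBl u v w : form (u - v) w = form u w - form v w.
Proof. exact: linearBl. Qed.

Lemma dot_suml (I : Type) (r : seq I) (P : pred I) (F : I -> L) v :
  form (\sum_(i <- r | P i) F i) v = \sum_(i <- r | P i) form (F i) v.
Proof. exact: linear_sumlz. Qed.

Lemma dot_sumr (I : Type) (r : seq I) (P : pred I) (F : I -> L) u :
  form u (\sum_(i <- r | P i) F i) = \sum_(i <- r | P i) form u (F i).
Proof. exact: linear_sumr. Qed.

(** The currents of the affine algebra at level 1, with the adjunctions of the
    unitary form. They are taken apart from the module so that every result can
    be applied again after exchanging e and f. *)
Record level_one e f h : Prop := {
  comm_hh : forall m n v, h m (h n v) =
    h n (h m v) + (if m + n == 0 then 2 * m%:~R else 0) *: v;
  comm_he : forall m n v, h m (e n v) = e n (h m v) + 2 *: e (m + n) v;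
  comm_hf : forall m n v, h m (f n v) = f n (h m v) - 2 *: f (m + n) v;
  comm_ef : forall m n v, e m (f n v) =
    f n (e m v) + h (m + n) v + (if m + n == 0 then m%:~R else 0) *: v;
  comm_ee : forall m n v, e m (e n v) = e n (e m v);
  comm_ff : forall m n v, f m (f n v) = f n (f m v);
  adj_e : forall m u v, form (e m u) v = form u (f (- m) v);
  adj_f : forall m u v, form (f m u) v = form u (e (- m) v);
  adj_h : forall m u v, form (h m u) v = form u (h (- m) v) }.

Lemma opp_hE h m v : opp_h h m v = - h m v.
Proof. by []. Qed.

(** The Chevalley involution: it turns every statement about the currents e
    into one about the currents f. *)
Lemma level_one_swap e f h : level_one e f h -> level_one f e (opp_h h).
Proof.
move=> [hh he hf ef ee ff ae af ah]; split=> //.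
- by move=> m n v; rewrite !opp_hE (linearN (h m)) (linearN (h n)) !opprK hh.
- by move=> m n v; rewrite !opp_hE hf opprD opprK (linearN (f n)).
- by move=> m n v; rewrite !opp_hE he opprD (linearN (e n)).
- move=> m n v; rewrite opp_hE ef [n + m]addrC -!addrA.
  rewrite [X in _ + (_ + X)]addrCA addNKr -scalerDl.
  case: eqP => [mn|_]; last by rewrite addr0 scale0r addr0.
  by rewrite -intrD [n + m]addrC mn scale0r addr0.
- by move=> m u v; rewrite !opp_hE (linearNl form) (linearNr form); congr (- _); apply: ah.
Qed.

(** The conditions on the vacuum, transported by the m-th translation of the
    affine Weyl group. *)
Record extremal e f h (m : int) (v : L) : Prop := {
  ext_e : forall j, - 2 * m <= j -> e j v = 0;
  ext_f : forall j, 2 * m <= j -> f j v = 0;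
  ext_h : forall j, 0 < j -> h j v = 0;
  ext_h0 : h 0 v = (2 * m)%:~R *: v;
  ext_norm : form v v = 1 }.

Lemma extremal_swap e f h m v :
  extremal e f h m v -> extremal f e (opp_h h) (- m) v.
Proof.
move=> [ee ef eh eh0 en]; split=> // [j hj|j hj|j hj|].
- by apply: ef; lia.
- by apply: ee; lia.
- by rewrite opp_hE eh // oppr0.
- by rewrite opp_hE eh0 mulrN mulrNz scaleNr.
Qed.

Section Theory.
Variables (e f h : int -> {linear L -> L}).
Hypothesis lv1 : level_one e f h.

Lemma comm_fe m n v : f n (e m v) =
  e m (f n v) - h (m + n) v - (if m + n == 0 then m%:~R else 0) *: v.
Proof. by rewrite (comm_ef lv1) -!addrA [X in _ + X]addrCA addNKr addrN addr0. Qed.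

(** Positivity: the squared norm of e_a u is the product of u and f_(-a) e_a u. *)
Lemma norm_e0 a u : f (- a) (e a u) = 0 -> e a u = 0.
Proof. by move=> fe0; apply/eqP; rewrite -(dnorm_eq0 form) (adj_e lv1) fe0 linear0r. Qed.

(** With a = -2m-1, the commutator of e_a and f_(-a) is h_0 + a, which acts on v
    by -1. *)
Lemma fe_extremal m v : extremal e f h m v ->
  f (2 * m + 1) (e (- 2 * m - 1) v) = v.
Proof.
move=> [ee ef eh eh0 en]; rewrite comm_fe ef; last by lia.
have -> : (- 2 * m - 1 + (2 * m + 1) = 0 :> int) by lia.
rewrite eqxx eh0 linear0 sub0r -opprD -scalerDl -scaleNr -intrD -mulrNz.
by rewrite (_ : - (2 * m + _) = 1) ?scale1r //; lia.
Qed.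

(** With a = -2m-1, the vector v has weight -1 for the sl2-triple of e_a and
    f_(-a), whence e_a e_a v = 0; the vector e_(a-1) e_a v has norm 0 in the same
    way. All other conditions follow from the commutation rules. *)
Lemma extremal_next m v : extremal e f h m v ->
  extremal e f h (m + 1) (e (- 2 * m - 1) v).
Proof.
move=> ev; have [ee ef eh eh0 en] := ev; have fev := fe_extremal ev.
set a := - 2 * m - 1; have aN : - a = 2 * m + 1 by rewrite /a; lia.
have h0ea : h 0 (e a v) = (2 * (m + 1))%:~R *: e a v.
  rewrite (comm_he lv1) eh0 linearZ /= add0r -scalerDl.
  by congr (_ *: _); rewrite mulrDr intrD.
split=> //.
- move=> j hj; have [|] := ltP a j => ja.
    by rewrite (comm_ee lv1) ee ?linear0 //; rewrite /a in ja *; lia.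
  have [->|->] : j = a \/ j = a - 1 by lia.
  + apply: norm_e0; rewrite comm_fe {1}aN fev subrr eqxx h0ea.
    rewrite -{1}[e a v]scale1r -!scalerBl.
    have -> : 1 - (2 * (m + 1))%:~R - a%:~R = 0 :> C.
      by rewrite -[1]/(1%:~R) -!intrB (_ : _ - a = 0) //; lia.
    by rewrite scale0r.
  + apply: norm_e0; rewrite comm_fe subrr eqxx h0ea comm_fe ef; last by lia.
    rewrite ifF; last by apply/eqP; lia.
    rewrite eh; last by lia.
    rewrite scale0r !subr0 !linear0 sub0r -opprD -scalerDl -scaleNr -intrD -mulrNz.
    by rewrite (_ : - (2 * (m + 1) + _) = 0) ?scale0r //; lia.
- move=> j hj; rewrite comm_fe ef ?linear0 ?eh; try by lia.
  by rewrite ifF ?scale0r ?subr0 //; apply/eqP; lia.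
- by move=> j hj; rewrite (comm_he lv1) eh // ee ?linear0 ?scaler0 ?addr0 //; lia.
- by rewrite (adj_e lv1) aN fev.
Qed.

(** Coefficientwise, and on an extremal vector, this is the differential equation
    d/dz e(z) = :h(z) e(z): of the level 1 vertex operator. No vertex operator is
    needed: the difference u of the two sides is killed by the h_l with l > 0, by
    induction on r, and by f_(r-a), the adjoint of the current in its first term,
    where a = -2m-1; so its norm is 0. *)
Lemma vertex_relation m v (r : nat) : extremal e f h m v ->
  r%:R *: e (- 2 * m - 1 - r%:Z) v =
  \sum_(1 <= k < r.+1) h (- k%:Z) (e (- 2 * m - 1 - r%:Z + k%:Z) v).
Proof.
move=> ev; have [ee ef eh eh0 en] := ev; set a := - 2 * m - 1.
pose u q := q%:R *: e (a - q%:Z) v -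
  \sum_(1 <= k < q.+1) h (- k%:Z) (e (a - q%:Z + k%:Z) v).
suff: u r = 0 by move/eqP; rewrite subr_eq0 => /eqP.
elim/ltn_ind: r => r IH.
have he j q : 0 < j -> h j (e q v) = 2 *: e (j + q) v.
  by move=> j0; rewrite (comm_he lv1) eh // linear0 add0r.
(* h_l maps the difference of index r to twice the one of index r - l. *)
have hu (l : nat) : (0 < l)%N -> h l (u r) = 0.
  move=> l0; rewrite /u linearB linearZ /= linear_sum /= he //.
  under eq_bigr => k _ do rewrite (comm_hh lv1) he // linearZ /= subr_eq0.
  rewrite big_split /= -scaler_sumr.
  have [rl|lr] := ltnP r l.
    rewrite ee /a; last by lia.
    rewrite scaler0 scaler0 sub0r.
    rewrite big_nat big1 ?scaler0 ?add0r; last first.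
      by move=> k kr; rewrite ee ?linear0 //; lia.
    rewrite big1 ?oppr0 // => k kr.
    by rewrite ifF ?scale0r //; apply/eqP; lia.
  have -> : \sum_(1 <= k < r.+1) (if l%:Z == k then 2 * l%:~R else 0) *:
              e (a - r%:Z + k%:Z) v = (2 * l%:R) *: e (a - r%:Z + l%:Z) v.
    rewrite (bigD1_seq l) ?mem_index_iota ?iota_uniq //=; last by lia.
    rewrite eqxx big1 ?addr0 // => k kl.
    by rewrite ifF ?scale0r //; apply/eqP => -[lk]; rewrite lk eqxx in kl.
  have -> : \sum_(1 <= k < r.+1) h (- k%:Z) (e (l%:Z + (a - r%:Z + k%:Z)) v) =
            \sum_(1 <= k < (r - l).+1) h (- k%:Z) (e (a - (r - l)%N%:Z + k%:Z) v).
    rewrite (@big_cat_nat _ _ _ (r - l).+1) //=; last by lia.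
    rewrite [X in _ + X]big_nat [X in _ + X]big1 ?addr0; last first.
      by move=> k kr; rewrite ee ?linear0 // /a; lia.
    by apply: eq_bigr => k _; congr (h _ (e _ _)); lia.
  have -> : l%:Z + (a - r%:Z) = a - (r - l)%N%:Z by lia.
  have -> : a - r%:Z + l%:Z = a - (r - l)%N%:Z by lia.
  have := IH (r - l)%N; rewrite /u => /(_ ltac:(lia)) /eqP.
  rewrite subr_eq0 => /eqP <-.
  rewrite !scalerA -scalerDl -scalerBl natrB //.
  have -> : r%:R * 2 - (2 * (r%:R - l%:R) + 2 * l%:R) = 0 :> C by ring.
  by rewrite scale0r.
(* The two terms are r (r + 1) v and the sum of the 2 (r + 1 - k) v. *)
have fu : f (r%:Z - a) (u r) = 0.
  rewrite /u linearB linearZ /= linear_sum /= comm_fe subrKA subrr eqxx ef; last by lia.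
  rewrite linear0 sub0r eh0 -opprD -scalerDl -scaleNr.
  have hk k : (1 <= k < r.+1)%N -> f (r%:Z - a) (h (- k%:Z) (e (a - r%:Z + k%:Z) v)) =
     (2 * (r%:R + 1 - k%:R)) *: v - h (- k%:Z) (h k v).
    move=> kr; have := comm_hf lv1 (- k%:Z) (r%:Z - a) (e (a - r%:Z + k%:Z) v).
    move/eqP; rewrite eq_sym subr_eq => /eqP ->.
    rewrite !comm_fe !ef /a; [|by lia..].
    rewrite !linear0 !sub0r.
    have -> : a - r%:Z + k%:Z + (r%:Z - a) = k by lia.
    have -> : a - r%:Z + k%:Z + (- k%:Z + (r%:Z - a)) = 0 by lia.
    rewrite eqxx ifF; last by apply/eqP; lia.
    rewrite scale0r subr0 eh0 linearN /= addrC -opprD -scalerDl -scaleNr scalerA.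
    congr (_ *: _ - _); rewrite intrD intrB /a !(intrB, intrM) /=; ring.
  rewrite big_nat (eq_bigr _ hk) -big_nat.
  have -> : \sum_(1 <= k < r.+1) ((2 * (r%:R + 1 - k%:R)) *: v - h (- k%:Z) (h k v))
     = (r%:R * (r%:R + 1)) *: v.
    rewrite big_nat (eq_bigr (fun k => (2 * (r%:R + 1 - k%:R)) *: v)); last first.
      by move=> k kr; rewrite eh ?linear0 ?oppr0 ?addr0 //; lia.
    rewrite -big_nat -scaler_suml; congr (_ *: _).
    elim: (r) => [|q IHq]; first by rewrite big_geq ?mul0r.
    rewrite big_nat_recr //= (eq_bigr (fun k => 2 * (q%:R + 1 - k%:R) + 2)); last first.
      by move=> k _; rewrite -[q.+1%:R]natr1; ring.
    rewrite big_split /= IHq sumr_const_nat subn1 /= -natr1 -mulr_natr; ring.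
  rewrite scalerA -scalerBl; apply/eqP; rewrite scaler_eq0; apply/orP; left.
  by apply/eqP; rewrite /a !(intrB, intrM) /=; ring.
apply/eqP; rewrite -(dnorm_eq0 form) {1}/u linearBl linearZl_LR /= linear_sumlz /=.
rewrite (adj_e lv1) (_ : - (a - r%:Z) = r%:Z - a); last by lia.
rewrite fu linear0r mulr0 sub0r big_nat big1 ?oppr0 // => k kr.
by rewrite (adj_h lv1) opprK hu ?linear0r //; lia.
Qed.

End Theory.
End Level1.

Section Fock.
Variables (C : numClosedFieldType) (L : lmodType C).
Variable form : {dot L for Num.conj}.
Implicit Types (e f h : int -> {linear L -> L}).

Definition hmon h (la : seq nat) (v : L) : L :=
  foldr (fun k x => h (- k%:Z) x) v la.

Definition fock h (v : L) : L -> Prop :=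
  lspan (fun w => exists2 la : seq nat, 0%N \notin la & w = hmon h la v).

Lemma fock_h h v (k : nat) w : (0 < k)%N ->
  fock h v w -> fock h v (h (- k%:Z) w).
Proof.
move=> k0; apply: lspan_map => _ [la la0 ->]; apply: lspan_mem.
by exists (k :: la) => //; rewrite inE negb_or la0 andbT; lia.
Qed.

Lemma fock_opp_h h v w : fock (opp_h h) v w -> fock h v w.
Proof.
have oppE la : hmon (opp_h h) la v = (-1) ^+ size la *: hmon h la v.
  elim: la => [|k la IH] /=; first by rewrite scale1r.
  by rewrite IH linearZ /= exprS mulN1r scaleNr.
apply: (lspan_map (g := idfun)) => _ [la la0 ->] /=; rewrite oppE.
by apply/lspan_scale/lspan_mem; exists la.
Qed.

Section Theory.
Variables (e f h : int -> {linear L -> L}) (m : int) (v : L).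
Hypothesis lv1 : level_one form e f h.
Hypothesis ev : extremal form e f h m v.

(** By the vertex relation, e_(a-r) v is a combination of the h_(-k) e_(a-r+k) v,
    down to e_a v, which is the next extremal vector. *)
Lemma fock_e_extremal j : fock h (e (- 2 * m - 1) v) (e j v).
Proof.
have [hj|hj] := leP (- 2 * m) j; first by rewrite (ext_e ev hj); apply: lspan0.
have {hj} [r ->] : exists r : nat, j = - 2 * m - 1 - r%:Z.
  by exists (absz (- 2 * m - 1 - j)%R); lia.
elim/ltn_ind: r => -[|r] IH.
  by rewrite subr0; apply: lspan_mem; exists [::].
rewrite -[X in fock _ _ X](scalerK (a := r.+1%:R)) ?pnatr_eq0 //.
rewrite (vertex_relation lv1) // big_nat.
apply/lspan_scale/lspan_sum => k kr; apply: fock_h; first by lia.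
have -> : - 2 * m - 1 - r.+1%:Z + k%:Z = - 2 * m - 1 - (r.+1 - k)%N%:Z by lia.
by apply: IH; lia.
Qed.

(** The commutator of e_j with h_(-k) is again a current e. *)
Lemma fock_e j w : fock h v w -> fock h (e (- 2 * m - 1) v) (e j w).
Proof.
apply: lspan_map => _ [la la0 ->]; elim: la j la0 => [|k la IH] j /=.
  by move=> _; apply: fock_e_extremal.
rewrite inE negb_or => /andP[k0 la0].
have -> : e j (h (- k%:Z) (hmon h la v)) =
    h (- k%:Z) (e j (hmon h la v)) - 2 *: e (- k%:Z + j) (hmon h la v).
  by rewrite (comm_he lv1) addrK.
apply: lspan_sub; last exact/lspan_scale/IH.
by apply: fock_h; [lia | apply: IH].
Qed.

Lemma hmon_rem (s : nat) la : s \in la ->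
  hmon h la v = h (- s%:Z) (hmon h (rem s la) v).
Proof.
have swap k l (w : L) : h (- k%:Z) (h (- l%:Z) w) = h (- l%:Z) (h (- k%:Z) w).
  rewrite (comm_hh lv1); case: eqP => [kl|_]; last by rewrite scale0r addr0.
  by rewrite (_ : - k%:Z = 0) ?mulr0 ?scale0r ?addr0 //; lia.
elim: la => [//|k la IH]; rewrite inE /= eq_sym; case: eqP => [-> //|_ /= /IH ->].
exact: swap.
Qed.

Lemma hmon_perm la mu : perm_eq la mu -> hmon h la v = hmon h mu v.
Proof.
elim: la mu => [|k la IH] mu; first by rewrite perm_sym => /perm_nilP->.
move=> pe; have kmu : k \in mu by rewrite -(perm_mem pe) mem_head.
rewrite (hmon_rem kmu) /= (IH (rem k mu)) //.
by rewrite -(perm_cons k) (perm_trans pe) // perm_to_rem.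
Qed.

(** The operator h_s is 2 s times the derivative in the variable h_(-s). *)
Lemma annihilate_hmon (s : nat) la : (0 < s)%N ->
  h s (hmon h la v) = (2 * s * count_mem s la)%N%:R *: hmon h (rem s la) v.
Proof.
move=> s0; have nrem k (w : L) : h s (h (- k%:Z) w) =
    h (- k%:Z) (h s w) + (if k == s then (2 * s)%N%:R else 0) *: w.
  rewrite (comm_hh lv1) natrM subr_eq0 eq_sym.
  by case: eqP => [[->]|ks]; [rewrite eqxx | case: eqP => // ks'; case: ks; lia].
elim: la => [|k la IH] /=; first by rewrite (ext_h ev) ?muln0 ?scale0r.
rewrite nrem IH linearZ /=; case: eqP => [->|_]; last by rewrite scale0r addr0.
have [sla|sla] := boolP (s \in la).
  by rewrite -(hmon_rem sla) -scalerDl -natrD; congr (_%:R *: _); lia.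
by rewrite (count_memPn sla) muln0 scale0r add0r muln1.
Qed.

Lemma form_hmon_cons (s : nat) la mu : (0 < s)%N ->
  form (hmon h (s :: la) v) (hmon h mu v) =
  (2 * s * count_mem s mu)%N%:R * form (hmon h la v) (hmon h (rem s mu) v).
Proof.
move=> s0; rewrite /= (adj_h lv1) opprK annihilate_hmon // linearZr_LR /=.
by rewrite conjC_nat.
Qed.

(** Hence the monomials of a Fock space are orthogonal. *)
Lemma form_hmon_neq la mu : 0%N \notin la -> 0%N \notin mu ->
  ~~ perm_eq la mu -> form (hmon h la v) (hmon h mu v) = 0.
Proof.
elim: la mu => [|s la IH] mu.
  case: mu => // s mu _; rewrite inE negb_or => /andP[s0 mu0] _.
  rewrite dot_conj form_hmon_cons; last by lia.
  by rewrite muln0 mul0r conjC0.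
rewrite inE negb_or => /andP[s0 la0] mu0 npe; rewrite form_hmon_cons; last by lia.
have [smu|smu] := boolP (s \in mu); last by rewrite (count_memPn smu) muln0 mul0r.
rewrite IH ?mulr0 //; first by apply: contra mu0; apply: mem_rem.
apply: contra npe => pe; rewrite perm_sym (perm_trans (perm_to_rem smu)) //.
by rewrite perm_cons perm_sym.
Qed.

Lemma form_hmon_gt0 la : 0%N \notin la -> 0 < form (hmon h la v) (hmon h la v).
Proof.
elim: la => [|s la IH]; first by rewrite (ext_norm ev) ltr01.
rewrite inE negb_or => /andP[s0 /IH la0]; rewrite form_hmon_cons; last by lia.
by rewrite /= eqxx mulr_gt0 // ltr0n; lia.
Qed.

End Theory.
End Fock.

(** * The basic module *)

Section Sl2Matrices.
Variable C : numClosedFieldType.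

Definition mxE2 : 'M[C]_2 := delta_mx 0 1.
Definition mxF2 : 'M[C]_2 := delta_mx 1 0.
Definition mxH2 : 'M[C]_2 := delta_mx 0 0 - delta_mx 1 1.

Lemma ord2_eq1 : lift ord0 ord0 = 1 :> 'I_2. Proof. exact: val_inj. Qed.

Lemma mxtrace2 (x : 'M[C]_2) : \tr x = x 0 0 + x 1 1.
Proof. by rewrite /mxtrace !big_ord_recl big_ord0 addr0 ord2_eq1. Qed.

Lemma mulmx2 (x y : 'M[C]_2) i j : (x *m y) i j = x i 0 * y 0 j + x i 1 * y 1 j.
Proof. by rewrite mxE !big_ord_recl big_ord0 addr0 ord2_eq1. Qed.

Lemma mx2P (x y : 'M[C]_2) : [/\ x 0 0 = y 0 0, x 0 1 = y 0 1,
  x 1 0 = y 1 0 & x 1 1 = y 1 1] -> x = y.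
Proof.
case=> h00 h01 h10 h11; apply/matrixP => i j.
by case: (unliftP 0 i) => [k|] ->; case: (unliftP 0 j) => [l|] ->;
  rewrite ?ord1 ?ord2_eq1.
Qed.

Lemma traceless_sl2 (x : 'M[C]_2) : \tr x = 0 ->
  x = x 0 1 *: mxE2 + (x 1 0 *: mxF2 + (x 0 0 *: mxH2 + 0)).
Proof.
rewrite mxtrace2 addrC => /eqP; rewrite addr_eq0 => /eqP tx.
by apply: mx2P; split; rewrite !mxE /= ?tx; ring.
Qed.

Lemma bracket_ef : bracket mxE2 mxF2 = mxH2.
Proof. by apply: mx2P; split; rewrite /bracket mxE [X in _ + X]mxE !mulmx2 !mxE /=; ring. Qed.
Lemma bracket_he : bracket mxH2 mxE2 = 2 *: mxE2.
Proof. by apply: mx2P; split; rewrite /bracket mxE [X in _ + X]mxE !mulmx2 !mxE /=; ring. Qed.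
Lemma bracket_hf : bracket mxH2 mxF2 = - 2 *: mxF2.
Proof. by apply: mx2P; split; rewrite /bracket mxE [X in _ + X]mxE !mulmx2 !mxE /=; ring. Qed.
Lemma bracket_xx (x : 'M[C]_2) : bracket x x = 0.
Proof. exact: subrr. Qed.

Lemma mxtrace_sl2 : [/\ \tr mxE2 = 0, \tr mxF2 = 0 & \tr mxH2 = 0].
Proof. by split; rewrite mxtrace2 !mxE /=; ring. Qed.

Lemma mxtrace_mul_sl2 : [/\ \tr (mxE2 *m mxF2) = 1, \tr (mxH2 *m mxH2) = 2,
  \tr (mxE2 *m mxE2) = 0 & \tr (mxF2 *m mxF2) = 0] /\
  \tr (mxH2 *m mxE2) = 0 /\ \tr (mxH2 *m mxF2) = 0.
Proof. by do !split; rewrite mxtrace2 !mulmx2 !mxE /=; ring. Qed.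

Lemma adjoint_sl2 : [/\ map_mx Num.conj mxE2^T = mxF2,
  map_mx Num.conj mxF2^T = mxE2 & map_mx Num.conj mxH2^T = mxH2].
Proof.
by split; apply: mx2P; split;
  rewrite !mxE /= ?subr0 ?sub0r ?oppr0 ?rmorphN ?rmorph0 ?rmorph1.
Qed.

End Sl2Matrices.

Section Basic.
Variables (C : numClosedFieldType) (L : lmodType C) (A : affine_module L).
Variables (vac : L) (form : {dot L for Num.conj}).
Hypothesis hL : basic_module A vac.
Hypothesis hform : invariant_form A form vac.

Definition cur_e : int -> {linear L -> L} := loop A (mxE2 C).
Definition cur_f : int -> {linear L -> L} := loop A (mxF2 C).
Definition cur_h : int -> {linear L -> L} := loop A (mxH2 C).

Lemma loop_mx0 m v : loop A 0 m v = 0.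
Proof.
have := loop_linear A 1 m v (mxtrace0 C 2) (mxtrace0 C 2).
rewrite !scale1r addr0 => /eqP; rewrite -subr_eq0 opprD addrA subrr sub0r.
by rewrite oppr_eq0 => /eqP.
Qed.

Lemma loop_scale c x m v : \tr x = 0 -> loop A (c *: x) m v = c *: loop A x m v.
Proof.
move=> tx; have := loop_linear A c m v tx (mxtrace0 C 2).
by rewrite loop_mx0 !addr0.
Qed.

(** Statements about all traceless matrices reduce to the three currents. *)
Lemma loop_sl2 x m v : \tr x = 0 ->
  loop A x m v = x 0 1 *: cur_e m v + x 1 0 *: cur_f m v + x 0 0 *: cur_h m v.
Proof.
have [tE tF tH] := mxtrace_sl2 C.
move=> tx; rewrite [in LHS](traceless_sl2 tx).
by rewrite !loop_linear ?loop_mx0 ?addr0 ?addrA // ?mxtraceD ?mxtraceZ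
  ?tE ?tF ?tH ?mxtrace0 ?mulr0 ?addr0.
Qed.

Lemma loop_comm x y m n v : \tr x = 0 -> \tr y = 0 ->
  loop A x m (loop A y n v) = loop A y n (loop A x m v) +
    loop A (bracket x y) (m + n) v +
    (if m + n == 0 then m%:~R * \tr (x *m y) else 0) *: v.
Proof.
move=> tx ty; have /eqP := loop_bracket A m n v tx ty.
rewrite subr_eq addrC => /eqP ->; rewrite addrA (basic_level hL).
by case: ifP; rewrite ?scale0r.
Qed.

Lemma level_one_basic : level_one form cur_e cur_f cur_h.
Proof.
have [tE tF tH] := mxtrace_sl2 C.
have [[tEF tHH tEE tFF] [tHE tHF]] := mxtrace_mul_sl2 C.
have [aE aF aH] := adjoint_sl2 C.
split.
- move=> m n v; rewrite /cur_h loop_comm // bracket_xx loop_mx0 addr0 tHH.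
  by rewrite mulrC.
- move=> m n v; rewrite /cur_h /cur_e loop_comm // bracket_he loop_scale // tHE.
  by rewrite mulr0 if_same scale0r addr0.
- move=> m n v; rewrite /cur_h /cur_f loop_comm // bracket_hf loop_scale // tHF.
  by rewrite mulr0 if_same scale0r addr0 scaleNr.
- move=> m n v; rewrite /cur_e /cur_f /cur_h loop_comm // bracket_ef tEF.
  by rewrite mulr1.
- move=> m n v; rewrite /cur_e loop_comm // bracket_xx loop_mx0 tEE.
  by rewrite mulr0 if_same scale0r !addr0.
- move=> m n v; rewrite /cur_f loop_comm // bracket_xx loop_mx0 tFF.
  by rewrite mulr0 if_same scale0r !addr0.
- by move=> m u v; rewrite (form_loop hform) // aE.
- by move=> m u v; rewrite (form_loop hform) // aF.
- by move=> m u v; rewrite (form_loop hform) // aH.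
Qed.
Let lv1 := level_one_basic.

Fixpoint ext_pos (n : nat) : L :=
  if n is n'.+1 then cur_e (- 2 * n'%:Z - 1) (ext_pos n') else vac.
Fixpoint ext_neg (n : nat) : L :=
  if n is n'.+1 then cur_f (- 2 * n'%:Z - 1) (ext_neg n') else vac.

(** The orbit of the vacuum under the translations of the affine Weyl group. *)
Definition ext_vec (m : int) : L :=
  match m with Posz n => ext_pos n | Negz n => ext_neg n.+1 end.

Lemma extremal_vac : extremal form cur_e cur_f cur_h 0 vac.
Proof.
have [tE tF tH] := mxtrace_sl2 C.
split.
- by move=> j; rewrite mulr0 => j0; apply: (vac_loop hL).
- by move=> j; rewrite mulr0 => j0; apply: (vac_loop hL).
- by move=> j /ltW j0; apply: (vac_loop hL).
- by rewrite mulr0 scale0r; apply: (vac_loop hL).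
- exact: form_vac hform.
Qed.

Lemma extremal_ext_vec m : extremal form cur_e cur_f cur_h m (ext_vec m).
Proof.
case: m => n /=.
  elim: n => [|n IH]; first exact: extremal_vac.
  rewrite (_ : n.+1%:Z = n%:Z + 1) /=; last by lia.
  exact: (extremal_next lv1 IH).
suff H k : extremal form cur_f cur_e (opp_h cur_h) k%:Z (ext_neg k).
  rewrite NegzE; have := extremal_swap (H n.+1).
  move=> [ee ef eh eh0 en]; split => //.
  - by move=> j /eh; rewrite !opp_hE opprK.
  - by move: eh0; rewrite !opp_hE opprK.
elim: k => [|k IH]; first by have := extremal_swap extremal_vac; rewrite oppr0.
rewrite (_ : k.+1%:Z = k%:Z + 1); last by lia.
exact: (extremal_next (level_one_swap lv1) IH).
Qed.

Lemma extremal_ext_vecN m :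
  extremal form cur_f cur_e (opp_h cur_h) (- m) (ext_vec m).
Proof. exact/extremal_swap/extremal_ext_vec. Qed.

Lemma ext_vec_negE n : ext_vec (- n%:Z) = ext_neg n.
Proof. by case: n. Qed.

Lemma ext_vecS m : cur_e (- 2 * m - 1) (ext_vec m) = ext_vec (m + 1).
Proof.
case: m => n; first by rewrite -PoszD addn1.
rewrite NegzE ext_vec_negE (_ : - n.+1%:Z + 1 = - n%:Z); last by lia.
rewrite -[RHS](fe_extremal (level_one_swap lv1)
  (extremal_ext_vecN (- n%:Z))) ext_vec_negE opprK /=.
by congr (cur_e _ (cur_f _ _)); lia.
Qed.

(** The step down is the step up with e and f exchanged. *)
Lemma ext_vecP m : cur_f (2 * m - 1) (ext_vec m) = ext_vec (m - 1).
Proof.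
have := fe_extremal lv1 (extremal_ext_vec (m - 1)).
by rewrite ext_vecS subrK => <-; congr (cur_f _ _); lia.
Qed.

Definition fock_gen (w : L) : Prop :=
  exists m, exists2 la : seq nat, 0%N \notin la & w = hmon cur_h la (ext_vec m).

Lemma fock_sub m w : fock cur_h (ext_vec m) w -> lspan fock_gen w.
Proof.
apply: (lspan_map (g := idfun)) => _ [la la0 ->] /=.
by apply: lspan_mem; exists m; exists la.
Qed.

Lemma h0_hmon m la :
  cur_h 0 (hmon cur_h la (ext_vec m)) = (2 * m)%:~R *: hmon cur_h la (ext_vec m).
Proof.
elim: la => [|k la IH] /=; first exact: ext_h0 (extremal_ext_vec m).
by rewrite (comm_hh lv1) mulr0 if_same scale0r addr0 IH linearZ.
Qed.

Lemma word_ext_vec m : loop_word A vac (m ^+ 2) (ext_vec m).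
Proof.
have [tE tF tH] := mxtrace_sl2 C.
have sqS n : 2 * n%:Z + 1 + n%:Z ^+ 2 = n.+1%:Z ^+ 2.
  by rewrite (_ : n.+1%:Z = n%:Z + 1); [ring | lia].
have oppS n : - (2 * n%:Z + 1) = - 2 * n%:Z - 1 by lia.
case: m => n.
  elim: n => [|n IH]; first exact: word_vac.
  have := word_loop (2 * n%:Z + 1) tE IH.
  by rewrite sqS oppS.
rewrite NegzE ext_vec_negE sqrrN; elim: n.+1 => {n} [|n IH]; first exact: word_vac.
have := word_loop (2 * n%:Z + 1) tF IH.
by rewrite sqS oppS.
Qed.

Lemma word_hmon m la :
  loop_word A vac (m ^+ 2 + (sumn la)%:Z) (hmon cur_h la (ext_vec m)).
Proof.
have [tE tF tH] := mxtrace_sl2 C.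
elim: la => [|k la IH]; first by rewrite addr0; apply: word_ext_vec.
have := word_loop k%:Z tH IH; rewrite addrCA -PoszD; exact.
Qed.

Lemma der_word d w : loop_word A vac d w -> der A w = (- d)%:~R *: w.
Proof.
elim=> [|x m {}d {}w tx _ IH]; first by rewrite (vac_der hL) oppr0 scale0r.
have /eqP := der_loop A (- m) w tx; rewrite subr_eq IH linearZ /= -scalerDl -intrD.
by move=> /eqP ->; rewrite opprD.
Qed.

(** The span of the Fock spaces is stable under all currents, so it is the
    whole irreducible module. *)
Lemma fock_spans x : lspan fock_gen x.
Proof.
have sub_e j w : lspan fock_gen w -> lspan fock_gen (cur_e j w).
  apply: lspan_map => _ [m [la la0 ->]]; apply: (@fock_sub (m + 1)).
  rewrite -ext_vecS; apply: (fock_e lv1 (extremal_ext_vec m)).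
  by apply: lspan_mem; exists la.
have sub_f j w : lspan fock_gen w -> lspan fock_gen (cur_f j w).
  apply: lspan_map => _ [m [la la0 ->]]; apply: (@fock_sub (m - 1)).
  rewrite -ext_vecP (_ : 2 * m - 1 = - 2 * - m - 1); last by lia.
  apply/fock_opp_h/(fock_e (level_one_swap lv1) (extremal_ext_vecN m)).
  suff: fock (opp_h (opp_h cur_h)) (ext_vec m) (hmon cur_h la (ext_vec m)).
    by move/fock_opp_h.
  apply: lspan_mem; exists la => //.
  by elim: la {la0} => //= k la ->; rewrite opprK.
have sub_h j w : lspan fock_gen w -> lspan fock_gen (cur_h j w).
  apply: lspan_map => _ [m [la la0 ->]].
  case: j => [[|j]|j].
  - by rewrite h0_hmon; apply/lspan_scale/lspan_mem; exists m; exists la.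
  - rewrite (annihilate_hmon lv1 (extremal_ext_vec m)) //.
    apply/lspan_scale/lspan_mem; exists m; exists (rem j.+1 la) => //.
    by apply: contra la0; apply: mem_rem.
  - apply: lspan_mem; exists m; exists (j.+1 :: la); last by rewrite /= NegzE.
    by rewrite inE negb_or la0.
have : submodule A (lspan fock_gen).
  split.
  - exact: lspan0.
  - by move=> c u v Wu Wv; apply: lspan_add Wv; apply: lspan_scale.
  - move=> y m v ty Wv; rewrite loop_sl2 //.
    by apply: lspan_add; [apply: lspan_add|]; apply: lspan_scale; auto.
  - by move=> v Wv; rewrite (basic_level hL).
  - move=> v; apply: lspan_map => w [m [la la0 ->]].
    rewrite (der_word (word_hmon m la)).
    by apply/lspan_scale/lspan_mem; exists m; exists la.
move/(basic_irreducible hL) => [/(_ vac) W0|]; last exact.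
suff /W0 vac0 : lspan fock_gen vac by have /eqP := vac_neq0 hL.
by apply: lspan_mem; exists 0; exists [::].
Qed.

End Basic.

(** * Partitions in a box *)

Fixpoint box_parts (a : nat) : nat -> nat -> seq (seq nat) :=
  if a is a'.+1 then
    fix inner b c := if b is b'.+1 then
        inner b' c ++
        (if (b'.+1 <= c)%N then map (cons b'.+1) (box_parts a' b'.+1 (c - b'.+1))
         else [::])
      else if c is 0%N then [:: [::]] else [::]
  else fun b c => if c is 0%N then [:: [::]] else [::].

Lemma box_partsSS a b c : box_parts a.+1 b.+1 c = box_parts a.+1 b c ++
  (if (b.+1 <= c)%N then map (cons b.+1) (box_parts a b.+1 (c - b.+1)) else [::]).
Proof. by []. Qed.

Lemma box_parts0b b c : box_parts 0 b c = if c is 0%N then [:: [::]] else [::].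
Proof. by []. Qed.

Lemma box_partsa0 a c : box_parts a 0 c = if c is 0%N then [:: [::]] else [::].
Proof. by case: a. Qed.

Lemma mem_box_parts a b c la : (la \in box_parts a b c) =
  [&& sorted geq la, all (fun k => 0 < k <= b)%N la, (size la <= a)%N
    & sumn la == c].
Proof.
elim: a b c la => [|a IHa] b c la.
  rewrite box_parts0b leqn0 size_eq0; case: la => [|k la]; last first.
    by rewrite !andbF; case: c.
  by case: c.
elim: b c la => [|b IHb] c la.
  rewrite box_partsa0; case: la => [|k la]; first by case: c.
  rewrite (_ : all _ _ = false) ?andbF; first by case: c.
  by rewrite /=; lia.
rewrite box_partsSS mem_cat IHb.
case: la => [|k la].
  rewrite /= orbC; case: ifP => [|_] //; move=> bc.
  by case: mapP => // -[].
have -> : (k :: la \in if (b < c)%N then map (cons b.+1) (box_parts a b.+1 (c - b.+1))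
     else [::]) = [&& k == b.+1, (b < c)%N & la \in box_parts a b.+1 (c - b.+1)].
  case: ifP => bc; last by rewrite andbF.
  apply/mapP/and3P => [[mu hmu [-> ->]]|[/eqP-> _ h]]; first by rewrite eqxx hmu.
  by exists la.
rewrite IHa /= (path_sortedE (rev_trans leq_trans)) ltnS.
apply/orP/idP => [[|]|].
- case/and4P => -> /andP[kb lab] -> ->; rewrite !andbT /=.
  rewrite (_ : (0 < k <= b.+1)%N) /=; last by lia.
  by apply: sub_all lab => j; lia.
- case/and3P => /eqP-> bc /and4P[-> lab -> /eqP->].
  rewrite leqnn lab subnKC // eqxx !andbT /=.
  by apply: sub_all lab => j /andP[].
- case/and4P => /andP[kla sla] /andP[kb lab] ala /eqP sc.
  case: (ltngtP k b.+1) => [kb'|kb'|kb']; [left|lia|right].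
    rewrite kla sla ala sc eqxx (_ : (0 < k <= b)%N) /=; last by lia.
    rewrite andbT; apply/allP => j jla.
    by have := allP kla j jla; have := allP lab j jla; rewrite /=; lia.
  by rewrite sla lab ala -sc kb' addKn eqxx leq_addr.
Qed.

Lemma uniq_box_parts a b c : uniq (box_parts a b c).
Proof.
elim: a b c => [|a IHa] b c; first by rewrite box_parts0b; case: c.
elim: b c => [|b IHb] c; first by rewrite box_partsa0; case: c.
rewrite box_partsSS cat_uniq IHb /=; case: ifP => bc //=; rewrite andbC.
rewrite map_inj_uniq ?IHa //=; last by move=> x y [].
apply/hasPn => _ /mapP[la _ ->]; apply/negP => hin.
have : b.+1 :: la \in box_parts a.+1 b c by exact: hin.
by rewrite mem_box_parts => /and4P[_ /= /andP[]]; lia.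
Qed.

(** Extended by zero to negative arguments, which the recursions reach at their
    boundary. *)
Definition box (a b c : int) : nat :=
  match a, b, c with
  | Posz a, Posz b, Posz c => size (box_parts a b c)
  | _, _, _ => 0%N
  end.

Lemma box_neg_a a b c : a < 0 -> box a b c = 0%N. Proof. by case: a. Qed.
Lemma box_neg_b a b c : b < 0 -> box a b c = 0%N. Proof. by case: a; case: b. Qed.
Lemma box_neg_c a b c : c < 0 -> box a b c = 0%N.
Proof. by case: a; case: b; case: c. Qed.

Lemma box_a0 (a : nat) c : box a 0 c = (c == 0 :> int).
Proof. by case: c => [[|c]|c] /=; rewrite ?box_partsa0. Qed.
Lemma box_0b (b : nat) c : box 0 b c = (c == 0 :> int).
Proof. by case: c => [[|c]|c]. Qed.

Lemma subz1 n : n.+1%:Z - 1 = n%:Z. Proof. by lia. Qed.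

(** Partitions without and with a part equal to b. *)
Lemma box_rec_part a b c : 0 <= a -> 0 <= b -> (a, b) != (0, 0) ->
  box a b c = (box a (b - 1) c + box (a - 1) b (c - b))%N.
Proof.
case: a => // a _; case: b => // b _; case: b => [|b].
  case: a => // a _; rewrite subr0 [box _ (0 - 1) _]box_neg_b // box_a0.
  by rewrite (_ : a.+1%:Z - 1 = a) ?box_a0 //; lia.
case: a => [|a] _.
  rewrite [box (0 - 1) _ _]box_neg_a // addn0.
  by rewrite (_ : b.+1%:Z - 1 = b) ?box_0b //; lia.
rewrite !subz1.
case: c => [c|c]; last by rewrite !box_neg_c //; lia.
rewrite {1 2}/box box_partsSS size_cat; congr addn.
case: ifP => bc; last by rewrite box_neg_c //; lia.
by rewrite size_map subzn.
Qed.

(** Partitions with fewer than a parts, and with exactly a parts, from each of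
    which 1 can be subtracted. The proof is by induction from the other
    recursion, as both unfold to the same four terms. *)
Lemma box_rec_size a b c : 0 <= a -> 0 <= b -> (a, b) != (0, 0) ->
  box a b c = (box (a - 1) b c + box a (b - 1) (c - a))%N.
Proof.
case: a => // a _; case: b => // b _.
have [n] := ubnP (a + b); elim: n a b c => [|n IH] a b c; first by rewrite ltn0.
move=> abn; have pneq (x y : int) : ((x, y) != (0, 0)) = (x != 0) || (y != 0).
  by rewrite xpair_eqE negb_and.
case: a abn => [|a]; case: b => [|b] abn // _.
- rewrite [box (0 - 1) _ _]box_neg_a // subr0 (_ : b.+1%:Z - 1 = b); last by lia.
  by rewrite !box_0b.
- rewrite [box _ (0 - 1) _]box_neg_b // addn0 (_ : a.+1%:Z - 1 = a); last by lia.
  by rewrite !box_a0.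
rewrite box_rec_part // !subz1.
rewrite (IH a.+1 b) ?(IH a b.+1 (c - b.+1%:Z)) ?pneq //; [|lia..].
rewrite [box a b.+1 c]box_rec_part ?pneq // ?[box a.+1 b _]box_rec_part ?pneq //; last by lia.
rewrite !subz1.
rewrite (_ : c - b.+1%:Z - a%:Z = c - a.+1%:Z - b%:Z); last by lia.
by rewrite -!addnA; congr addn; rewrite addnCA.
Qed.

Lemma box_sym a b c : box a b c = box b a c.
Proof.
case: a => a; last by rewrite box_neg_a // box_neg_b.
case: b => b; last by rewrite box_neg_b // box_neg_a.
have [n] := ubnP (a + b); elim: n a b c => [|n IH] a b c; first by rewrite ltn0.
move=> abn; case: a abn => [|a]; first by rewrite box_0b box_a0.
case: b => [|b] abn; first by rewrite box_0b box_a0.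
rewrite box_rec_part // [RHS]box_rec_size //.
rewrite !subz1.
by rewrite IH ?(IH a b.+1) //; lia.
Qed.

(** A partition of c fits in the c by c box, so this counts all partitions. *)
Definition npart (c : int) : nat := box c c c.

Lemma box_large a b c : c <= a -> c <= b -> box a b c = npart c.
Proof.
case: c => c; last by rewrite /npart !box_neg_c.
case: a => // a; case: b => // b ca cb.
suff H : box a b c = box c b c.
  suff K : box c b c = box c c c by rewrite H K.
  elim: b cb {H} => [|b IH] cb; first by rewrite (_ : c = 0%N) //; lia.
  have [<-//|cb'] := eqVneq c b.+1; rewrite box_rec_part ?xpair_eqE ?andbF //.
  rewrite [X in (_ + X)%N]box_neg_c; last by lia.
  by rewrite addn0 (_ : b.+1%:Z - 1 = b) ?IH //; lia.
elim: a ca => [|a IH] ca; first by rewrite (_ : c = 0%N) //; lia.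
have [<-//|ca'] := eqVneq c a.+1; rewrite box_rec_size //.
rewrite [X in (_ + X)%N]box_neg_c; last by lia.
by rewrite addn0 (_ : a.+1%:Z - 1 = a) ?IH //; lia.
Qed.

(** * Two-row tableaux and the major index *)

Lemma nrowS t b l : nrow t b l.+1 = (nrow t b l + (t l == b))%N.
Proof. exact: big_ord_recr. Qed.

Lemma nrow0 t b : nrow t b 0 = 0%N.
Proof. exact: big_ord0. Qed.

Lemma eq_nrow s t b l : (forall i, (i < l)%N -> s i = t i) ->
  nrow s b l = nrow t b l.
Proof. by move=> st; apply: eq_bigr => i _; rewrite st. Qed.

Lemma nrow_total t l : (nrow t false l + nrow t true l = l)%N.
Proof.
elim: l => [|l IH]; first by rewrite !nrow0.
by rewrite !nrowS addnACA IH; case: (t l); rewrite ?addn1.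
Qed.

Lemma standardP N t :
  reflect (forall l, (l <= N)%N -> (nrow t true l <= nrow t false l)%N)
    (standard N t).
Proof.
apply: (iffP forallP) => [h l lN|h l]; last by apply: h; rewrite -ltnS.
by have := h (Ordinal (lN : (l < N.+1)%N)).
Qed.

Lemma eq_standard s t N : (forall i, (i < N)%N -> s i = t i) ->
  standard N s = standard N t.
Proof.
by move=> st; apply/standardP/standardP => h l lN;
   have := h l lN; rewrite !(@eq_nrow s t) // => i il; apply: st; lia.
Qed.

Lemma standardS N t : standard N.+1 t =
  standard N t && (nrow t true N.+1 <= nrow t false N.+1)%N.
Proof.
apply/standardP/andP => [h|[/standardP h hN] l].
  by split; [apply/standardP => l lN; apply: h; lia | apply: h].
by rewrite leq_eqVlt => /predU1P[->|] //; rewrite ltnS => /h.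
Qed.

Lemma eq_maj s t N : (forall i, (i < N)%N -> s i = t i) -> maj N s = maj N t.
Proof.
move=> st; rewrite /maj big_nat_cond [RHS]big_nat_cond; apply: eq_bigl => i.
case: i => [|i] //=.
by case: (ltnP i.+1 N) => iN //=; rewrite !st //; lia.
Qed.

Lemma majS N t : (0 < N)%N ->
  maj N.+1 t = (maj N t + (if ~~ t N.-1 && t N then N else 0))%N.
Proof. by move=> N0; rewrite /maj big_mkcond big_nat_recr //= -big_mkcond. Qed.

Fixpoint ballots (N : nat) : seq bitseq :=
  if N is N'.+1 then
    [seq t <- [seq rcons t false | t <- ballots N'] ++
              [seq rcons t true | t <- ballots N'] | standard N (nth false t)]
  else [:: [::]].

Lemma nth_rcons_lt (t : bitseq) x i : (i < size t)%N ->
  nth false (rcons t x) i = nth false t i.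
Proof. by move=> it; rewrite nth_rcons it. Qed.

Lemma nth_rcons_eq (t : bitseq) x : nth false (rcons t x) (size t) = x.
Proof. by rewrite nth_rcons ltnn eqxx. Qed.

Lemma mem_ballots N t :
  (t \in ballots N) = (size t == N) && standard N (nth false t).
Proof.
elim: N t => [|N IH] t.
  rewrite inE size_eq0; case: eqP => //= _; apply/esym/standardP.
  by move=> l; rewrite leqn0 => /eqP->; rewrite !nrow0.
rewrite /= mem_filter andbC; case st: (standard N.+1 _); rewrite ?andbF //=.
rewrite !andbT; case: (lastP t) => [|t' x] in st *.
  by apply/negbTE; rewrite mem_cat; apply/norP; split; apply/mapP => -[[]].
rewrite size_rcons eqSS mem_cat.
have inj y : injective (fun t : bitseq => rcons t y) by move=> a b /rcons_inj[].
have E : (t' \in ballots N) = (size t' == N).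
  rewrite IH; case: eqP => // sN; move: st; rewrite standardS => /andP[st _].
  by apply: etrans st; apply: eq_standard => i iN; rewrite nth_rcons_lt ?sN.
have neq y z : y != z -> (rcons t' y \in [seq rcons t z | t <- ballots N]) = false.
  by move=> yz; apply/negbTE/mapP => -[s _ /rcons_inj[_ yz']]; rewrite yz' eqxx in yz.
by case: x {st}; rewrite ?(mem_map (inj _)) E neq ?orbF.
Qed.

Lemma uniq_ballots N : uniq (ballots N).
Proof.
elim: N => [//|N IH]; rewrite filter_uniq // cat_uniq.
have inj y : injective (fun t : bitseq => rcons t y) by move=> a b /rcons_inj[].
rewrite !map_inj_uniq ?IH //= andbT; apply/hasPn => _ /mapP[s _ ->].
by apply/mapP => -[s' _ /rcons_inj[]].
Qed.

Definition ballot_stat (N b : nat) (m : int) (t : bitseq) : bool :=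
  (nrow (nth false t) true N == b) && ((maj N (nth false t))%:Z == m).

(** The row x of the last entry is recorded because it decides whether a new
    last entry in the second row creates a descent. *)
Definition nballots (x : bool) (N b : nat) (m : int) : nat :=
  count (fun t => (nth false t N.-1 == x) && ballot_stat N b m t) (ballots N).

Lemma nballots_false N b m : (0 < N)%N ->
  nballots false N.+1 b m = (nballots false N b m + nballots true N b m)%N.
Proof.
move=> N0; rewrite /nballots -count_predUI count_filter count_cat !count_map.
rewrite [X in (_ + X)%N](_ : _ = 0%N); last first.
  apply/eqP; rewrite eqn0Ngt -has_count; apply/hasPn => t; rewrite mem_ballots.
  by case/andP => /eqP sN _ /=; rewrite -sN nth_rcons_eq.
rewrite [X in (_ = _ + X)%N](_ : _ = 0%N); last first.
  apply/eqP; rewrite eqn0Ngt -has_count; apply/hasPn => t _ /=.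
  by case: (nth false t N.-1); rewrite ?andbF.
rewrite !addn0; apply: eq_in_count => t; rewrite mem_ballots => /andP[/eqP sN st].
have lt i : (i < N)%N -> nth false (rcons t false) i = nth false t i.
  by move=> iN; rewrite nth_rcons_lt ?sN.
have eN : nth false (rcons t false) N = false by rewrite -sN nth_rcons_eq.
rewrite /= /ballot_stat eN /= standardS (eq_standard lt) st majS // !nrowS.
rewrite !(eq_nrow _ lt) (eq_maj lt) eN andbF !addn0 /=.
have /standardP/(_ N (leqnn N)) le := st; rewrite (leq_trans le) ?leq_addr // andbT.
by case: (nth _ _ _); rewrite /= ?orbF.
Qed.

Lemma nballots_true N b m : (0 < N)%N -> (b.+1.*2 <= N.+1)%N ->
  nballots true N.+1 b.+1 m =
  (nballots false N b (m - N%:Z) + nballots true N b m)%N.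
Proof.
move=> N0 bN; rewrite /nballots -count_predUI count_filter count_cat !count_map.
rewrite [X in (X + _)%N](_ : _ = 0%N); last first.
  apply/eqP; rewrite eqn0Ngt -has_count; apply/hasPn => t; rewrite mem_ballots.
  by case/andP => /eqP sN _ /=; rewrite -sN nth_rcons_eq.
rewrite [X in (_ = _ + X)%N](_ : _ = 0%N); last first.
  apply/eqP; rewrite eqn0Ngt -has_count; apply/hasPn => t _ /=.
  by case: (nth false t N.-1); rewrite ?andbF.
rewrite add0n addn0; apply: eq_in_count => t; rewrite mem_ballots => /andP[/eqP sN st].
have lt i : (i < N)%N -> nth false (rcons t true) i = nth false t i.
  by move=> iN; rewrite nth_rcons_lt ?sN.
have eN : nth false (rcons t true) N = true by rewrite -sN nth_rcons_eq.
rewrite /= /ballot_stat eN /= standardS (eq_standard lt) st majS // !nrowS.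
rewrite !(eq_nrow _ lt) (eq_maj lt) eN andbT addn0 lt; last by lia.
have := nrow_total (nth false t) N; move: (nrow _ _ _) (nrow _ _ _) (maj _ _) => F T M.
by case: (nth _ _ _) => /=; lia.
Qed.

Lemma nballots_gt x N b m : (N < b.*2)%N -> nballots x N b m = 0%N.
Proof.
move=> Nb; apply/eqP; rewrite eqn0Ngt -has_count; apply/hasPn => t.
rewrite mem_ballots => /andP[_ /standardP/(_ N (leqnn N))] le.
by have := nrow_total (nth false t) N; rewrite /ballot_stat; lia.
Qed.

Lemma nballots_true0 N m : nballots true N.+1 0 m = 0%N.
Proof.
apply/eqP; rewrite eqn0Ngt -has_count; apply/hasPn => t _ /=.
by rewrite /ballot_stat nrowS; case: (nth _ _ _) => //; rewrite addn1.
Qed.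

(** MacMahon's count of words by the major index, minus the same count for words
    with one more letter of the first kind and one fewer of the second. Each of
    the two terms satisfies the recursions of nballots_false and nballots_true,
    by box_rec_part and box_rec_size; they cancel where the first row would be
    shorter than the second, by box_sym. *)
Lemma nballotsE N b m : (b.*2 <= N.+1)%N -> let a := N.+1%:Z - b%:Z in
  (nballots false N.+1 b m)%:Z =
    (box (a - 1) b ((a - 1) * b%:Z - m))%:Z -
    (box a (b%:Z - 1) (a * (b%:Z - 1) - m))%:Z /\
  (nballots true N.+1 b m)%:Z =
    (box a (b%:Z - 1) (a * b%:Z - m))%:Z -
    (box (a + 1) (b%:Z - 2) ((a + 1) * (b%:Z - 1) - m))%:Z.
Proof.
elim: N b m => [|N IH] b m bN a.
  have b0 : b = 0%N by lia.
  rewrite {}/a {}b0 {bN} nballots_true0 !(@box_neg_b _ (0 - _)) // subr0 subrr.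
  split=> //; rewrite mul0r sub0r box_a0 oppr_eq0.
  rewrite /nballots /= /standard; case: forallP => [_|[]] /=; last first.
    by move=> l; case: l => [[|[|//]] hl]; rewrite /= ?nrow0 // !nrowS !nrow0.
  case: forallP => [|_] /=.
    by move=> /(_ (inord 1)); rewrite inordK // !nrowS !nrow0.
  rewrite addn0 /ballot_stat nrowS nrow0 /maj big_geq //=.
  by rewrite eq_sym.
have pneq (x y : int) : ((x, y) != (0, 0)) = (x != 0) || (y != 0).
  by rewrite xpair_eqE negb_and.
split.
- rewrite nballots_false //; have [bN'|bN'] := leqP b.*2 N.+1; last first.
    rewrite !nballots_gt //; have -> : a = b%:Z by rewrite /a; lia.
    by rewrite box_sym [(_ - 1) * _]mulrC subrr.
  have [] := IH b m bN'; set a' := N.+1%:Z - b%:Z; rewrite PoszD => -> ->.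
  have -> : a = a' + 1 by rewrite /a /a'; lia.
  have a'0 : 0 < a' by rewrite /a'; lia.
  rewrite addrK [box a' b _]box_rec_part // ?pneq; [|lia..].
  have [->|b0] := eqVneq b 0%N.
    by rewrite !(@box_neg_b _ (0 - _)) // !mulr0 !subr0 add0n.
  rewrite [box (a' + 1) (b%:Z - 1) _]box_rec_part ?pneq; [|lia..].
  rewrite addrK !PoszD (_ : b%:Z - 1 - 1 = b%:Z - 2); last by lia.
  rewrite (_ : a' * b%:Z - m - b%:Z = (a' - 1) * b%:Z - m); last by ring.
  rewrite (_ : (a' + 1) * (b%:Z - 1) - m - (b%:Z - 1) = a' * (b%:Z - 1) - m); last by ring.
  ring.
- case: b => [|b] in bN a *.
    by rewrite nballots_true0 !(@box_neg_b _ (0 - _)).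
  rewrite nballots_true //; have [|e1 _] := IH b (m - N.+1%:Z); first by lia.
  have [|_ e2] := IH b m; first by lia.
  move: e1 e2; set a' := N.+1%:Z - b%:Z => e1 e2; rewrite PoszD e1 e2.
  have -> : a = a' by rewrite /a /a'; lia.
  have a'0 : 0 < a' by rewrite /a'; lia.
  have -> : b.+1%:Z - 1 = b by lia.
  have -> : b.+1%:Z - 2 = b%:Z - 1 by lia.
  have -> : b.+1%:Z = b%:Z + 1 by lia.
  have eN : N.+1%:Z = a' + b%:Z by rewrite /a'; lia.
  rewrite eN [box a' b (_ * (_ + 1) - _)]box_rec_size ?pneq; [|lia..].
  have [->|b0] := eqVneq b 0%N.
    by rewrite !(@box_neg_b _ (0 - _)) // mulr0 !addr0 ?subr0 sub0r opprB add0r mulr1 addn0 ?addr0.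
  rewrite [box (a' + 1) (b%:Z - 1) _]box_rec_size ?pneq; [|lia..].
  rewrite addrK !PoszD (_ : b%:Z - 1 - 1 = b%:Z - 2); last by lia.
  rewrite (_ : (a' - 1) * b%:Z - (m - (a' + b%:Z)) = a' * (b%:Z + 1) - m); last by ring.
  rewrite (_ : a' * (b%:Z + 1) - m - a' = a' * b%:Z - m); last by ring.
  rewrite (_ : a' * (b%:Z - 1) - (m - (a' + b%:Z)) = (a' + 1) * b%:Z - m); last by ring.
  rewrite (_ : (a' + 1) * b%:Z - m - (a' + 1) = (a' + 1) * (b%:Z - 1) - m); last by ring.
  ring.
Qed.

(** * Tableaux of given spin and degree *)

Lemma add_two_lt N t i : (i < N)%N -> add_two N t i = t i.
Proof. by rewrite /add_two => ->. Qed.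

Lemma add_two_N N t : add_two N t N = false.
Proof. by rewrite /add_two ltnn; apply/eqP; lia. Qed.

Lemma add_two_N1 N t : add_two N t N.+1 = true.
Proof. by rewrite /add_two eqxx ifF //; lia. Qed.

Lemma nrow_add_two N t b : nrow (add_two N t) b N.+2 = (nrow t b N).+1.
Proof.
rewrite !nrowS add_two_N add_two_N1 (eq_nrow _ (@add_two_lt N t)).
by case: b; rewrite /= ?addn0 addn1.
Qed.

Lemma standard_add_two N t : standard N.+2 (add_two N t) = standard N t.
Proof.
rewrite 2!standardS nrow_add_two nrow_add_two ltnS (eq_standard (@add_two_lt N t)).
rewrite !nrowS add_two_N !(eq_nrow _ (@add_two_lt N t)).
case st: (standard N t) => //=; have /standardP/(_ N (leqnn N)) le := st.
by rewrite le andbT; lia.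
Qed.

Lemma maj_add_two N t : maj N.+2 (add_two N t) = (maj N t + N.+1)%N.
Proof.
rewrite majS // add_two_N add_two_N1 /=; congr addn.
case: N => [|N]; first by rewrite /maj !big_geq.
by rewrite majS // add_two_N andbF addn0 (eq_maj (@add_two_lt N.+1 t)).
Qed.

Lemma spin2_add_two N t : spin2 N.+2 (add_two N t) = spin2 N t.
Proof. by rewrite /spin2 !nrow_add_two subSS. Qed.

Lemma rgrade_add_two n t : rgrade n.+1 (add_two n.*2 t) = rgrade n t.
Proof.
rewrite /rgrade doubleS maj_add_two.
by rewrite (_ : n.+1 ^ 2 = n ^ 2 + n.*2.+1)%N; [lia | rewrite -mul2n !expnS; lia].
Qed.

Lemma nth_cat_add_two (t : bitseq) N : size t = N ->
  nth false (t ++ [:: false; true]) =1 add_two N (nth false t).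
Proof.
move=> sN i; rewrite nth_cat sN /add_two; case: ltnP => // Ni.
have [j ->] : exists j, i = (N + j)%N by exists (i - N)%N; lia.
by rewrite addKn; case: j => [|[|j]] /=; apply/esym/eqP; rewrite ?nth_nil; lia.
Qed.

Lemma eq_spin2 s t N : (forall i, (i < N)%N -> s i = t i) -> spin2 N s = spin2 N t.
Proof. by move=> st; rewrite /spin2 !(eq_nrow _ st). Qed.

Lemma eq_rgrade s t n : (forall i, (i < n.*2)%N -> s i = t i) -> rgrade n s = rgrade n t.
Proof. by move=> st; rewrite /rgrade (eq_maj st). Qed.

Definition has_type (k : nat) (d : int) (n : nat) (t : bitseq) : bool :=
  (spin2 n.*2 (nth false t) == k.*2) && (rgrade n (nth false t) == d).

(** The tableaux of spin k and degree d with 2n cells, listed so that the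
    serpentine embedding preserves the position in the list. *)
Fixpoint tabs (k : nat) (d : int) (n : nat) : seq bitseq :=
  if n is n'.+1 then
    let old := [seq t ++ [:: false; true] | t <- tabs k d n'] in
    old ++ [seq t <- ballots n.*2 | has_type k d n t & t \notin old]
  else [seq t <- ballots 0 | has_type k d 0 t].

Lemma tabsS k d n (old := [seq t ++ [:: false; true] | t <- tabs k d n]) :
  tabs k d n.+1 =
  old ++ [seq t <- ballots n.+1.*2 | has_type k d n.+1 t & t \notin old].
Proof. by []. Qed.

Lemma mem_tabs k d n t :
  (t \in tabs k d n) = (t \in ballots n.*2) && has_type k d n t.
Proof.
elim: n t => [|n IH] t; first by rewrite mem_filter andbC.
rewrite tabsS mem_cat mem_filter; set old := map _ _.
have [told|] := boolP (t \in old); last by rewrite andbT /= andbC.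
have [s + ->] := mapP told; rewrite IH mem_ballots => /andP[/andP[/eqP ss st] ht].
have E := nth_cat_add_two ss; apply/esym/andP; split.
  rewrite mem_ballots size_cat ss addn2 doubleS eqxx.
  by rewrite (@eq_standard _ (add_two n.*2 (nth false s))) ?standard_add_two.
rewrite /has_type doubleS (@eq_spin2 _ (add_two n.*2 (nth false s))) //.
rewrite (@eq_rgrade _ (add_two n.*2 (nth false s))) //.
by rewrite spin2_add_two rgrade_add_two.
Qed.

Lemma cat_FT_inj : injective (fun t : bitseq => t ++ [:: false; true]).
Proof.
move=> u v /(congr1 (fun s => take (size s - 2) s)).
by rewrite !size_cat !addnK !take_size_cat.
Qed.

Lemma uniq_tabs k d n : uniq (tabs k d n).
Proof.
elim: n => [|n IH]; first by rewrite filter_uniq // uniq_ballots.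
rewrite tabsS cat_uniq map_inj_uniq ?IH; last exact: cat_FT_inj.
rewrite filter_uniq ?andbT; last exact: (uniq_ballots n.+1.*2).
by apply/hasPn => t; rewrite mem_filter => /andP[/andP[]].
Qed.

Lemma index_tabs k d n t : t \in tabs k d n ->
  index (t ++ [:: false; true]) (tabs k d n.+1) = index t (tabs k d n).
Proof.
by move=> tn; rewrite tabsS index_cat (mem_map cat_FT_inj) tn (index_map cat_FT_inj).
Qed.

Lemma size_tabs_le k d n n' : (n <= n')%N ->
  (size (tabs k d n) <= size (tabs k d n'))%N.
Proof.
elim: n' => [|n' IH]; first by rewrite leqn0 => /eqP->.
rewrite leq_eqVlt => /predU1P[->//|]; rewrite ltnS => /IH /leq_trans -> //.
by rewrite /= size_cat size_map leq_addr.
Qed.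

(** In a box of a by b cells, complementation turns major index m into size
    a b - m; with a = n + k and b = n - k this is d - k^2 when d = n^2 - m. *)
Lemma size_tabs k d n : (0 < n)%N -> (k <= n)%N ->
  (size (tabs k d n))%:Z =
  (box (n%:Z + k%:Z) (n%:Z - k%:Z) (d - k%:Z ^+ 2))%:Z -
  (box (n%:Z + k%:Z + 1) (n%:Z - k%:Z - 1) (d - (k%:Z + 1) ^+ 2))%:Z.
Proof.
move=> n0 kn.
have -> : size (tabs k d n) = count (has_type k d n) (ballots n.*2).
  rewrite -size_filter; apply: perm_size; apply: uniq_perm.
  - exact: uniq_tabs.
  - by rewrite filter_uniq // uniq_ballots.
  - by move=> t; rewrite mem_tabs mem_filter andbC.
pose b := (n - k)%N; pose m := n%:Z ^+ 2 - d.
have -> : count (has_type k d n) (ballots n.*2) =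
    (nballots false n.*2 b m + nballots true n.*2 b m)%N.
  rewrite /nballots -count_predUI [X in (_ + X)%N](_ : _ = 0%N); last first.
    apply/eqP; rewrite eqn0Ngt -has_count; apply/hasPn => t _ /=.
    by case: (nth false t _); rewrite ?andbF.
  rewrite addn0; apply: eq_in_count => t.
  rewrite mem_ballots => /andP[_ /standardP/(_ _ (leqnn _)) le].
  rewrite /= /has_type /ballot_stat /spin2 /rgrade.
  have := nrow_total (nth false t) n.*2; move: le.
  set F := nrow _ false _; set T := nrow _ true _; set M := maj _ _ => TF FT.
  rewrite -andb_orl (_ : _ || _); last by case: (nth _ _ _).
  rewrite /= (_ : (n ^ 2)%N%:Z = n%:Z ^+ 2); last by rewrite -mulnn PoszM expr2.
  by rewrite /m /b; apply/andP/andP => -[]; lia.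
have [n1 En] : exists n1, n.*2 = n1.+1 by exists n.*2.-1; lia.
rewrite En; have [|e1 e2] := @nballotsE n1 b m; first by rewrite /b; lia.
rewrite PoszD e1 e2 {e1 e2} -En; set a := n.*2%:Z - b%:Z.
have aE : a = n%:Z + k%:Z by rewrite /a /b; lia.
have bE : b%:Z = n%:Z - k%:Z by rewrite /b; lia.
have pneq (x y : int) : ((x, y) != (0, 0)) = (x != 0) || (y != 0).
  by rewrite xpair_eqE negb_and.
rewrite -aE -bE [box a b _]box_rec_part ?pneq; [|lia..].
have Ed : d - k%:Z ^+ 2 = a * b%:Z - m by rewrite /m aE bE; ring.
have Ed' : d - (k%:Z + 1) ^+ 2 = (a + 1) * (b%:Z - 1) - m by rewrite /m aE bE; ring.
rewrite Ed Ed' (_ : a * b%:Z - m - b%:Z = (a - 1) * b%:Z - m); last by ring.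
have [b0|b0] := eqVneq b%:Z 0.
  by rewrite b0 !(@box_neg_b _ (0 - _)) // PoszD; lia.
rewrite [box (a + 1) (b%:Z - 1) _]box_rec_part ?pneq; [|lia..].
rewrite (_ : b%:Z - 1 - 1 = b%:Z - 2) ?addrK; last by lia.
rewrite (_ : (a + 1) * (b%:Z - 1) - m - (b%:Z - 1) = a * (b%:Z - 1) - m); last by ring.
ring.
Qed.

(** The coefficient of q^d in q^(k^2) (1 - q^(2k+1)) / prod (1 - q^i): the
    multiplicity of spin k in degree d, both in the basic module and in the
    serpentine limit. *)
Definition mult (k : nat) (d : int) : nat :=
  (npart (d - k%:Z ^+ 2) - npart (d - (k%:Z + 1) ^+ 2))%N.

Lemma size_tabs_lim k d n : (k + `|d| < n)%N ->
  (size (tabs k d n) + npart (d - (k%:Z + 1) ^+ 2))%N = npart (d - k%:Z ^+ 2).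
Proof.
move=> kdn; apply/eqP; rewrite -eqz_nat PoszD size_tabs ?box_large; try by lia.
all: have := sqr_ge0 k%:Z; have := sqr_ge0 (k%:Z + 1); lia.
Qed.

Lemma npart_decr k d : (npart (d - (k%:Z + 1) ^+ 2) <= npart (d - k%:Z ^+ 2))%N.
Proof. by rewrite -(@size_tabs_lim k d (k + `|d|).+1) // leq_addl. Qed.

Lemma size_tabs_stable k d n : (k + `|d| < n)%N -> size (tabs k d n) = mult k d.
Proof. by move=> h; rewrite /mult -(size_tabs_lim h) addnK. Qed.

Lemma size_tabs_mult k d n : (size (tabs k d n) <= mult k d)%N.
Proof.
have := @size_tabs_le k d n (n + (k + `|d|).+1) (leq_addr _ _).
by rewrite (@size_tabs_stable _ _ (n + _)) //; lia.
Qed.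

(** * Weight spaces of the basic module *)

Section OrthonormalFamilies.
Variables (C : numClosedFieldType) (L : lmodType C).
Variable form : {dot L for Num.conj}.
Local Open Scope sesquilinear_scope.

Lemma ortho_lspan (S : L -> Prop) x v :
  (forall u, S u -> form x u = 0) -> lspan S v -> form x v = 0.
Proof.
move=> Sx; elim=> [|a u w Su _ IH]; first by rewrite linear0r.
by rewrite linearDr linearZr_LR /= Sx // IH mulr0 addr0.
Qed.

(** An orthonormal family of p vectors in a space with an orthonormal basis of
    p vectors is a basis: its coordinate matrix is unitary. *)
Lemma orthonormal_full (p : nat) (b : 'I_p -> L) (I : finType) (X : I -> L) x :
  #|I| = p ->
  (forall i, X i = \sum_j form (X i) (b j) *: b j) ->
  (forall i j, form (X i) (X j) = (i == j)%:R) ->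
  (forall i j, form (b i) (b j) = (i == j)%:R) ->
  x = \sum_j form x (b j) *: b j ->
  x = \sum_i form x (X i) *: X i.
Proof.
move=> cI XE oX ob xE; subst p.
pose M : 'M[C]_#|I| := \matrix_(i, j) form (X (enum_val i)) (b j).
have sumE i y : form (X i) y = \sum_j form (X i) (b j) * form (b j) y.
  rewrite {1}(XE i) dot_suml; apply: eq_bigr => j _.
  by rewrite linearZl_LR.
have Mu : M \is unitarymx.
  apply/unitarymxP/matrixP => i j; rewrite !mxE -(inj_eq enum_val_inj) -oX sumE.
  by apply: eq_bigr => l _; rewrite !mxE [in RHS](dot_conj form (b l)).
have Mu' : M^t* *m M = 1%:M.
  by apply/mulmx1C/unitarymxP.
have termE i : form x (X i) *: X i =
    \sum_j (form x (X i) * form (X i) (b j)) *: b j.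
  by rewrite {2}(XE i) scaler_sumr; apply: eq_bigr => j _; rewrite scalerA.
rewrite [LHS]xE (eq_bigr _ (fun i _ => termE i)) exchange_big /=.
apply: eq_bigr => j _; rewrite -scaler_suml; congr (_ *: _).
transitivity (\sum_l form x (b l) * (M^t* *m M) l j).
  rewrite Mu' (bigD1 j) //= mxE eqxx mulr1 big1 ?addr0 // => l lj.
  by rewrite mxE (negbTE lj) mulr0.
rewrite [RHS](reindex _ (onW_bij _ (enum_val_bij I))) /=.
under eq_bigr => l _ do rewrite mxE mulr_sumr.
rewrite exchange_big /=; apply: eq_bigr => i _.
rewrite dot_conj sumE rmorph_sum mulr_suml /=; apply: eq_bigr => l _.
by rewrite !mxE rmorphM /= -(dot_conj form x) mulrCA mulrA.
Qed.

End OrthonormalFamilies.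

Section HighestWeight.
Variables (C : numClosedFieldType) (L : lmodType C) (A : affine_module L).
Variables (vac : L) (form : {dot L for Num.conj}).
Hypothesis hL : basic_module A vac.
Hypothesis hform : invariant_form A form vac.

Local Notation e := (cur_e A).
Local Notation f := (cur_f A).
Local Notation h := (cur_h A).
Let lv1 := level_one_basic hL hform.

Definition wspace (m d : int) (x : L) : Prop :=
  h 0 x = (2 * m)%:~R *: x /\ der A x = (- d)%:~R *: x.

Lemma wspace_add m d x y : wspace m d x -> wspace m d y -> wspace m d (x + y).
Proof. by move=> [hx dx] [hy dy]; split; rewrite raddfD /= ?hx ?hy ?dx ?dy scalerDr. Qed.

Lemma wspace_scale m d c x : wspace m d x -> wspace m d (c *: x).
Proof.
by move=> [hx dx]; split; rewrite linearZ /= ?hx ?dx !scalerA mulrC.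
Qed.

Lemma wspace_sum m d (I : Type) (r : seq I) (F : I -> L) :
  (forall i, wspace m d (F i)) -> wspace m d (\sum_(i <- r) F i).
Proof.
move=> WF; elim/big_rec: _ => [|i x _ Wx]; last exact: wspace_add.
by split; rewrite linear0 scaler0.
Qed.

(** The operators h_0 and d are self-adjoint with real eigenvalues. *)
Lemma wspace_ortho m d m' d' x y : wspace m d x -> wspace m' d' y ->
  (m, d) != (m', d') -> form x y = 0.
Proof.
move=> [hx dx] [hy dy]; rewrite xpair_eqE negb_and => md.
have real (a : int) : (a%:~R : C)^* = a%:~R by rewrite rmorph_int.
have := adj_h lv1 0 x y; have := form_der hform x y.
rewrite oppr0 hx hy dx dy !linearZl_LR !linearZr_LR /= !real.
move=> /eqP; rewrite -subr_eq0 -mulrBl mulf_eq0 => dd /eqP.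
rewrite -subr_eq0 -mulrBl mulf_eq0 => mm; apply/eqP.
case/orP: dd => [|//]; case/orP: mm => [|//].
rewrite -!intrB !intr_eq0 => mm dd.
by case/orP: md => /eqP[]; lia.
Qed.

Lemma wspace_cur_e j m d x : wspace m d x -> wspace (m + 1) (d - j) (e j x).
Proof.
have [tE tF tH] := mxtrace_sl2 C.
move=> [hx dx]; split.
  rewrite (comm_he lv1) hx linearZ /= add0r -scalerDl; congr (_ *: _).
  by rewrite mulrDr intrD.
have /eqP := der_loop A j x tE; rewrite subr_eq => /eqP ->.
by rewrite dx linearZ /= -scalerDl -intrD opprB.
Qed.

Lemma wspace_cur_f j m d x : wspace m d x -> wspace (m - 1) (d - j) (f j x).
Proof.
have [tE tF tH] := mxtrace_sl2 C.
move=> [hx dx]; split.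
  rewrite (comm_hf lv1) hx linearZ /= add0r -scalerBl; congr (_ *: _).
  by rewrite mulrBr intrB.
have /eqP := der_loop A j x tF; rewrite subr_eq => /eqP ->.
by rewrite dx linearZ /= -scalerDl -intrD opprB.
Qed.

Lemma wspace_cur_h j m d x : wspace m d x -> wspace m (d - j) (h j x).
Proof.
have [tE tF tH] := mxtrace_sl2 C.
move=> [hx dx]; split.
  by rewrite (comm_hh lv1) mulr0 if_same scale0r addr0 hx linearZ.
have /eqP := der_loop A j x tH; rewrite subr_eq => /eqP ->.
by rewrite dx linearZ /= -scalerDl -intrD opprB.
Qed.

Lemma wspace_e m d x : wspace m d x -> wspace (m + 1) d (e 0 x).
Proof. by move/(wspace_cur_e 0); rewrite subr0. Qed.

Lemma wspace_f m d x : wspace m d x -> wspace (m - 1) d (f 0 x).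
Proof. by move/(wspace_cur_f 0); rewrite subr0. Qed.

(** The matrices of the loops in a word are combinations of weight matrices. *)
Lemma word_wspace d w :
  loop_word A vac d w -> lspan (fun u => exists m, wspace m d u) w.
Proof.
elim=> [|x m {}d {}w tx _ IH].
  apply: lspan_mem; exists 0; split; first by rewrite mulr0 scale0r (vac_loop hL) //; have [] := mxtrace_sl2 C.
  by rewrite (vac_der hL) oppr0 scale0r.
have dE : m + d = d - - m by rewrite opprK addrC.
rewrite loop_sl2 //; apply: lspan_add; first apply: lspan_add;
  apply: lspan_scale; apply: lspan_map IH => u [m' wu]; apply: lspan_mem.
- by exists (m' + 1); rewrite dE; apply: wspace_cur_e.
- by exists (m' - 1); rewrite dE; apply: wspace_cur_f.
- by exists m'; rewrite dE; apply: wspace_cur_h.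
Qed.

Definition hvec (m : int) (la : seq nat) : L := hmon h la (ext_vec A vac m).

Lemma wspace_hvec m la : wspace m (m ^+ 2 + (sumn la)%:Z) (hvec m la).
Proof.
split; first exact: (h0_hmon hL hform).
exact: (der_word hL (word_hmon A vac m la)).
Qed.

Definition part_seq (c : int) : seq (seq nat) :=
  if c is Posz r then box_parts r r r else [::].

Lemma size_part_seq c : size (part_seq c) = npart c.
Proof. by case: c. Qed.

(** The i-th vector of the orthonormal Fock basis in weight 2m and degree d: the
    extremal vector has degree m^2, so partitions of d - m^2 occur. *)
Definition fb (m d : int) (i : nat) : L :=
  let w := hvec m (nth [::] (part_seq (d - m ^+ 2)) i) in
  (sqrtC (form w w))^-1 *: w.

Lemma part_seqP c la : la \in part_seq c ->
  [/\ sorted geq la, 0%N \notin la & (sumn la)%:Z = c].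
Proof.
case: c => // c; rewrite mem_box_parts => /and4P[sla ala _ /eqP sc]; split=> //.
  by apply/negP => /(allP ala).
by rewrite sc.
Qed.

Lemma nth_part_seqP m d i (la := nth [::] (part_seq (d - m ^+ 2)) i) :
  (i < npart (d - m ^+ 2))%N ->
  [/\ sorted geq la, 0%N \notin la & m ^+ 2 + (sumn la)%:Z = d].
Proof.
rewrite -size_part_seq => /(mem_nth [::]) /part_seqP[s0 s1 s2]; split=> //.
by rewrite s2 addrC subrK.
Qed.

Lemma wspace_fb m d i : (i < npart (d - m ^+ 2))%N -> wspace m d (fb m d i).
Proof.
move=> /nth_part_seqP[_ _ E]; apply: wspace_scale.
by rewrite -{1}E; apply: wspace_hvec.
Qed.

Lemma form_hvec_gt0 m la : 0%N \notin la -> 0 < form (hvec m la) (hvec m la).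
Proof. exact: (form_hmon_gt0 lv1 (extremal_ext_vec hL hform m)). Qed.

Lemma form_fb m d i j : (i < npart (d - m ^+ 2))%N -> (j < npart (d - m ^+ 2))%N ->
  form (fb m d i) (fb m d j) = (i == j)%:R.
Proof.
move=> hi hj; have [si i0 _] := nth_part_seqP hi; have [sj j0 _] := nth_part_seqP hj.
rewrite /fb dotZl dotZr.
have uq : uniq (part_seq (d - m ^+ 2)) by case: (d - _) => // c; apply: uniq_box_parts.
have [->|ij] := eqVneq i j.
  have := form_hvec_gt0 m j0; set z := form _ _ => z0.
  have s0 : 0 <= sqrtC z by rewrite sqrtC_ge0 ltW.
  have /CrealP -> : (sqrtC z)^-1 \is Num.real by rewrite realV ger0_real.
  rewrite -{3}(sqrtCK z) expr2 mulKf ?mulVf // sqrtC_eq0 gt_eqF //.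
rewrite [X in _ * (_ * X)](form_hmon_neq lv1 (extremal_ext_vec hL hform m)) ?mulr0 //.
apply: contra ij => pe; rewrite -(nth_uniq [::] _ _ uq) ?size_part_seq //.
apply/eqP/(sorted_eq _ _ si sj pe); first by apply: rev_trans; apply: leq_trans.
by move=> x y; rewrite /= andbC; apply: anti_leq.
Qed.

(** The remainder of the expansion is orthogonal to all Fock vectors, which span
    the module. *)
Lemma fb_complete m d x : wspace m d x ->
  x = \sum_(i < npart (d - m ^+ 2)) form x (fb m d i) *: fb m d i.
Proof.
move=> wx; apply/eqP; rewrite -subr_eq0; set y := _ - _.
have wy : wspace m d y.
  apply: wspace_add wx _; rewrite -scaleN1r; apply/wspace_scale/wspace_sum => i.
  exact/wspace_scale/wspace_fb.
have yfb (i : 'I_(npart (d - m ^+ 2))) : form y (fb m d i) = 0.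
  rewrite dotBl dot_suml (bigD1 i) //= dotZl form_fb // eqxx mulr1.
  rewrite big1 ?addr0 ?subrr // => j ji.
  by rewrite dotZl form_fb // (inj_eq val_inj) (negbTE ji) mulr0.
rewrite -(dnorm_eq0 form); apply/eqP.
apply: ortho_lspan (fock_spans hL hform y) => _ [m' [la la0 ->]].
have [|md] := eqVneq (m, d) (m', m' ^+ 2 + (sumn la)%:Z); last first.
  exact: wspace_ortho wy (wspace_hvec m' la) md.
case=> <- dE; pose la' := sort geq la.
have pe : perm_eq la la' by rewrite perm_sym perm_sort.
have la'P : la' \in part_seq (d - m ^+ 2).
  rewrite dE addrC addKr mem_box_parts sort_sorted; last by move=> a b; apply: leq_total.
  rewrite (perm_size (permEl (perm_sort _ _))) (perm_sumn (permEl (perm_sort _ _))).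
  rewrite eqxx andbT /=; apply/andP; split.
    apply/allP => k; rewrite mem_sort => kla; rewrite lt0n.
    rewrite (memPn la0) //=; elim: (la) kla => //= a s IH.
    by rewrite inE => /predU1P[->|/IH]; lia.
  elim: (la) la0 => //= a s IH; rewrite inE negb_or => /andP[a0 /IH]; lia.
have ii : (index la' (part_seq (d - m ^+ 2)) < npart (d - m ^+ 2))%N.
  by rewrite -size_part_seq index_mem.
have := yfb (Ordinal ii); rewrite /fb /= nth_index // dotZr => /eqP.
rewrite mulf_eq0 conjC_eq0 invr_eq0 sqrtC_eq0.
have /part_seqP[_ l0 _] := la'P; rewrite (gt_eqF (form_hvec_gt0 m l0)) /= => /eqP.
by rewrite /hvec -(hmon_perm _ lv1 pe).
Qed.

(** The operator e maps the weight space of spin k, of dimension p, to that of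
    spin k + 1, of dimension p', so that its kernel has dimension at least
    p - p'. *)
Lemma hw_exists (k : nat) (d : int) : exists g : nat -> L,
  (forall i, (i < mult k d)%N -> wspace k d (g i) /\ e 0 (g i) = 0) /\
  (forall i j, (i < mult k d)%N -> (j < mult k d)%N ->
     form (g i) (g j) = (i == j)%:R).
Proof.
pose p := npart (d - k%:Z ^+ 2); pose p' := npart (d - (k%:Z + 1) ^+ 2).
pose E : 'M[C]_(p, p') := \matrix_(i, j) form (e 0 (fb k d i)) (fb (k%:Z + 1) d j).
pose K := schmidt (row_base (kermx E)).
have rk : (\rank (kermx E) <= p)%N by apply: rank_leq_col.
have Ku : K \is unitarymx by apply: schmidt_unitarymx.
have KE : K *m E = 0.
  apply/sub_kermxP; rewrite (eqmx_schmidt_free (row_base_free _)).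
  by rewrite eq_row_base.
have mr : (mult k d <= \rank (kermx E))%N.
  by rewrite mxrank_ker leq_sub2l // rank_leq_col.
pose g i : L := if insub i is Some i' then \sum_(j < p) K i' j *: fb k d j else 0.
have gE i (hi : (i < \rank (kermx E))%N) :
    g i = \sum_(j < p) K (Ordinal hi) j *: fb k d j by rewrite /g insubT.
exists g; split=> [i hi|i j hi hj].
  rewrite (gE i (leq_trans hi mr)); set i' := Ordinal _; split.
    by apply: wspace_sum => j; apply/wspace_scale/wspace_fb.
  rewrite linear_sum /=.
  transitivity (\sum_(l < p') (K *m E) i' l *: fb (k%:Z + 1) d l); last first.
    by rewrite KE big1 // => l _; rewrite mxE scale0r.
  under [RHS]eq_bigr => l _ do rewrite mxE scaler_suml.
  rewrite exchange_big /=; apply: eq_bigr => j _; rewrite linearZ /=.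
  rewrite [e 0 _](@fb_complete (k%:Z + 1) d); last exact/wspace_e/wspace_fb.
  by rewrite scaler_sumr; apply: eq_bigr => l _; rewrite scalerA mxE.
rewrite (gE i (leq_trans hi mr)) (gE j (leq_trans hj mr)).
set i' := Ordinal (leq_trans hi mr); set j' := Ordinal (leq_trans hj mr).
rewrite dot_suml.
have /unitarymxP/matrixP/(_ i' j') := Ku; rewrite !mxE => <-.
apply: eq_bigr => a _; rewrite dotZl !mxE dot_sumr (bigD1 a) //= dotZr.
rewrite form_fb // eqxx mulr1 big1 ?addr0 // => b ba.
by rewrite dotZr form_fb // eq_sym (inj_eq val_inj) (negbTE ba) mulr0.
Qed.

Definition hw_family (hw : nat -> int -> nat -> L) : Prop :=
  (forall k d i, (i < mult k d)%N ->
     wspace k d (hw k d i) /\ e 0 (hw k d i) = 0) /\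
  (forall k d i j, (i < mult k d)%N -> (j < mult k d)%N ->
     form (hw k d i) (hw k d j) = (i == j)%:R).

Lemma hw_family_exists : exists hw, hw_family hw.
Proof.
have [hw hwP] := boolp.choice (fun kd : nat * int => hw_exists kd.1 kd.2).
exists (fun k d => hw (k, d)); split=> [k d|k d].
  by have [] := hwP (k, d).
by have [] := hwP (k, d).
Qed.

(** ** Strings of the finite sl2 *)

(** The normalization makes the norm of each vector that of g. *)
Fixpoint string (D : nat) (g : L) (j : nat) : L :=
  if j is j'.+1 then (sqrtC (j'.+1 * (D - j'))%N%:R)^-1 *: f 0 (string D g j')
  else g.

Lemma stringS D g j :
  string D g j.+1 = (sqrtC (j.+1 * (D - j))%N%:R)^-1 *: f 0 (string D g j).
Proof. by []. Qed.

Lemma sqrt_nat_neq0 n : (0 < n)%N -> sqrtC n%:R != 0 :> C.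
Proof. by move=> n0; rewrite sqrtC_eq0 pnatr_eq0; lia. Qed.

Lemma conj_sqrt_nat n : (sqrtC n%:R)^* = sqrtC n%:R :> C.
Proof. by apply/CrealP; rewrite ger0_real // sqrtC_ge0 ler0n. Qed.

Section String.
Variables (D : nat) (g : L).
Hypotheses (hg : h 0 g = D%:R *: g) (eg : e 0 g = 0).

Lemma string_f j : (j < D)%N ->
  f 0 (string D g j) = sqrtC (j.+1 * (D - j))%N%:R *: string D g j.+1.
Proof. by move=> jD; rewrite /= scalerKV // sqrt_nat_neq0 // muln_gt0 subn_gt0. Qed.

Lemma string_h j : h 0 (string D g j) = (D%:R - (j.*2)%:R) *: string D g j.
Proof.
elim: j => [|j IH]; first by rewrite subr0.
rewrite linearZ /= (comm_hf lv1) IH linearZ /= add0r -scalerBl scalerA mulrC -scalerA.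
by congr (_ *: (_ *: _)); rewrite doubleS -!natr1; ring.
Qed.

Lemma string_e j : (j < D)%N ->
  e 0 (string D g j.+1) = sqrtC (j.+1 * (D - j))%N%:R *: string D g j.
Proof.
elim: j => [|j IH] jD.
  rewrite linearZ /= (comm_ef lv1) eg linear0 add0r hg eqxx scale0r addr0 scalerA.
  rewrite mul1n subn0; congr (_ *: _).
  by rewrite -{2}(sqrtCK D%:R) expr2 mulKf // sqrt_nat_neq0 //; lia.
have jD' : (j < D)%N by lia.
move: (IH jD') (string_f jD') (string_h j.+1); rewrite [string D g j.+2]stringS.
set u := string D g j.+1 => {}IH fE hE.
rewrite linearZ /= (comm_ef lv1) eqxx scale0r !addr0 IH linearZ /= fE scalerA.
rewrite -expr2 sqrtCK hE -scalerDl scalerA; congr (_ *: _).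
set s := sqrtC _; have s0 : s != 0 by apply: sqrt_nat_neq0; rewrite muln_gt0 subn_gt0.
apply: (mulfI s0); rewrite mulVKf // -expr2 sqrtCK.
rewrite -mul2n !natrM !natrB ?(ltnW jD') //.
by rewrite -!natr1; ring.
Qed.

Lemma string_top : f 0 (string D g D) = 0.
Proof.
rewrite (norm_e0 (level_one_swap lv1)) // oppr0 (comm_ef lv1) eqxx scale0r !addr0.
rewrite string_h; case: D string_e string_f => [_ _|n Se Sf].
  by rewrite eg linear0 add0r subrr scale0r.
rewrite Se // linearZ_LR Sf // scalerA -expr2 sqrtCK.
rewrite -scalerDl subSnn muln1 -mul2n natrM.
by apply/eqP; rewrite scaler_eq0; apply/orP; left; apply/eqP; ring.
Qed.

End String.

Lemma form_stringS D D' g g' j j' : (j' < D')%N -> h 0 g' = D'%:R *: g' ->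
  e 0 g' = 0 -> form (string D g j.+1) (string D' g' j'.+1) =
  (sqrtC (j.+1 * (D - j))%N%:R)^-1 * sqrtC (j'.+1 * (D' - j'))%N%:R *
    form (string D g j) (string D' g' j').
Proof.
move=> jD hg eg.
rewrite stringS dotZl (adj_f lv1) oppr0 string_e // dotZr conj_sqrt_nat.
by rewrite mulrA.
Qed.

(** Each f on the left becomes an e on the right, and these exhaust the f applied
    to g' and then kill g'. *)
Lemma form_string_gt D D' g g' j j' : (j' < j)%N -> (j' <= D')%N ->
  h 0 g' = D'%:R *: g' -> e 0 g' = 0 ->
  form (string D g j) (string D' g' j') = 0.
Proof.
move=> + + hg eg; elim: j' j => [|j' IH] [|j] // jj jD.
  by rewrite stringS dotZl (adj_f lv1) oppr0 eg linear0r mulr0.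
by rewrite form_stringS // IH ?mulr0 //; apply: ltnW.
Qed.

Lemma form_string_eq D g g' j : (j <= D)%N ->
  h 0 g' = D%:R *: g' -> e 0 g' = 0 ->
  form (string D g j) (string D g' j) = form g g'.
Proof.
move=> + hg eg; elim: j => [//|j IH] jD; rewrite form_stringS // IH; last exact: ltnW.
by rewrite mulVf ?mul1r // sqrt_nat_neq0 // muln_gt0 subn_gt0.
Qed.

Section Basis.
Variable hw : nat -> int -> nat -> L.
Hypothesis hwP : hw_family hw.

Definition vec (k : nat) (d : int) (i j : nat) : L := string k.*2 (hw k d i) j.

Lemma hw_h k d i : (i < mult k d)%N -> h 0 (hw k d i) = (k.*2)%:R *: hw k d i.
Proof.
move=> /(proj1 hwP)[[-> _] _]; congr (_ *: _).
by rewrite intrM -mul2n natrM.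
Qed.

Lemma hw_e k d i : (i < mult k d)%N -> e 0 (hw k d i) = 0.
Proof. by move=> /(proj1 hwP)[]. Qed.

Lemma wspace_vec k d i j : (i < mult k d)%N ->
  wspace (k%:Z - j%:Z) d (vec k d i j).
Proof.
move=> hi; elim: j => [|j IH]; first by rewrite subr0; have [] := proj1 hwP k d i hi.
apply: wspace_scale; have := wspace_f IH.
by rewrite (_ : k%:Z - j%:Z - 1 = k%:Z - j.+1%:Z) //; lia.
Qed.

Lemma form_vec k d i j k' d' i' j' : (i < mult k d)%N -> (i' < mult k' d')%N ->
  (j <= k.*2)%N -> (j' <= k'.*2)%N ->
  form (vec k d i j) (vec k' d' i' j') =
  [&& k == k', d == d', i == i' & j == j']%:R.
Proof.
move=> hi hi' jk jk'; case: (ltngtP j j') => [jj|jj|<-]; rewrite ?andbF.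
- by rewrite dot_conj form_string_gt ?conjC0 //; [apply: hw_h | apply: hw_e].
- by rewrite form_string_gt //; [apply: hw_h | apply: hw_e].
have [kd|] := eqVneq (k%:Z - j%:Z, d) (k'%:Z - j%:Z, d'); last first.
  move=> kd; rewrite (wspace_ortho (wspace_vec j hi) (wspace_vec j hi') kd).
  case: eqP => //= kk; case: eqP => //= dd; case/eqP: kd.
  by rewrite kk dd.
case: kd => kk dd; have {}kk : k = k' by lia.
subst k' d'; rewrite !eqxx andbT /= form_string_eq //; last exact: hw_e.
  exact: (proj2 hwP).
exact: hw_h.
Qed.

Lemma mult_telescope (a : nat) d n : (a <= n)%N ->
  (\sum_(a <= k < n) mult k d + npart (d - n%:Z ^+ 2))%N = npart (d - a%:Z ^+ 2).
Proof.
elim: n => [|n IH]; first by rewrite leqn0 => /eqP ->; rewrite big_geq.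
rewrite leq_eqVlt => /predU1P[->|]; first by rewrite big_geq.
rewrite ltnS => an; rewrite big_nat_recr //= -(IH an) -addnA; congr addn.
have := npart_decr n d; rewrite /mult (_ : n%:Z + 1 = n.+1%:Z); last by lia.
by move=> le; rewrite subnK.
Qed.

Definition vec_gen (d : int) (w : L) : Prop :=
  exists k i j, [/\ (i < mult k d)%N, (j <= k.*2)%N & w = vec k d i j].

(** The string vectors in weight 2m and degree d are those with k >= |m| and
    j = k - m, in number the sum over k >= |m| of mult k d; it telescopes to the
    number of partitions of d - m^2, which is the dimension. *)
Lemma wspace_vec_span m d x : wspace m d x ->
  lspan (vec_gen d) x.
Proof.
move=> wx; pose a := `|m|%N; pose K := (a + `|d|).+1.
have am : a%:Z ^+ 2 = m ^+ 2.
  by rewrite /a; case: (m) => // n; rewrite NegzE sqrrN abszN.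
pose I := {k : 'I_K & 'I_(if (a <= k)%N then mult k d else 0%N)}.
have IP (u : I) : (a <= tag u)%N /\ (tagged u < mult (tag u) d)%N.
  by case: u => k i /=; case: leqP i => // _ [].
pose X (u : I) := vec (tag u) d (tagged u) `|(tag u)%:Z - m|%N.
have jX (u : I) : (tag u)%:Z - `|(tag u)%:Z - m|%N%:Z = m.
  by have [+ _] := IP u; rewrite /a; lia.
have jleX (u : I) : (`|(tag u)%:Z - m| <= (tag u).*2)%N.
  by have [+ _] := IP u; rewrite /a; lia.
have wX u : wspace m d (X u) by rewrite -{1}(jX u); apply: wspace_vec (IP u).2.
have cI : #|{: I}| = npart (d - m ^+ 2).
  rewrite card_tagged sumnE big_map big_enum /=.
  under eq_bigr => k _ do rewrite card_ord.
  rewrite -(big_mkord xpredT (fun k => if (a <= k)%N then mult k d else 0%N)).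
  rewrite (@big_cat_nat _ _ _ a) //=; last by rewrite /K; lia.
  rewrite big_nat big1 ?add0n => [|k ka]; last by rewrite ifF //; lia.
  rewrite big_nat (eq_bigr (fun k => mult k d)) => [|k ka]; last by rewrite ifT //; lia.
  rewrite -big_nat; have := @mult_telescope a d K; rewrite [npart (d - K%:Z ^+ 2)]box_neg_c.
    by rewrite addn0 am => -> //; rewrite /K; lia.
  have : (d : int) < K%:Z by rewrite /K; lia.
  have : K%:Z <= K%:Z ^+ 2 by rewrite expr2 ler_peMl // /K; lia.
  lia.
have -> := @orthonormal_full _ _ form (npart (d - m ^+ 2)) (fun i => fb m d i)
  I X x cI.
- apply: lspan_sum => u _; apply/lspan_scale/lspan_mem.
  by exists (tag u), (tagged u), `|(tag u)%:Z - m|%N; split=> //; case: (IP u).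
- by move=> u; apply: fb_complete.
- move=> u v; rewrite form_vec ?(IP _).2 //; congr (_%:R).
  have [->|uv] := eqVneq u v; first by rewrite !eqxx.
  apply/eqP; rewrite eqb0; apply: contra uv => /and4P[/eqP/val_inj kk _ /eqP ii _].
  case: u v kk ii => [k i] [k' i'] /= kk ii; subst k'.
  by rewrite (val_inj ii).
- by move=> i j; rewrite form_fb.
- exact: fb_complete.
Qed.

Lemma wspace_homog m d x : wspace m d x -> affine_homog A vac d x.
Proof.
move=> /fb_complete ->; apply: lspan_sum => i _.
have [_ _ E] := nth_part_seqP (ltn_ord i).
do 2!apply: lspan_scale; apply: lspan_mem; rewrite -[in loop_word _ _ d]E.
exact: word_hmon.
Qed.

Lemma affine_homogE d x : affine_homog A vac d x <-> lspan (vec_gen d) x.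
Proof.
split; apply: (lspan_map (g := idfun)) => w /=.
  move/word_wspace; apply: (lspan_map (g := idfun)) => u [m] /=.
  exact: wspace_vec_span.
by case=> k [i [j [hi hj ->]]]; apply: wspace_homog (wspace_vec j hi).
Qed.

Lemma vec_span x : lspan (fun w => exists d, vec_gen d w) x.
Proof.
apply: (lspan_map (g := idfun) _ (fock_spans hL hform x)) => _ [m [la la0 ->]] /=.
apply: (lspan_map (g := idfun) _ (wspace_vec_span (wspace_hvec m la))) => w vw /=.
by apply: lspan_mem; exists (m ^+ 2 + (sumn la)%:Z).
Qed.

Lemma loop_vec x k d i j : \tr x = 0 -> (i < mult k d)%N -> (j <= k.*2)%N ->
  loop A x 0 (vec k d i j) =
  \sum_(l < k.*2.+1) irrep_coef k.*2 x l j *: vec k d i l.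
Proof.
move=> tx hi jk; have hg := hw_h hi; have eg := hw_e hi.
set D := k.*2 in jk hg *; rewrite loop_sl2 //.
have term (a : nat -> C) l : (l <= D)%N ->
    \sum_(q < D.+1) (if q == l :> nat then a q else 0) *: vec k d i q =
    a l *: vec k d i l.
  move=> lD; rewrite (bigD1 (Ordinal (lD : (l < D.+1)%N))) //= eqxx.
  by rewrite big1 ?addr0 // => q ql; rewrite ifF ?scale0r //; apply: negbTE ql.
pose cE q := if j == q.+1 then x 0 1 * sqrtC (j * (D - q))%N%:R else 0.
pose cF q := if q == j.+1 then x 1 0 * sqrtC (q * (D - j))%N%:R else 0.
pose cH q := if q == j then x 0 0 * (D%:R - (j.*2)%:R) else 0.
have -> : \sum_(l < D.+1) irrep_coef D x l j *: vec k d i l =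
    \sum_(l < D.+1) cE l *: vec k d i l + \sum_(l < D.+1) cF l *: vec k d i l +
    \sum_(l < D.+1) cH l *: vec k d i l.
  rewrite -!big_split /=; apply: eq_bigr => l _; rewrite -!scalerDl.
  congr (_ *: _); rewrite /irrep_coef /cE /cF /cH.
  case: eqP => [->|lj].
    by rewrite !ifF ?add0r //; apply/eqP; lia.
  case: eqP => [->|lj']; last by rewrite !addr0.
  by rewrite ifF ?add0r ?addr0 //; apply/eqP; lia.
congr (_ + _ + _).
- case: j jk @cE {cF cH} => [|j] jk cE.
    by rewrite eg scaler0 big1 // => l _; rewrite scale0r.
  rewrite string_e // scalerA -(term (fun q => x 0 1 * sqrtC (j.+1 * (D - q))%N%:R)); last exact: ltnW.
  by apply: eq_bigr => l _; rewrite /cE eqSS eq_sym.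
- have [jD|jD] := ltnP j D; last first.
    have -> : j = D by lia.
    rewrite string_top // scaler0 big1 // => l _.
    by rewrite /cF ifF ?scale0r //; have := ltn_ord l; lia.
  by rewrite string_f // scalerA -(term (fun q => x 1 0 * sqrtC (q * (D - j))%N%:R)).
- rewrite string_h // scalerA.
  by rewrite -(term (fun q => x 0 0 * (D%:R - (j.*2)%:R))).
Qed.

End Basis.
End HighestWeight.

(** * Coordinates of the Schur-Weyl sums *)

Section Index.
Variable N : nat.
Implicit Types (s t : stab N) (p q : sw_index N).

Lemma same_uptoP (s t : filling) : reflect (forall i, (i < N)%N -> s i = t i) (same_upto N s t).
Proof.
apply: (iffP forallP) => [h i iN|h i]; last by apply/eqP/h.
by apply/eqP/(h (Ordinal iN)).
Qed.

Lemma stab_standard t : standard N (rows t).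
Proof. exact: valP t. Qed.

Lemma stab_inj s t : (forall i, (i < N)%N -> rows s i = rows t i) -> s = t.
Proof.
move=> st; apply/val_inj/val_inj/(@eq_from_nth _ false); rewrite !size_tuple //.
Qed.

Lemma same_upto_stab s t : same_upto N (rows s) (rows t) = (s == t).
Proof.
apply/same_uptoP/eqP => [|-> //]; exact: stab_inj.
Qed.

Lemma mkseq_standard (t : filling) : standard N t ->
  standard N (nth false (mkseq t N)).
Proof. by rewrite (@eq_standard _ t) // => i iN; rewrite nth_mkseq. Qed.

Definition mk_stab (t : filling) (st : standard N t) : stab N :=
  Sub [tuple of mkseq t N] (mkseq_standard st).

Lemma rows_mk_stab (t : filling) (st : standard N t) i :
  (i < N)%N -> rows (mk_stab st) i = t i.
Proof. by move=> iN; rewrite /rows /= nth_mkseq. Qed.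

(** The index of u_j in the summand of the tableau s; a weight j out of range
    gives u_0. *)
Definition swi (s : stab N) (j : nat) : sw_index N :=
  Tagged (fun t => 'I_(spin2 N (rows t)).+1) (inord j : 'I_(spin2 N (rows s)).+1).

Lemma tab_swi s j : tab (swi s j) = s. Proof. by []. Qed.

Lemma wt_swi s j : (j <= spin2 N (rows s))%N -> wt (swi s j) = j.
Proof. by move=> js; rewrite /wt /= inordK. Qed.

Lemma wt_le p : (wt p <= spin2 N (rows (tab p)))%N.
Proof. by case: p => t j; rewrite /wt -ltnS. Qed.

Lemma swiK p : swi (tab p) (wt p) = p.
Proof. by case: p => t j; rewrite /swi /tab /wt /= inord_val. Qed.

Lemma sw_index_eqP p q : (p == q) = (tab p == tab q) && (wt p == wt q).
Proof.
apply/eqP/andP => [->//|[/eqP tpq /eqP wpq]].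
by rewrite -(swiK p) -(swiK q) tpq wpq.
Qed.

End Index.

Section Sums.
Variables (C : numClosedFieldType) (V : lmodType C) (N : nat).

Lemma sum_tab (s : stab N) (F : sw_index N -> V) :
  \sum_(p | tab p == s) F p = \sum_(j < (spin2 N (rows s)).+1) F (swi s j).
Proof.
rewrite (eq_bigl (fun p : sw_index N => (tag p == s) && true)) => [|p]; last first.
  by rewrite andbT.
rewrite (eq_bigr (fun p : sw_index N => F (Tagged _ (tagged p)))) => [|[t j]] //.
rewrite -(sig_big_dep (fun t => t == s) (fun _ _ => true)
  (fun t (j : 'I_(spin2 N (rows t)).+1) => F (Tagged _ j))) big_pred1_eq.
by apply: eq_bigr => j _; rewrite /swi inord_val.
Qed.

Lemma sum_pure d (u : irrep C d) (t : filling) (s : stab N) (g : stab N -> nat -> V) :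
  (forall i, (i < N)%N -> rows s i = t i) -> spin2 N t = d ->
  \sum_p pure_sw N u t p *: g (tab p) (wt p) = \sum_(j < d.+1) u j *: g s j.
Proof.
move=> st sd; have sds : spin2 N (rows s) = d by rewrite -sd; apply: eq_spin2.
have same p : same_upto N (rows (tab p)) t = (tab p == s).
  rewrite -same_upto_stab; apply: eq_forallb => i.
  by rewrite st.
rewrite (bigID (fun p => tab p == s)) /= [X in _ + X]big1 ?addr0 => [|p ps]; last first.
  by rewrite ffunE big1 ?scale0r // => j; rewrite same (negbTE ps).
rewrite sum_tab sds; apply: eq_bigr => j _.
rewrite ffunE same tab_swi eqxx wt_swi ?sds; last by rewrite -ltnS.
by rewrite (big_pred1 j) // => l; rewrite andTb.
Qed.

End Sums.

Section Serpentine.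
Variables (C : numClosedFieldType) (N : nat).

Lemma stab_ext_standard (t : stab N) : standard N.+2 (add_two N (rows t)).
Proof. by rewrite standard_add_two stab_standard. Qed.

(** The embedding i_N on tableaux. *)
Definition stab_ext (t : stab N) : stab N.+2 := mk_stab (stab_ext_standard t).

Lemma rows_stab_ext t i : (i < N.+2)%N -> rows (stab_ext t) i = add_two N (rows t) i.
Proof. exact: rows_mk_stab. Qed.

Lemma val_stab_ext t : val (stab_ext t) = val t ++ [:: false; true] :> bitseq.
Proof.
apply: (@eq_from_nth _ false) => [|i]; rewrite size_tuple.
  by rewrite size_cat size_tuple addn2.
by move=> iN; rewrite (nth_cat_add_two (size_tuple (val t))) -rows_stab_ext.
Qed.

Lemma spin2_stab_ext t : spin2 N.+2 (rows (stab_ext t)) = spin2 N (rows t).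
Proof. by rewrite (eq_spin2 (@rows_stab_ext t)) spin2_add_two. Qed.

Lemma stab_ext_inj : injective stab_ext.
Proof.
move=> s t st; apply: stab_inj => i iN.
have := congr1 (fun x => rows x i) st; rewrite !rows_stab_ext ?add_two_lt //; lia.
Qed.

Lemma serp_fun_swi (v : sw_sum C N) t j : (j <= spin2 N (rows t))%N ->
  serp_fun v (swi (stab_ext t) j) = v (swi t j).
Proof.
move=> jt; rewrite ffunE tab_swi wt_swi ?spin2_stab_ext //.
rewrite (big_pred1 (swi t j)) // => q.
rewrite [RHS]sw_index_eqP tab_swi wt_swi //; congr andb.
apply/same_uptoP/eqP => [h|->]; last exact: rows_stab_ext.
apply: stab_inj => i iN; have := h i; rewrite rows_stab_ext ?add_two_lt //; [|lia..].
by move=> ->; lia.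
Qed.

Lemma serp_fun_notin (v : sw_sum C N) p :
  (forall t, tab p != stab_ext t) -> serp_fun v p = 0.
Proof.
move=> pt; rewrite ffunE big1 // => q /andP[/same_uptoP h _].
case/eqP: (pt (tab q)); apply: stab_inj => i iN.
by rewrite h // rows_stab_ext.
Qed.

Lemma sum_serp (V : lmodType C) (v : sw_sum C N) (g : stab N.+2 -> nat -> V) :
  \sum_p serp_fun v p *: g (tab p) (wt p) =
  \sum_p v p *: g (stab_ext (tab p)) (wt p).
Proof.
under eq_bigr => p _ do rewrite ffunE scaler_suml.
rewrite (exchange_big_dep xpredT) //=; apply: eq_bigr => q _.
rewrite (big_pred1 (swi (stab_ext (tab q)) (wt q))) => [|p].
  by rewrite tab_swi wt_swi // spin2_stab_ext wt_le.
rewrite [RHS]sw_index_eqP tab_swi wt_swi ?spin2_stab_ext ?wt_le // [wt q == _]eq_sym.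
congr andb; apply/same_uptoP/eqP => [h|->]; last exact: rows_stab_ext.
by apply: stab_inj => i iN; rewrite h // rows_stab_ext.
Qed.

(** An infinite tableau with entries N+1 and N+2 in the first and second row
    gives compatible vectors in both spaces. *)
Lemma serp_pure d (u : irrep C d) (t : filling) : t N = false -> t N.+1 = true ->
  serp_fun (pure_sw N u t) = pure_sw N.+2 u t.
Proof.
move=> t0 t1; have tE i : (i < N.+2)%N -> add_two N t i = t i.
  rewrite ltnS leq_eqVlt => /predU1P[->|]; first by rewrite add_two_N1 t1.
  rewrite ltnS leq_eqVlt => /predU1P[->|]; first by rewrite add_two_N t0.
  exact: add_two_lt.
apply/ffunP => p; have [[s ps]|np] := pselect (exists s, tab p = stab_ext s).
  have wp : (wt p <= spin2 N (rows s))%N by rewrite -spin2_stab_ext -ps wt_le.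
  rewrite -[p]swiK ps serp_fun_swi // !ffunE !tab_swi !wt_swi ?spin2_stab_ext //.
  apply: eq_bigl => j; congr andb; apply/same_uptoP/same_uptoP => h i iN.
    rewrite rows_stab_ext // -tE // /add_two; case: ifP => // il; exact: h.
  by have := h i; rewrite rows_stab_ext ?add_two_lt; [apply|..]; lia.
rewrite serp_fun_notin => [|s]; last by apply/eqP => ps; apply: np; exists s.
rewrite ffunE big1 // => j /andP[/same_uptoP h _]; case: np.
have st : standard N t.
  rewrite -standard_add_two (eq_standard tE) -(eq_standard h).
  exact: stab_standard.
exists (mk_stab st); apply: stab_inj => i iN.
rewrite h // rows_stab_ext // -tE // /add_two; case: ifP => // il.
by rewrite rows_mk_stab.
Qed.

End Serpentine.

(** * Maps out of the inductive limit *)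

Section LimMap.
Variables (C : numClosedFieldType) (a : chain C).

Lemma seq_of_germ x : compatible a x -> ev_eq (seq_of (germ a x)) x.
Proof. exact: germK. Qed.

Lemma lim_dot_eq (p q : indlim a) c :
  (exists n0, forall n, (n0 <= n)%N -> hdot (seq_of p n) (seq_of q n) = c) ->
  lim_dot p q = c.
Proof.
move=> hc; apply: xget_unique => // c' [n1 h1].
by case: hc => n0 h0; rewrite -(h0 (maxn n0 n1)) ?leq_maxl // h1 ?leq_maxr.
Qed.

Lemma lim_addE (p q : indlim a) :
  ev_eq (seq_of (p + q)) (fun n => seq_of p n + seq_of q n).
Proof. exact/seq_of_germ/compatibleD/seq_ofP/seq_ofP. Qed.

Lemma lim_scaleE c (p : indlim a) :
  ev_eq (seq_of (c *: p)) (fun n => c *: seq_of p n).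
Proof. exact/seq_of_germ/compatibleZ/seq_ofP. Qed.

Variables (L : lmodType C) (T : forall n, {linear tensor C n.*2 -> L}).
Hypothesis hT : forall n v, T n.+1 (a n v) = T n v.

(** The maps are evaluated at an index from which the representative follows the
    chain. *)
Definition lim_map (p : indlim a) : L :=
  let n := projT1 (cid (seq_ofP p)) in T n (seq_of p n).

Lemma lim_mapP p : exists n0, forall n, (n0 <= n)%N ->
  T n (seq_of p n) = lim_map p.
Proof.
rewrite /lim_map; case: cid => n0 h0 /=; exists n0.
elim=> [|n IH]; first by rewrite leqn0 => /eqP ->.
by rewrite leq_eqVlt => /predU1P[->//|]; rewrite ltnS => le; rewrite h0 // hT IH.
Qed.

Lemma lim_map_eq p c :
  (exists n0, forall n, (n0 <= n)%N -> T n (seq_of p n) = c) -> lim_map p = c.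
Proof.
move=> [n0 h0]; have [n1 h1] := lim_mapP p.
by rewrite -(h0 (maxn n0 n1)) ?leq_maxl // h1 ?leq_maxr.
Qed.

Lemma lim_map_germ x c : compatible a x ->
  (exists n0, forall n, (n0 <= n)%N -> T n (x n) = c) -> lim_map (germ a x) = c.
Proof.
move=> cx [n0 h0]; have [n1 h1] := seq_of_germ cx; apply: lim_map_eq.
exists (maxn n0 n1) => n; rewrite geq_max => /andP[le0 le1].
by rewrite h1 // h0.
Qed.

Lemma lim_map_is_linear : linear lim_map.
Proof.
move=> c p q; apply: lim_map_eq.
have [n1 h1] := lim_mapP p; have [n2 h2] := lim_mapP q.
have [n3 h3] := lim_addE (c *: p) q; have [n4 h4] := lim_scaleE c p.
exists (maxn (maxn n1 n2) (maxn n3 n4)) => n; rewrite !geq_max.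
case/andP => /andP[le1 le2] /andP[le3 le4].
by rewrite h3 // h4 // linearP h1 // h2.
Qed.

End LimMap.

Section SchurWeyl.
Variables (C : numClosedFieldType) (phi : schur_weyl_family C).
Hypothesis hphi : forall n, schur_weyl_iso (phi n).

Lemma phi_ker n : lker (phi n) == 0%VS.
Proof. by apply/lker0P/bij_inj/swi_bij/hphi. Qed.

Lemma phi_invK n v : phi n ((phi n)^-1%VF v) = v.
Proof.
have [psi K1 K2] := swi_bij (hphi n).
by rewrite -[v]K2 (lker0_lfunK (phi_ker n)).
Qed.

Lemma phi_serpentine n v : phi n.+1 (serpentine phi n v) = serp_fun (phi n v).
Proof. by rewrite /serpentine !comp_lfunE phi_invK lfunE. Qed.

Lemma pure_compatible d (u : irrep C d) (t : filling) n0 :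
  (forall i, (n0.*2 <= i)%N -> t i = odd i) ->
  compatible (serpentine phi) (fun n => (phi n)^-1%VF (pure_sw n.*2 u t)).
Proof.
move=> ht; exists n0 => n hn; rewrite /serpentine !comp_lfunE phi_invK lfunE /=.
congr (_ _); rewrite serp_pure // ht; rewrite /= ?odd_double //; lia.
Qed.

End SchurWeyl.

(** * Tail equivalence *)

Definition ext_word (s : bitseq) : filling :=
  fun i => if (i < size s)%N then nth false s i else odd i.

Lemma nrow_odd (t : filling) n0 n : (n0 <= n)%N ->
  (forall i, (n0.*2 <= i)%N -> t i = odd i) ->
  forall b, nrow t b n.*2 = (nrow t b n0.*2 + (n - n0))%N.
Proof.
move=> le ht b; elim: n le => [|n IH]; first by rewrite leqn0 => /eqP->; rewrite subn0 addn0.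
rewrite leq_eqVlt => /predU1P[<-|]; first by rewrite subnn addn0.
rewrite ltnS => le; rewrite doubleS !nrowS !ht /= ?odd_double; [|lia..].
by rewrite IH //; case: (b); lia.
Qed.

Lemma odd_tail_add_two (t : filling) n :
  (forall i, (n.*2 <= i)%N -> t i = odd i) ->
  forall i, (i < n.+1.*2)%N -> t i = add_two n.*2 t i.
Proof.
move=> ht i; rewrite doubleS ltnS leq_eqVlt => /predU1P[->|].
  by rewrite add_two_N1 ht /= ?odd_double.
rewrite ltnS leq_eqVlt => /predU1P[->|]; first by rewrite add_two_N ht ?odd_double.
by move=> il; rewrite add_two_lt.
Qed.

Lemma rgrade_odd (t : filling) n0 n : (n0 <= n)%N ->
  (forall i, (n0.*2 <= i)%N -> t i = odd i) -> rgrade n t = rgrade n0 t.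
Proof.
move=> le ht; elim: n le => [|n IH]; first by rewrite leqn0 => /eqP->.
rewrite leq_eqVlt => /predU1P[<- //|]; rewrite ltnS => le.
rewrite (@eq_rgrade _ (add_two n.*2 t)) ?rgrade_add_two ?IH //.
by apply: odd_tail_add_two => i ni; apply: ht; lia.
Qed.

Lemma spin2_odd (t : filling) n0 n : (n0 <= n)%N ->
  (forall i, (n0.*2 <= i)%N -> t i = odd i) -> spin2 n.*2 t = spin2 n0.*2 t.
Proof. by move=> le ht; rewrite /spin2 !(nrow_odd le ht) subnDr. Qed.

Lemma tau_odd k i : (k.*2 < i)%N -> tau k i = odd i.
Proof. by rewrite /tau => ->. Qed.

Lemma nrow_tau k n : (k <= n)%N ->
  nrow (tau k) true n.*2 = (n - k)%N /\ nrow (tau k) false n.*2 = (n + k)%N.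
Proof.
move=> kn; have ht i : (k.*2 <= i)%N -> tau k i = odd i.
  by rewrite leq_eqVlt => /predU1P[<-|/tau_odd //]; rewrite /tau ltnn odd_double.
have t0 : nrow (tau k) true k.*2 = 0%N.
  rewrite (@eq_nrow _ (fun=> false)) => [|i ik]; last by rewrite /tau ltnNge ltnW.
  by rewrite /nrow big1.
have := nrow_total (tau k) k.*2; rewrite !(nrow_odd kn ht) t0; lia.
Qed.

(** Being tail-equivalent to tau k means alternating from some even point on and
    having spin k there; this form is the one used below. *)
Lemma tail_class_odd k t : tail_class k t ->
  exists n0, [/\ (forall n, standard n.*2 t), (forall n, (n0 <= n)%N -> spin2 n.*2 t = k.*2)
    & (forall i, (n0.*2 <= i)%N -> t i = odd i)].
Proof.
move=> [st [l0 h]]; exists (l0 + k).+1; split=> [n|n hn|i hi]; first exact: st.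
  have [hr _] := h n.*2 ltac:(lia); rewrite /spin2 !hr.
  by have [|-> ->] := @nrow_tau k n; lia.
have [_ hc] := h i ltac:(lia); have := congr1 fst (hc i (leqnn i)).
by rewrite -(@tau_odd k); [rewrite /cell /=; case: (t i); case: (tau k i) | lia].
Qed.

Lemma odd_tail_class k t n0 : standard n0.*2 t -> spin2 n0.*2 t = k.*2 ->
  (forall i, (n0.*2 <= i)%N -> t i = odd i) -> tail_class k t.
Proof.
move=> st sp ht.
have std n : (n0 <= n)%N -> standard n.*2 t.
  elim: n => [|n IH]; first by rewrite leqn0 => /eqP <-.
  rewrite leq_eqVlt => /predU1P[<- //|]; rewrite ltnS => le.
  rewrite doubleS (@eq_standard _ (add_two n.*2 t)) ?standard_add_two ?IH //.
  by apply: odd_tail_add_two => i ni; apply: ht; lia.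
split.
  move=> N; have /standardP h := std (N + n0)%N (leq_addl _ _).
  by apply/standardP => l lN; apply: h; lia.
have le0 : (nrow t true n0.*2 <= nrow t false n0.*2)%N by have /standardP := st; apply.
pose m := maxn n0 k; exists m.*2.+1 => l hl.
have tE i : (m.*2 < i)%N -> t i = tau k i.
  by move=> mi; rewrite tau_odd ?ht //; lia.
have rows_eq b j : nrow t b (m.*2 + j) = nrow (tau k) b (m.*2 + j).
  elim: j => [|j IH].
    have m1 : (n0 <= m)%N by apply: leq_maxl.
    have m2 : (k <= m)%N by apply: leq_maxr.
    have [t1 t2] := nrow_tau m2.
    rewrite addn0; have := nrow_total t n0.*2; have := sp; rewrite /spin2.
    by case: b; rewrite (nrow_odd m1 ht) ?t1 ?t2; lia.
  rewrite addnS !nrowS IH; congr (_ + _)%N; congr (nat_of_bool (_ == b)).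
  case: j {IH} => [|j]; last by apply: tE; lia.
  by rewrite addn0 ht /tau; lia.
split=> [b|i li].
  by have := rows_eq b (l - m.*2)%N; rewrite subnKC //; lia.
rewrite /cell tE; last by lia.
by have := rows_eq (tau k i) (i - m.*2)%N; rewrite subnKC => [->//|]; lia.
Qed.

(** * The isomorphism with the serpentine limit *)

Lemma spin2_half n t : (spin2 n.*2 t)./2.*2 = spin2 n.*2 t.
Proof. by have := nrow_total t n.*2; rewrite /spin2; lia. Qed.

Lemma hdot_eq0 (C : numClosedFieldType) (I : finType) (u v : {ffun I -> C^o}) :
  0 = hdot (u - v) (u - v) -> u = v.
Proof.
move=> /esym/eqP; rewrite psumr_eq0 => [|i _]; last exact: mul_conjC_ge0.
move=> /allP h; apply/ffunP => i; have := h i; rewrite mem_index_enum => /(_ isT).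
by rewrite /= mul_conjC_eq0 !ffunE subr_eq0 => /eqP.
Qed.

Section Isomorphism.
Variables (C : numClosedFieldType) (phi : schur_weyl_family C).
Hypothesis hphi : forall n, schur_weyl_iso (phi n).
Variables (L : lmodType C) (A : affine_module L) (vac : L).
Hypothesis hL : basic_module A vac.
Variable form : {dot L for Num.conj}.
Hypothesis hform : invariant_form A form vac.
Variable hw : nat -> int -> nat -> L.
Hypothesis hwP : hw_family A form hw.

Let vec := vec A hw.

Definition word N (t : stab N) : bitseq := tval (val t).

Definition tab_spin n (t : stab n.*2) : nat := (spin2 n.*2 (rows t))./2.

Definition tab_index n (t : stab n.*2) : nat :=
  index (word t) (tabs (tab_spin t) (rgrade n (rows t)) n).

(** A tableau is sent to the string vector numbered by its position in the list
    of tableaux of its spin and degree. *)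
Definition vecS n (t : stab n.*2) (j : nat) : L :=
  vec (tab_spin t) (rgrade n (rows t)) (tab_index t) j.

Lemma stab_tabs n (t : stab n.*2) :
  word t \in tabs (tab_spin t) (rgrade n (rows t)) n.
Proof.
by rewrite mem_tabs mem_ballots size_tuple eqxx stab_standard /has_type spin2_half !eqxx.
Qed.

Lemma tab_index_lt n (t : stab n.*2) :
  (tab_index t < mult (tab_spin t) (rgrade n (rows t)))%N.
Proof. by apply: leq_trans (size_tabs_mult _ _ n); rewrite index_mem stab_tabs. Qed.

Lemma rgrade_stab_ext n (t : stab n.*2) :
  rgrade n.+1 (rows (stab_ext t)) = rgrade n (rows t).
Proof.
by rewrite (@eq_rgrade _ _ n.+1 (@rows_stab_ext _ t)) rgrade_add_two.
Qed.

Lemma tab_spin_ext n (t : stab n.*2) :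
  @tab_spin n.+1 (stab_ext t) = tab_spin t.
Proof. exact: (congr1 half (spin2_stab_ext t)). Qed.

(** The lists of tableaux were built to make this true. *)
Lemma vecS_ext n (t : stab n.*2) j : @vecS n.+1 (stab_ext t) j = vecS t j.
Proof.
rewrite /vecS tab_spin_ext rgrade_stab_ext; congr (vec _ _ _ j).
rewrite /tab_index tab_spin_ext rgrade_stab_ext.
by rewrite [word (stab_ext t)]val_stab_ext index_tabs // stab_tabs.
Qed.

Lemma wt_le_spin n (p : sw_index n.*2) : (wt p <= (tab_spin (tab p)).*2)%N.
Proof. by rewrite spin2_half wt_le. Qed.

Lemma form_vecS n (p q : sw_index n.*2) :
  form (vecS (tab p) (wt p)) (vecS (tab q) (wt q)) = (p == q)%:R.
Proof.
rewrite (form_vec hL hform hwP) ?tab_index_lt ?wt_le_spin //; congr (_%:R).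
have [->|pq] := eqVneq p q; first by rewrite !eqxx.
apply/eqP; rewrite eqb0; apply: contra pq => /and4P[/eqP kk /eqP dd ii wpq].
rewrite sw_index_eqP wpq andbT.
have hq := stab_tabs (tab q); have := stab_tabs (tab p).
move: ii; rewrite /tab_index kk dd; set r := tabs _ _ _ => /eqP ii hp.
have := congr1 (nth [::] r) ii; rewrite !nth_index //.
by move=> /val_inj/val_inj->.
Qed.

Definition sw_vec n (v : tensor C n.*2) : L :=
  \sum_p phi n v p *: vecS (tab p) (wt p).

Lemma sw_vec_is_linear n : linear (@sw_vec n).
Proof.
move=> c u v; rewrite /sw_vec linearP scaler_sumr -big_split /=.
by apply: eq_bigr => p _; rewrite !ffunE scalerDl scalerA.
Qed.

HB.instance Definition _ n :=
  GRing.isLinear.Build C (tensor C n.*2) L _ (@sw_vec n) (@sw_vec_is_linear n).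

Lemma form_sw_vec n u v : form (@sw_vec n u) (sw_vec v) = hdot u v.
Proof.
rewrite -(swi_isometry (hphi n)) dot_suml; apply: eq_bigr => p _.
rewrite dotZl dot_sumr (bigD1 p) //= dotZr form_vecS eqxx mulr1.
rewrite big1 ?addr0 // => q qp.
by rewrite dotZr form_vecS eq_sym (negbTE qp) mulr0.
Qed.

Lemma sw_vec_serpentine n v : @sw_vec n.+1 (serpentine phi n v) = sw_vec v.
Proof.
rewrite /sw_vec phi_serpentine // (sum_serp _ (@vecS n.+1)).
by apply: eq_bigr => p _; rewrite vecS_ext.
Qed.

Lemma sw_vec_sl2 n x v : \tr x = 0 ->
  @sw_vec n (sl2_tensor x v) = loop A x 0 (sw_vec v).
Proof.
move=> tx; rewrite /sw_vec (swi_sl2 (hphi n)) // linear_sum /=.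
under eq_bigr => p _ do rewrite ffunE scaler_suml.
rewrite (exchange_big_dep xpredT) //=; apply: eq_bigr => q _.
rewrite linearZ /= (loop_vec hL hform hwP) ?tab_index_lt ?wt_le_spin //.
rewrite scaler_sumr (eq_bigl (fun p => tab p == tab q)) => [|p]; last by rewrite eq_sym.
rewrite sum_tab spin2_half; apply: eq_bigr => l _.
have ll : (l <= spin2 n.*2 (rows (tab q)))%N by rewrite -ltnS.
by rewrite tab_swi wt_swi // scalerA mulrC.
Qed.

Definition sw_lin n : {linear tensor C n.*2 -> L} := @sw_vec n.

Definition serp_map : indlim (serpentine phi) -> L := lim_map sw_lin.

Lemma serp_map_linear : linear serp_map.
Proof. exact: lim_map_is_linear sw_vec_serpentine. Qed.

Lemma serp_map0 : serp_map 0 = 0.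
Proof. by have := serp_map_linear (-1) 0 0; rewrite !scaleN1r oppr0 addr0 addNr. Qed.

Lemma serp_mapP p : exists n0, forall n, (n0 <= n)%N ->
  sw_vec (seq_of p n) = serp_map p.
Proof. exact: lim_mapP sw_vec_serpentine p. Qed.

Lemma serp_map_isometry p q : lim_dot p q = form (serp_map p) (serp_map q).
Proof.
have [n1 h1] := serp_mapP p; have [n2 h2] := serp_mapP q.
apply: lim_dot_eq; exists (maxn n1 n2) => n; rewrite geq_max => /andP[le1 le2].
by rewrite -form_sw_vec h1 // h2.
Qed.

Lemma sw_vec_inj n : injective (@sw_vec n).
Proof.
move=> u v /eqP; rewrite -subr_eq0 -(raddfB (sw_lin n)) => /eqP z.
have := form_sw_vec (u - v) (u - v); rewrite -[sw_vec _]/(sw_lin n _) z linear0r.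
exact/hdot_eq0.
Qed.

Lemma serp_map_inj : injective serp_map.
Proof.
move=> p q pq; have [n1 h1] := serp_mapP p; have [n2 h2] := serp_mapP q.
rewrite -(seq_ofK p) -(seq_ofK q); apply: germ_eq; first exact: seq_ofP.
exists (maxn n1 n2) => n; rewrite geq_max => /andP[le1 le2].
by apply: sw_vec_inj; rewrite h1 // h2.
Qed.

(** The generators of the grading, that is the vectors of the limit given by an
    infinite tableau t. *)
Definition pure_germ d (u : irrep C d) (t : filling) : indlim (serpentine phi) :=
  germ (serpentine phi) (fun n => (phi n)^-1%VF (pure_sw n.*2 u t)).

Lemma serp_map_odd k d (u : irrep C k.*2) (t : filling) m
    (i := index (mkseq t m.*2) (tabs k d m)) :
  (forall n, standard n.*2 t) -> spin2 m.*2 t = k.*2 -> rgrade m t = d ->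
  (forall i, (m.*2 <= i)%N -> t i = odd i) ->
  (i < mult k d)%N /\
  serp_map (pure_germ u t) = \sum_(j < k.*2.+1) u j *: vec k d i j.
Proof.
move=> st sp rg od; pose s n := mk_stab (st n).
have sE n : (m <= n)%N -> [/\ tab_spin (s n) = k, rgrade n (rows (s n)) = d
    & spin2 n.*2 t = k.*2].
  move=> le; have e := @rows_mk_stab _ t (st n).
  rewrite /tab_spin (eq_spin2 e) (eq_rgrade e) (spin2_odd le od) sp doubleK.
  by rewrite (rgrade_odd le od) rg.
have [s1 s2 _] := sE m (leqnn m).
have im : tab_index (s m) = i by rewrite /tab_index s1 s2.
have iE n : (m <= n)%N -> tab_index (s n) = i.
  elim: n => [|n IH]; first by rewrite leqn0 => /eqP <-.
  rewrite leq_eqVlt => /predU1P[<- //|]; rewrite ltnS => le; rewrite -(IH le).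
  have [q1 q2 _] := sE _ le; have [|q1' q2' _] := sE n.+1; first exact: leqW.
  rewrite /tab_index q1 q2 q1' q2'.
  have -> : word (s n.+1) = word (s n) ++ [:: false; true].
    rewrite -(val_stab_ext (s n)); congr (tval (val _)); apply: stab_inj => l lN.
    rewrite rows_mk_stab // (@rows_stab_ext n.*2) // (@odd_tail_add_two t n) //.
      by rewrite /add_two; case: ifP => // il; rewrite rows_mk_stab.
    by move=> j nj; apply: od; lia.
  by rewrite index_tabs // -[X in tabs X _]q1 -[X in tabs _ X]q2 stab_tabs.
split; first by have := tab_index_lt (s m); rewrite s1 s2 im.
apply: (lim_map_germ sw_vec_serpentine); first exact: (pure_compatible hphi) od.
exists m => n le; have [q1 q2 q3] := sE n le.
rewrite /sw_lin /= /sw_vec phi_invK //.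
rewrite (@sum_pure _ _ _ _ u t (s n) (fun t j => vecS t j) _ q3); last exact: rows_mk_stab.
by apply: eq_bigr => j _; rewrite /vecS q1 q2 iE.
Qed.

Lemma serp_map_pure k d (u : irrep C k.*2) (t : filling) :
  tail_class k t -> stable_rgrade t d ->
  exists2 i, (i < mult k d)%N &
    serp_map (pure_germ u t) = \sum_(j < k.*2.+1) u j *: vec k d i j.
Proof.
move=> tk [n1 h1]; have [n0 [st sp od]] := tail_class_odd tk.
pose m := maxn n0 n1; exists (index (mkseq t m.*2) (tabs k d m)); last first.
  apply: (proj2 (serp_map_odd _ _ _ _ _)) => //; rewrite ?sp ?h1 ?leq_maxl ?leq_maxr //.
  by move=> i mi; apply: od; move: mi; rewrite /m; lia.
apply: (proj1 (serp_map_odd u _ _ _ _)) => //; rewrite ?sp ?h1 ?leq_maxl ?leq_maxr //.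
by move=> i mi; apply: od; move: mi; rewrite /m; lia.
Qed.

(** Every position is reached: the lists of tableaux have full length far
    enough in the chain. *)
Lemma vec_pure k d i : (i < mult k d)%N ->
  exists t : filling, [/\ tail_class k t, stable_rgrade t d &
    forall u : irrep C k.*2,
      serp_map (pure_germ u t) = \sum_(j < k.*2.+1) u j *: vec k d i j].
Proof.
move=> hi; pose n := (k + `|d|).+1.
have szn : size (tabs k d n) = mult k d by apply: size_tabs_stable.
pose w := nth [::] (tabs k d n) i.
have wn : w \in tabs k d n by rewrite mem_nth ?szn.
have := wn; rewrite mem_tabs mem_ballots => /andP[/andP[/eqP sw st] /andP[/eqP sp /eqP rg]].
pose t := ext_word w.
have te l : (l < n.*2)%N -> t l = nth false w l by rewrite /t /ext_word sw => ->.
have od l : (n.*2 <= l)%N -> t l = odd l.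
  by rewrite /t /ext_word sw ltnNge => ->.
have tk : tail_class k t.
  apply: (odd_tail_class (n0 := n)) => //; first by rewrite (eq_standard te).
  by rewrite (eq_spin2 te).
exists t; split=> // [|u].
  by exists n => n' le; rewrite (rgrade_odd le od) (eq_rgrade te).
have [] := @serp_map_odd k d u t n _ _ _ od; last first.
- have -> : mkseq t n.*2 = w.
    apply: (@eq_from_nth _ false); rewrite size_mkseq ?sw // => l ln.
    by rewrite nth_mkseq // te.
  by rewrite index_uniq ?szn ?uniq_tabs.
- by rewrite (eq_rgrade te).
- by rewrite (eq_spin2 te).
- by move=> n'; case: tk => + _; apply.
Qed.

Definition unit_irrep d j : irrep C d := [ffun l : 'I_d.+1 => (l == j :> nat)%:R].

Lemma sum_unit_irrep d j (F : nat -> L) : (j <= d)%N ->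
  \sum_(l < d.+1) unit_irrep d j l *: F l = F j.
Proof.
move=> jd; rewrite (bigD1 (Ordinal (jd : (j < d.+1)%N))) //= ffunE eqxx scale1r.
by rewrite big1 ?addr0 // => l lj; rewrite ffunE (negbTE (lj : (l != j :> nat))) scale0r.
Qed.

Lemma vec_span_homog d w : lspan (vec_gen A hw d) w ->
  exists2 q, serp_map q = w & serp_homog d q.
Proof.
elim=> [|c _ y [k [i [j [hi hj ->]]]] _ [q <- hq]].
  exists 0; last exact: lspan0.
  exact: serp_map0.
have [t [tk rt E]] := vec_pure hi.
exists (c *: pure_germ (unit_irrep k.*2 j) t + q).
  by rewrite serp_map_linear E (sum_unit_irrep (fun l => vec k d i l)).
apply: lspanD hq.
by exists k, (unit_irrep k.*2 j), t.
Qed.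

(** The string vectors span the module, and all of them are reached. *)
Lemma serp_map_surj w : exists p, serp_map p = w.
Proof.
elim: (vec_span hL hform hwP w) => [|c x y [d gd] _ [q <-]].
  by exists 0; apply: serp_map0.
have [p <- _] := vec_span_homog (lspan_mem gd).
by exists (c *: p + q); rewrite serp_map_linear.
Qed.

Lemma serp_homogE d p : serp_homog d p <-> lspan (vec_gen A hw d) (serp_map p).
Proof.
split; last by move=> /vec_span_homog[q /serp_map_inj ->].
pose S : {linear indlim (serpentine phi) -> L} :=
  HB.pack serp_map (GRing.isLinear.Build C _ _ _ serp_map serp_map_linear).
apply: (lspan_map (g := S)) => _ [k [u [t [tk rt ->]]]].
have [i hi] := serp_map_pure u tk rt; rewrite /S /= /pure_germ => ->.
apply: lspan_sum => j _; apply/lspan_scale/lspan_mem.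
by exists k, i, j; split=> //; rewrite -ltnS.
Qed.

Lemma serp_map_sl2 x p : \tr x = 0 ->
  serp_map (lim_sl2 x p) = loop A x 0 (serp_map p).
Proof.
move=> tx; have [n1 h1] := serp_mapP p; have [n2 h2] := seq_ofP p.
apply: (lim_map_germ sw_vec_serpentine).
  exists n2 => n le; rewrite h2 //; apply: sw_vec_inj.
  by rewrite sw_vec_serpentine !sw_vec_sl2 // sw_vec_serpentine.
by exists n1 => n le; rewrite [LHS]sw_vec_sl2 // h1.
Qed.

Lemma serp_iso : exists F : {linear L -> indlim (serpentine phi)},
  graded_unitary_iso form (fun x => loop A x 0) (affine_homog A vac)
    (@lim_dot _ (serpentine phi)) (@lim_sl2 _ (serpentine phi))
    (@serp_homog _ phi) F.
Proof.
pose F0 w := projT1 (cid (serp_map_surj w)).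
have F0K : cancel F0 serp_map by move=> w; rewrite /F0; case: cid.
have serpK : cancel serp_map F0 by move=> p; apply: serp_map_inj; rewrite F0K.
have lF : linear F0.
  by move=> c u v; apply: serp_map_inj; rewrite serp_map_linear !F0K.
pose F : {linear L -> indlim (serpentine phi)} :=
  HB.pack F0 (GRing.isLinear.Build C _ _ _ F0 lF).
exists F; split=> /=.
- by exists serp_map.
- by move=> u v; rewrite serp_map_isometry !F0K.
- by move=> x u tx; apply: serp_map_inj; rewrite serp_map_sl2 // !F0K.
- by move=> d u; rewrite serp_homogE F0K; apply: (affine_homogE hL hform hwP).
Qed.

End Isomorphism.

(** * Young's orthogonal form and the Jucys-Murphy elements *)

Section AdjTransp.
Variable i : nat.

Lemma adj_transp_l : adj_transp i i = i.+1.
Proof. by rewrite /adj_transp /= eqxx. Qed.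

Lemma adj_transp_r : adj_transp i i.+1 = i.
Proof. by rewrite /adj_transp /= eqxx ifF //; apply/eqP; lia. Qed.

Lemma adj_transp_id j : j != i -> j != i.+1 -> adj_transp i j = j.
Proof. by rewrite /adj_transp /= => /negbTE-> /negbTE->. Qed.

Lemma adj_transpK : involutive (adj_transp i).
Proof.
move=> j; have [->|ji] := eqVneq j i; first by rewrite adj_transp_l adj_transp_r.
have [->|ji'] := eqVneq j i.+1; first by rewrite adj_transp_r adj_transp_l.
by rewrite !adj_transp_id.
Qed.

Lemma adj_transp_lt N j : (i.+1 < N)%N -> (j < N)%N -> (adj_transp i j < N)%N.
Proof.
move=> iN jN; have [->|ji] := eqVneq j i; first by rewrite adj_transp_l.
have [->|ji'] := eqVneq j i.+1; first by rewrite adj_transp_r; lia.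
by rewrite adj_transp_id.
Qed.

Variable t : filling.
Let t' := t \o adj_transp i.

Lemma nrow_adj_le b l : (l <= i)%N -> nrow t' b l = nrow t b l.
Proof.
by move=> li; apply: eq_nrow => j jl; rewrite /t' /= adj_transp_id //; apply/eqP; lia.
Qed.

Lemma nrow_adj_mid b : nrow t' b i.+1 = (nrow t b i + (t i.+1 == b))%N.
Proof. by rewrite nrowS nrow_adj_le // /t' /comp adj_transp_l. Qed.

Lemma nrow_adj_ge b l : (i.+1 < l)%N -> nrow t' b l = nrow t b l.
Proof.
elim: l => [//|l IH]; rewrite ltnS leq_eqVlt => /predU1P[<-|il].
  rewrite nrowS nrow_adj_mid 2!nrowS /t' /comp adj_transp_r.
  exact: addnAC.
by rewrite !nrowS IH // /t' /= adj_transp_id //; apply/eqP; lia.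
Qed.

Lemma contentE j : content t j = (nrow t (t j) j)%:Z - (t j)%:Z.
Proof. by []. Qed.

Lemma content_adj_l : t i != t i.+1 -> content t' i = content t i.+1.
Proof.
move=> tt; rewrite /content /cell /t' /= adj_transp_l nrow_adj_le //.
by rewrite nrowS (negbTE tt) addn0.
Qed.

Lemma content_adj_r : t i != t i.+1 -> content t' i.+1 = content t i.
Proof.
move=> tt; rewrite /content /cell /t' /= adj_transp_r nrow_adj_mid.
by rewrite eq_sym (negbTE tt) addn0.
Qed.

Lemma spin2_adj N : (i.+1 < N)%N -> spin2 N t' = spin2 N t.
Proof. by move=> iN; rewrite /spin2 !nrow_adj_ge. Qed.

End AdjTransp.

Section YoungForm.
Variables (C : numClosedFieldType) (N : nat).
Implicit Types (s t : stab N) (p q : sw_index N) (v : sw_sum C N).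

(** Exchanging the entries in positions i and i.+1 gives another standard
    tableau. *)
Definition swappable i t : bool :=
  (rows t i != rows t i.+1) && standard N (rows t \o adj_transp i).

Definition axial i t : int := content (rows t) i.+1 - content (rows t) i.

Lemma stab_le t l : (l <= N)%N -> (nrow (rows t) true l <= nrow (rows t) false l)%N.
Proof. exact: (standardP _ _ (stab_standard t)). Qed.

Lemma swappable_standard i t : (i.+1 < N)%N ->
  standard N (rows t \o adj_transp i) =
  (nrow (rows t) true i + rows t i.+1 <= nrow (rows t) false i + ~~ rows t i.+1)%N.
Proof.
move=> iN; apply/standardP/idP => [/(_ i.+1)|h l lN].
  by rewrite !nrow_adj_mid eqb_id eqbF_neg; apply; lia.
have [li|] := leqP l i; first by rewrite !nrow_adj_le // stab_le.
rewrite leq_eqVlt => /predU1P[<-|il]; first by rewrite !nrow_adj_mid eqb_id eqbF_neg.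
by rewrite !nrow_adj_ge // stab_le.
Qed.

Lemma axial_swappable i t : (i.+1 < N)%N -> swappable i t ->
  (2 <= `|axial i t|)%N.
Proof.
move=> iN /andP[tt]; rewrite swappable_standard // /axial /content /cell /=.
have := @stab_le t i.+1 (ltnW iN); move: tt; rewrite !nrowS.
by case: (rows t i); case: (rows t i.+1) => //= _; lia.
Qed.

Lemma axial_not_swappable i t : (i.+1 < N)%N -> ~~ swappable i t ->
  `|axial i t|%N = 1%N.
Proof.
move=> iN; rewrite negb_and negbK swappable_standard // /axial /content /cell /=.
have := @stab_le t i (ltnW (ltnW iN)); rewrite !nrowS.
by case: (rows t i); case: (rows t i.+1) => //=; lia.
Qed.

Definition swap i t : stab N :=
  insubd t [tuple of mkseq (rows t \o adj_transp i) N].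

Lemma rows_swap i t j : swappable i t -> (j < N)%N ->
  rows (swap i t) j = rows t (adj_transp i j).
Proof.
case/andP=> _ st jN; rewrite /swap /rows val_insubd ifT; first by rewrite nth_mkseq.
exact: mkseq_standard.
Qed.

Lemma spin2_swap i t : (i.+1 < N)%N -> swappable i t ->
  spin2 N (rows (swap i t)) = spin2 N (rows t).
Proof.
move=> iN st; rewrite (@eq_spin2 _ (rows t \o adj_transp i)) ?spin2_adj // => j jN.
exact: rows_swap.
Qed.

Lemma eq_content (s t : filling) j : (forall l, (l <= j)%N -> s l = t l) ->
  content s j = content t j.
Proof.
move=> st; rewrite /content /cell /= st // (@eq_nrow s t) // => l lj.
by rewrite st // ltnW.
Qed.

Lemma content_swap i t j : swappable i t -> (j < N)%N ->
  content (rows (swap i t)) j = content (rows t \o adj_transp i) j.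
Proof. by move=> st jN; apply: eq_content => l lj; rewrite rows_swap //; lia. Qed.

Lemma swap_axial i t : (i.+1 < N)%N -> swappable i t ->
  axial i (swap i t) = - axial i t.
Proof.
move=> iN st; rewrite /axial !content_swap ?(ltnW iN) //.
have tt := proj1 (andP st).
by rewrite content_adj_l // content_adj_r //; lia.
Qed.

Lemma swappable_swap i t : (i.+1 < N)%N -> swappable i t -> swappable i (swap i t).
Proof.
move=> iN st; rewrite /swappable !rows_swap ?(ltnW iN) // adj_transp_l adj_transp_r.
rewrite eq_sym (proj1 (andP st)) /= (@eq_standard _ (rows t)) ?stab_standard // => j jN.
by rewrite /= rows_swap ?adj_transp_lt // adj_transpK.
Qed.

Lemma swapK i t : (i.+1 < N)%N -> swappable i t -> swap i (swap i t) = t.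
Proof.
move=> iN st; apply: stab_inj => j jN.
by rewrite !rows_swap ?adj_transp_lt ?swappable_swap // adj_transpK.
Qed.

Lemma swap_neq i t : (i.+1 < N)%N -> swappable i t -> swap i t != t.
Proof.
move=> iN st; apply/eqP => /(congr1 (fun s => rows s i)).
rewrite rows_swap ?(ltnW iN) // adj_transp_l => tt.
by have := proj1 (andP st); rewrite tt eqxx.
Qed.

(** Only the tableau itself and its swap contribute to the sum. *)
Lemma transp_swE i v p (t := tab p) (r : C := (axial i t)%:~R) : (i.+1 < N)%N ->
  transp_sw i v p = r^-1 * v p +
    (if swappable i t then sqrtC (1 - r ^- 2) * v (swi (swap i t) (wt p)) else 0).
Proof.
move=> iN; rewrite ffunE (bigD1 p) //= /young_coef eqxx; congr (_ + _).
have sameE q : same_upto N (rows t) (rows (tab q) \o adj_transp i) ->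
    forall j, (j < N)%N -> rows (tab q) j = rows t (adj_transp i j).
  by move=> /same_uptoP h j jN; rewrite h ?adj_transp_lt //= adj_transpK.
case: ifP => st; last first.
  rewrite big1 // => q /andP[/eqP wq qp]; rewrite ifF; last first.
    by apply: contraNF qp => /eqP tq; rewrite sw_index_eqP -tq wq !eqxx.
  case: ifP => [h|_]; last by rewrite mul0r.
  have e := sameE q h; move: st; rewrite /swappable.
  rewrite -(@eq_standard (rows (tab q))) ?stab_standard ?andbT; last by move=> j jN; rewrite e.
  move/negbT; rewrite negbK => /eqP tt; case/eqP: qp; apply/eqP.
  rewrite sw_index_eqP wq eqxx andbT; apply/eqP/stab_inj => j jN; rewrite e //.
  have [->|ji] := eqVneq j i; first by rewrite adj_transp_l.
  have [->|ji'] := eqVneq j i.+1; first by rewrite adj_transp_r.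
  by rewrite adj_transp_id.
have wp : (wt p <= spin2 N (rows (swap i t)))%N by rewrite spin2_swap // wt_le.
rewrite (bigD1 (swi (swap i t) (wt p))) /=; last first.
  rewrite wt_swi // eqxx /=; apply: contra (swap_neq iN st) => /eqP/(congr1 (@tab N)).
  by rewrite tab_swi => ->.
rewrite eq_sym (negbTE (swap_neq iN st)) ifT; last first.
  by apply/same_uptoP => j jN; rewrite /= rows_swap ?adj_transp_lt // adj_transpK.
rewrite -/(axial i (swap i t)) swap_axial // rmorphN /= sqrrN.
rewrite big1 ?addr0 // => q /andP[/andP[/eqP wq qp] qs]; rewrite ifF; last first.
  by apply: contraNF qp => /eqP tq; rewrite sw_index_eqP -tq wq !eqxx.
case: ifP => [h|_]; last by rewrite mul0r.
have e := sameE q h; case/eqP: qs; rewrite -[LHS]swiK wq; congr swi.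
by apply: stab_inj => j jN; rewrite e // rows_swap.
Qed.

(** The Jucys-Murphy elements, which are sums of the transpositions (j i) with
    j < i; the recursion uses adjacent transpositions only, as Young's form
    does. *)
Fixpoint jm (i : nat) (v : sw_sum C N) : sw_sum C N :=
  if i is i'.+1 then transp_sw i' (jm i' (transp_sw i' v)) + transp_sw i' v
  else 0.

(** On the plane of t and its swap, with r the axial distance, the claim is
    r^-2 c_i + (1 - r^-2) c_(i+1) + r^-1 = c_(i+1), and the off-diagonal terms
    cancel. Without a swap, r is 1 or -1. *)
Lemma jmE i v p : (i < N)%N -> jm i v p = (content (rows (tab p)) i)%:~R * v p.
Proof.
elim: i v p => [|i IH] v p iN.
  rewrite /= ffunE contentE nrow0; have := @stab_le (tab p) 1 iN.
  by rewrite !nrowS !nrow0; case: (rows _ 0%N) => //; rewrite subr0 mul0r.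
have iN' := ltnW iN; rewrite /= ffunE !transp_swE // !IH //.
set t := tab p; set r : C := (axial i t)%:~R.
have cE : (content (rows t) i.+1)%:~R = (content (rows t) i)%:~R + r.
  by rewrite /r /axial intrB addrC subrK.
case: ifP => st.
  have wp : (wt p <= spin2 N (rows (swap i t)))%N by rewrite spin2_swap // wt_le.
  rewrite !transp_swE // !tab_swi wt_swi // (swappable_swap iN st) st swapK // swiK.
  rewrite swap_axial // content_swap // content_adj_l ?(proj1 (andP st)) // cE.
  rewrite rmorphN /= -/r sqrrN; set c := (content _ _)%:~R; set x := v _; set y := v _.
  have r0 : r != 0.
    by rewrite /r intr_eq0 -absz_eq0; have := axial_swappable iN st; lia.
  have := sqrtCK (1 - r ^- 2); set s := sqrtC _ => sE.
  transitivity ((r ^- 2 * c + s ^+ 2 * (c + r) + r^-1) * x).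
    by rewrite invrN; field.
  by rewrite sE; congr (_ * _); field.
rewrite transp_swE // -/t st !addr0 cE; set c := (content _ _)%:~R.
rewrite -/r; have r2 : r * r = 1.
  have := axial_not_swappable iN (negbT st); rewrite /r -intrM.
  by case: (axial i t) => [[|[|n]]|[|n]].
have r0 : r != 0 by apply: contra_eq_neq r2 => ->; rewrite mul0r eq_sym oner_eq0.
have -> : r^-1 = r by apply: (mulfI r0); rewrite mulfV.
transitivity ((r * r) * c * v p + r * v p); first by ring.
by rewrite r2; ring.
Qed.

(** The next cell has content at least 0 in the first row, whose length is at
    least that of the second, and a smaller one in the second row. *)
Lemma content_inj (s t : filling) n : standard n s -> standard n t ->
  (forall i, (i < n)%N -> content s i = content t i) ->
  forall i, (i < n)%N -> s i = t i.
Proof.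
move=> /standardP ss /standardP st h; elim/ltn_ind => i IH iN.
have e b : nrow s b i = nrow t b i by apply: eq_nrow => j ji; apply: IH; lia.
have := h i iN; rewrite /content /cell /= !e; have := st i (ltnW iN).
by case: (s i); case: (t i) => //=; lia.
Qed.

End YoungForm.

(** * Homogeneous Schur-Weyl embeddings *)

Section Torus.
Variables (C : numClosedFieldType).

Definition torus2 : 'M[C]_2 := diag_mx (\row_j if j == 0 then 2 else 2^-1).

Lemma det_torus2 : \det torus2 = 1.
Proof.
by rewrite det_diag !big_ord_recl big_ord0 !mxE /= mulr1 mulfV // pnatr_eq0.
Qed.

Definition nones N (w : N.-tuple 'I_2) : nat := (\sum_(i < N) (tnth w i == 1%R))%N.

Lemma torus_tensor N (v : tensor C N) w :
  SL2_tensor torus2 v w = 2 ^+ N * 4^-1 ^+ nones w * v w.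
Proof.
rewrite ffunE (bigD1 w) //= [X in _ + X]big1 ?addr0 => [|w' ww']; last first.
  have [i wi] : exists i, tnth w i != tnth w' i.
    apply/existsP; apply: contraNT ww'; rewrite negb_exists => /forallP h.
    by apply/eqP/eq_from_tnth => i; have := h i; rewrite negbK => /eqP.
  by rewrite (bigD1 i) //= mxE (negbTE wi) mulr0n !mul0r.
congr (_ * _); rewrite /nones -prodrXr -[X in 2 ^+ X](card_ord N) -prodr_const -big_split /=.
apply: eq_bigr => i _; rewrite !mxE eqxx mulr1n.
have [->|] : tnth w i = 0 \/ tnth w i = 1.
- by case: (tnth w i) => [[|[|//]] hi]; [left|right]; apply: val_inj.
- by rewrite mulr1.
- by move=> ->; rewrite /= expr1; field.
Qed.

Lemma cartan_tensor N (v : tensor C N) w :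
  sl2_tensor (mxH2 C) v w = (N%:R - 2 * (nones w)%:R) * v w.
Proof.
rewrite ffunE; transitivity (\sum_(i < N) (1 - 2 * (tnth w i == 1)%:R) * v w).
  apply: eq_bigr => i _; rewrite (bigD1 (tnth w i)) //= big1 ?addr0 => [|b bi].
    have -> : [tuple if j == i then tnth w i else tnth w j | j < N] = w.
      by apply: eq_from_tnth => j; rewrite tnth_mktuple; case: eqP => [->|].
    congr (_ * _); rewrite !mxE.
    have [->|->] : tnth w i = 0 \/ tnth w i = 1.
      by case: (tnth w i) => [[|[|//]] hi]; [left|right]; apply: val_inj.
    - by rewrite /=; ring.
    - by rewrite /=; ring.
  rewrite !mxE; move: bi.
  by case: (tnth w i) => [[|[|//]] hi]; case: b => [[|[|//]] hb] //= _;
     rewrite ?subrr ?mul0r.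
rewrite -mulr_suml; congr (_ * _).
rewrite big_split /= sumr_const card_ord; congr (_ + _).
by rewrite sumrN -mulr_sumr -natr_sum.
Qed.

End Torus.

Section Delta.
Variables (C : numClosedFieldType) (I : finType).

Definition delta (i : I) : {ffun I -> C^o} := [ffun j => (j == i)%:R].

Lemma deltaE (v : {ffun I -> C^o}) : v = \sum_i v i *: delta i.
Proof.
apply/ffunP => j; rewrite sum_ffunE (bigD1 j) //= !ffunE eqxx.
rewrite big1 ?addr0 => [|i ij]; first by rewrite -[_ *: _]/(_ * _) mulr1.
by rewrite !ffunE eq_sym (negbTE ij) scaler0.
Qed.

Lemma hdot_delta i : hdot (delta i) (delta i) = 1.
Proof.
rewrite /hdot (bigD1 i) //= !ffunE eqxx mul1r conjC1 big1 ?addr0 // => j ji.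
by rewrite !ffunE (negbTE ji) mul0r.
Qed.

End Delta.

Lemma lfun_delta (C : numClosedFieldType) (I J : finType)
    (a : 'Hom({ffun I -> C^o} : vectType C, {ffun J -> C^o} : vectType C)) v j :
  a v j = \sum_i v i * a (delta C i) j.
Proof.
rewrite {1}(deltaE v) linear_sum sum_ffunE; apply: eq_bigr => i _.
by rewrite linearZ ffunE.
Qed.

Section TorusEquivariance.
Variables (C : numClosedFieldType) (N : nat) (a : 'Hom(tensor C N, tensor C N.+2)).
Hypothesis ha : forall v, a (SL2_tensor (torus2 C) v) = SL2_tensor (torus2 C) (a v).

(** The weight spaces are the eigenspaces of the single element
    diag(2, 1/2) of the torus, which has distinct eigenvalues on them. *)
Lemma cartan_equivariant v : a (sl2_tensor (mxH2 C) v) = sl2_tensor (mxH2 C) (a v).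
Proof.
have supp x w : a (delta C x) w != 0 -> nones w = (nones x).+1.
  have e : SL2_tensor (torus2 C) (delta C x) =
      (2 ^+ N * 4^-1 ^+ nones x : C) *: (delta C x : tensor C N).
    apply/ffunP => y; rewrite torus_tensor !ffunE.
    by rewrite -[RHS]/(_ * _); have [->|] := eqVneq y x; rewrite ?mulr0 ?mulr1.
  have := congr1 (fun u : tensor C N.+2 => u w) (ha (delta C x)).
  rewrite e linearZ /= torus_tensor ffunE -[_ *: _]/(_ * _) => /eqP.
  move=> h aw; move: h; rewrite (inj_eq (mulIf aw)) !exprSr -!mulrA.
  have p2 : (2 : C) ^+ N != 0 by rewrite expf_neq0 // pnatr_eq0.
  rewrite (inj_eq (mulfI p2)) => /eqP h.
  have {}h : (4^-1 : C) ^+ (nones x).+1 = 4^-1 ^+ nones w.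
    by rewrite exprS h; move: (_ ^+ nones w) => z; field.
  have q1 : (4^-1 : C) < 1 by rewrite invf_lt1 ?ltr0n // ltr1n.
  have q0 : 0 < (4^-1 : C) by rewrite invr_gt0 ltr0n.
  by have := ieexprIn q0 (negbT (lt_eqF q1)) h.
apply/ffunP => w; rewrite cartan_tensor [LHS]lfun_delta (lfun_delta a v) mulr_sumr.
apply: eq_bigr => x _; rewrite cartan_tensor.
have [->|/supp ->] := eqVneq (a (delta C x) w) 0; first by rewrite !mulr0.
by rewrite -[N.+2%:R]natr1 -[N.+1%:R]natr1 -[(nones x).+1%:R]natr1; ring.
Qed.

End TorusEquivariance.

Definition adj_finperm (i : nat) : finperm :=
  FinPerm (inv_bij (adj_transpK i))
    (ex_intro _ i.+2 (fun j (hj : (i.+2 <= j)%N) =>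
       @adj_transp_id i j (negbT (gtn_eqF (ltnW hj))) (negbT (gtn_eqF hj)))).

Lemma adj_in_sym N i : (i.+1 < N)%N -> in_sym N (adj_finperm i).
Proof. by move=> iN j Nj; apply: adj_transp_id; apply/eqP; lia. Qed.

(** The only ways of adding two cells are 11, 12, 21 and 22, in the rows of the
    new entries; the descents tell 12 from the others. *)
Lemma maj_add_two_inv N (t : filling) : maj N.+2 t = (maj N t + N.+1)%N ->
  t N = false /\ t N.+1 = true.
Proof.
rewrite majS //; case: N => [|N].
  by rewrite /maj !big_geq //; case: (t 0%N); case: (t 1%N) => //=; lia.
by rewrite majS //=; case: (t N.+1); case: (t N.+2); case: (t N) => //=; lia.
Qed.

Section Embedding.
Variables (C : numClosedFieldType) (phi : schur_weyl_family C).
Hypothesis hphi : forall n, schur_weyl_iso (phi n).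
Variables (n : nat) (a : 'Hom(tensor C n.*2, tensor C n.+1.*2)).
Hypothesis ha : schur_weyl_embedding (N := n.*2) a.
Hypothesis hom : forall d v, tensor_homog phi d v -> tensor_homog phi d (a v).

(** The embedding, read in the coordinates u_j (x) t. *)
Definition beta : 'Hom(sw_sum C n.*2, sw_sum C n.+1.*2) :=
  (phi n.+1 \o a \o (phi n)^-1)%VF.

Lemma beta_phi u : beta (phi n u) = phi n.+1 (a u).
Proof. by rewrite /beta !comp_lfunE lker0_lfunK // phi_ker. Qed.

Lemma beta_ind (P : sw_sum C n.*2 -> Prop) :
  (forall u, P (phi n u)) -> forall v, P v.
Proof. by move=> h v; rewrite -(phi_invK hphi v). Qed.

Lemma beta_isometry u v : hdot (beta u) (beta v) = hdot u v.
Proof.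
elim/beta_ind: u => u; elim/beta_ind: v => v.
by rewrite !beta_phi !(swi_isometry (hphi _)) (swe_isometry ha).
Qed.

Lemma beta_transp i v : (i.+1 < n.*2)%N ->
  beta (transp_sw i v) = transp_sw i (beta v).
Proof.
move=> iN; elim/beta_ind: v => v.
rewrite -(swi_sym (hphi n)) // !beta_phi -(swi_sym (hphi n.+1)); last first.
  by rewrite doubleS; lia.
by congr (phi n.+1 _); have := swe_sym ha v (adj_in_sym iN).
Qed.

Lemma beta_jm i v : (i < n.*2)%N -> beta (jm i v) = jm i (beta v).
Proof.
elim: i v => [|i IH] v iN /=; first by rewrite linear0.
by rewrite linearD /= !beta_transp // IH ?beta_transp //; apply: ltnW.
Qed.

(** The embedding commutes with the Jucys-Murphy elements, whose eigenvalues on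
    a basis vector determine the tableau. *)
Lemma beta_tab p q : beta (delta C p) q != 0 ->
  forall i, (i < n.*2)%N -> rows (tab q) i = rows (tab p) i.
Proof.
move=> bq; have stq : standard n.*2 (rows (tab q)).
  apply/standardP => l ln; have /standardP h := stab_standard (tab q).
  by apply: h; rewrite doubleS; lia.
apply: (content_inj stq (stab_standard _)) => i iN.
have jmd : jm i (delta C p) = (content (rows (tab p)) i)%:~R *: (delta C p : sw_sum C n.*2).
  apply/ffunP => p'; rewrite jmE // !ffunE -[RHS]/(_ * _).
  by have [->|] := eqVneq p' p; rewrite ?mulr0.
have := congr1 (fun v : sw_sum C n.+1.*2 => v q) (beta_jm (delta C p) iN).
rewrite jmd linearZ ffunE jmE; last by rewrite doubleS; lia.
by rewrite -[_ *: _]/(_ * _) => /(mulIf bq)/intr_inj.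
Qed.

Lemma delta_pure p : delta C p =
  pure_sw n.*2 (unit_irrep C (tab_spin (tab p)).*2 (wt p)) (rows (tab p)).
Proof.
apply/ffunP => q; rewrite !ffunE sw_index_eqP same_upto_stab.
have wp := wt_le_spin p.
have [tq|] := eqVneq (tab q) (tab p); last by rewrite big_pred0.
have wq : (wt q < (tab_spin (tab p)).*2.+1)%N by rewrite -tq ltnS wt_le_spin.
by rewrite (big_pred1 (Ordinal wq)) => [|j] //; rewrite ffunE.
Qed.

Lemma homog_support m d (v : sw_sum C m.*2) q : sw_homog d v -> v q != 0 ->
  rgrade m (rows (tab q)) = d.
Proof.
elim=> [|c w v' [k [u [t [_ <- ->]]]] _ IH]; first by rewrite ffunE eqxx.
rewrite !ffunE; have [->//|nt] := eqVneq (tab q) t.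
rewrite big_pred0 ?scaler0 ?add0r // => j.
by rewrite same_upto_stab (negbTE nt).
Qed.

(** By beta_tab the tableau of p is extended by two cells, and the degree of the
    result leaves only one possibility. *)
Lemma beta_support p q : beta (delta C p) q != 0 -> tab q = stab_ext (tab p).
Proof.
move=> bq; have rt := beta_tab bq.
have : rgrade n.+1 (rows (tab q)) = rgrade n (rows (tab p)).
  apply: homog_support bq; elim/beta_ind: (delta C p) (delta_pure p) => v vE.
  rewrite beta_phi; apply: hom; rewrite /tensor_homog vE; apply: lspan_mem.
  exists (tab_spin (tab p)), (unit_irrep C (tab_spin (tab p)).*2 (wt p)), (tab p).
  by split=> //; rewrite spin2_half.
rewrite /rgrade -(eq_maj rt) => mE; set t := rows (tab q) in rt mE *.
have sqS : (n.+1 ^ 2 = n ^ 2 + n.*2.+1)%N by rewrite -mul2n !expnS; lia.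
have [t0 t1] : t n.*2 = false /\ t n.*2.+1 = true.
  by apply: maj_add_two_inv; move: mE; rewrite sqS doubleS; lia.
apply: (@stab_inj n.+1.*2) => i iN; rewrite (@rows_stab_ext n.*2) //.
have iN2 : (i < n.*2.+2)%N by exact: iN.
rewrite /add_two; case: ltnP => il; first exact: rt.
have [->|->] : i = n.*2 \/ i = n.*2.+1 by lia.
  by rewrite -/t t0; apply/esym/eqP; lia.
by rewrite -/t t1 eqxx.
Qed.

Lemma cartan_sw m (v : sw_sum C m) p :
  sl2_sw (mxH2 C) v p = ((spin2 m (rows (tab p)))%:R - ((wt p).*2)%:R) * v p.
Proof.
rewrite ffunE (bigD1 p) //= big1 ?addr0 => [|q /andP[tq qp]].
  by rewrite /irrep_coef eqxx !mxE /= subr0 mul1r.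
have wq : wt p != wt q.
  by apply: contra qp => /eqP wE; rewrite sw_index_eqP tq wE eqxx.
by rewrite /irrep_coef (negbTE wq) !mxE /= !subrr !mul0r !if_same mul0r.
Qed.

(** The embedding also commutes with the Cartan element. *)
Lemma beta_wt p q : beta (delta C p) q != 0 -> wt q = wt p.
Proof.
move=> bq; have tq := beta_support bq.
have tr0 : \tr (mxH2 C) = 0 by have [] := mxtrace_sl2 C.
have H v : beta (sl2_sw (mxH2 C) v) = sl2_sw (mxH2 C) (beta v).
  elim/beta_ind: v => v; rewrite -(swi_sl2 (hphi n)) // !beta_phi.
  rewrite -(swi_sl2 (hphi n.+1)) //; congr (phi n.+1 _).
  apply: (@cartan_equivariant C n.*2 a) => u.
  exact: (swe_SL2 ha _ (det_torus2 C)).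
have e : sl2_sw (mxH2 C) (delta C p) =
    ((spin2 n.*2 (rows (tab p)))%:R - ((wt p).*2)%:R : C) *: (delta C p : sw_sum C n.*2).
  apply/ffunP => p'; rewrite cartan_sw !ffunE -[RHS]/(_ * _).
  by have [->|] := eqVneq p' p; rewrite ?mulr0.
have := congr1 (fun v : sw_sum C n.+1.*2 => v q) (H (delta C p)).
rewrite e linearZ ffunE cartan_sw -[_ *: _]/(_ * _) => /(mulIf bq).
rewrite tq (spin2_stab_ext (tab p)) => /addrI/oppr_inj/eqP.
by rewrite eqr_nat; lia.
Qed.

(** The factor by which the embedding differs from the serpentine one on a basis
    vector; it has modulus 1 by phase_norm. *)
Definition phase (p : sw_index n.*2) : C :=
  beta (delta C p) (swi (stab_ext (tab p) : stab n.+1.*2) (wt p)).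

Lemma betaE v : beta v = serp_fun ([ffun p => phase p * v p] : sw_sum C n.*2).
Proof.
apply/ffunP => q; rewrite [LHS]lfun_delta.
have [[t tq]|nt] := pselect (exists t, tab q = stab_ext t); last first.
  rewrite serp_fun_notin => [|t]; last by apply/eqP => tq; apply: nt; exists t.
  rewrite big1 // => p _; have [->|/beta_support tq] := eqVneq (beta (delta C p) q) 0.
    by rewrite mulr0.
  by case: nt; exists (tab p).
have wq : (wt q <= spin2 n.*2 (rows t))%N by rewrite -spin2_stab_ext -tq wt_le.
have qE : q = swi (stab_ext t : stab n.+1.*2) (wt q) by rewrite -tq swiK.
rewrite (bigD1 (swi t (wt q))) //= big1 ?addr0 => [|p pq].
  rewrite {4}qE serp_fun_swi // ffunE /phase tab_swi wt_swi // -qE.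
  by rewrite mulrC.
have [->|bq] := eqVneq (beta (delta C p) q) 0; first by rewrite mulr0.
case/eqP: pq; rewrite -(swiK p) (beta_wt bq); congr swi.
by apply: (@stab_ext_inj n.*2); rewrite -tq (beta_support bq).
Qed.

End Embedding.

(** * The intertwiner *)

Section Connectivity.
Variable N : nat.
Implicit Types s t : stab N.

Definition row_sorted t : Prop :=
  forall i, (i.+1 < N)%N -> rows t i -> rows t i.+1.

Lemma row_sortedE t i : row_sorted t -> (i < N)%N ->
  rows t i = (nrow (rows t) false N <= i)%N.
Proof.
move=> ht; have mono j d : (j + d < N)%N -> rows t j -> rows t (j + d)%N.
  elim: d => [|d IH] h; first by rewrite addn0.
  by move=> /IH r; rewrite addnS; apply: ht; [|apply: r]; lia.
have stepF d : (i + d <= N)%N -> rows t i -> nrow (rows t) false (i + d) = nrow (rows t) false i.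
  elim: d => [|d IH] h ri; first by rewrite addn0.
  by rewrite addnS nrowS IH ?(mono i d) ?addn0 //; lia.
move=> iN; case ri: (rows t i).
  have := stepF (N - i)%N; rewrite subnKC; last exact: ltnW.
  move=> -> //; apply/esym; have := nrow_total (rows t) i; lia.
have le_F j : (j <= i)%N -> rows t j = false.
  move=> ji; apply/negbTE/negP => /(mono j (i - j)%N); rewrite subnKC // ri.
  by move=> /(_ iN).
have -> : nrow (rows t) false N = (i.+1 + (nrow (rows t) false N - i.+1))%N.
  rewrite subnKC //; have -> : i.+1 = nrow (rows t) false i.+1.
    rewrite (@eq_nrow _ (fun=> false)) => [|l li]; last exact: le_F.
    by rewrite /nrow sum_nat_const card_ord muln1.
  rewrite /nrow -!(big_mkord xpredT (fun l => (rows t l == false) : nat)).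
  by rewrite [leqRHS](@big_cat_nat _ _ _ i.+1) //= leq_addr.
lia.
Qed.

Lemma row_sorted_eq s t : row_sorted s -> row_sorted t ->
  spin2 N (rows s) = spin2 N (rows t) -> s = t.
Proof.
move=> hs ht st; apply: stab_inj => i iN; rewrite !row_sortedE //; congr (_ <= _)%N.
have := nrow_total (rows s) N; have := nrow_total (rows t) N.
have := stab_le s (leqnn N); have := stab_le t (leqnn N).
by move: st; rewrite /spin2; lia.
Qed.

Lemma swap_inversion t i : (i.+1 < N)%N -> rows t i -> ~~ rows t i.+1 -> swappable i t.
Proof.
move=> iN ti ti'; rewrite /swappable ti (negbTE ti') /= swappable_standard //.
have := @stab_le N t i.+1 (ltnW iN); rewrite !nrowS ti (negbTE ti') /=; lia.
Qed.

(** Removing inversions one by one, each of which lowers the sum of the lengths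
    of the second rows, leads from any tableau to the one that fills the first
    row and then the second. *)
Lemma swap_connected (X : Type) (g : stab N -> X) (k : nat) :
  (forall t i, spin2 N (rows t) = k -> (i.+1 < N)%N -> swappable i t ->
     g (swap i t) = g t) ->
  forall s t, spin2 N (rows s) = k -> spin2 N (rows t) = k -> g s = g t.
Proof.
move=> gswap.
have sorted_ex t : spin2 N (rows t) = k ->
    exists t0, [/\ row_sorted t0, spin2 N (rows t0) = k & g t0 = g t].
  pose area t := (\sum_(l < N.+1) nrow (rows t) true l)%N.
  have [m] := ubnP (area t); elim: m t => [//|m IH] t tm tk.
  have [[i [iN ti ti']]|ns] := pselect (exists i, [/\ (i.+1 < N)%N, rows t i & ~~ rows t i.+1]).
    have sw := swap_inversion iN ti ti'.
    have [||t0 [h0 h1 h2]] := IH (swap i t).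
    - rewrite -ltnS; apply: leq_trans tm; rewrite ltnS /area.
      have iN1 : (i.+1 < N.+1)%N by lia.
      have nr l : (l <= N)%N ->
          nrow (rows (swap i t)) true l = nrow (rows t \o adj_transp i) true l.
        by move=> lN; apply: eq_nrow => j jl; rewrite rows_swap //; lia.
      rewrite (bigD1 (Ordinal iN1)) //= [leqRHS](bigD1 (Ordinal iN1)) //=.
      rewrite nr ?nrow_adj_mid ?nrowS ?ti ?(negbTE ti') /=; last by lia.
      rewrite addn0 addn1 addSn ltnS leq_add2l; apply: leq_sum => l li.
      have lN : (l <= N)%N by rewrite -ltnS.
      rewrite nr //; have li' : l != i.+1 :> nat by [].
      by case: (leqP l i) => il; [rewrite nrow_adj_le | rewrite nrow_adj_ge //; lia].
    - by rewrite spin2_swap.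
    - by exists t0; split=> //; rewrite h2 gswap.
  exists t; split=> // i iN ti; apply: contrapT => /negP ti'.
  by apply: ns; exists i.
move=> s t sk tk; have [s0 [hs es <-]] := sorted_ex s sk.
have [t0 [ht et <-]] := sorted_ex t tk.
by rewrite (row_sorted_eq hs ht) // es et.
Qed.

End Connectivity.

Section Phase.
Variables (C : numClosedFieldType) (phi : schur_weyl_family C).
Hypothesis hphi : forall n, schur_weyl_iso (phi n).
Variables (n : nat) (a : 'Hom(tensor C n.*2, tensor C n.+1.*2)).
Hypothesis ha : schur_weyl_embedding (N := n.*2) a.
Hypothesis hom : forall d v, tensor_homog phi d v -> tensor_homog phi d (a v).

Local Notation phase := (phase phi a).

Lemma phase_norm p : phase p * (phase p)^* = 1.
Proof.
rewrite -(hdot_delta C p) -(beta_isometry hphi ha) /hdot.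
rewrite (bigD1 (swi (stab_ext (tab p) : stab n.+1.*2) (wt p))) //= big1 ?addr0 // => q qp.
have [->|bq] := eqVneq (beta phi a (delta C p) q) 0; first by rewrite mul0r.
case/eqP: qp; rewrite -[LHS]swiK (beta_wt hphi ha hom bq).
by rewrite (beta_support hphi ha hom bq).
Qed.

(** Both sides of the commutation with the transposition s_i are compared at the
    basis vector of the extended tableau; its coefficient in Young's form is not
    0, as the axial distance is at least 2. *)
Lemma phase_swap p i : (i.+1 < n.*2)%N -> swappable i (tab p) ->
  phase (swi (swap i (tab p)) (wt p)) = phase p.
Proof.
move=> iN sw; set t := tab p; set p' := swi (swap i t) (wt p).
have wp : (wt p <= spin2 n.*2 (rows (swap i t)))%N by rewrite spin2_swap // wt_le.
have wt' : (wt p <= spin2 n.*2 (rows t))%N by apply: wt_le.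
have iN2 : (i.+1 < n.*2.+2)%N by lia.
have ext_adj j : (j < n.*2.+2)%N -> (rows (stab_ext t) \o adj_transp i) j =
    add_two n.*2 (rows t \o adj_transp i) j.
  move=> jN; rewrite /= rows_stab_ext ?adj_transp_lt // /add_two.
  have [->|ji] := eqVneq j i; first by rewrite /= adj_transp_l iN (ltnW iN).
  have [->|ji'] := eqVneq j i.+1; first by rewrite /= adj_transp_r iN (ltnW iN).
  by rewrite /= adj_transp_id.
have sw2 : swappable i (stab_ext t).
  move: sw => /andP[s1 s2]; rewrite /swappable !rows_stab_ext ?(ltnW iN2) //.
  by rewrite !add_two_lt ?(ltnW iN) // s1 (eq_standard ext_adj) standard_add_two.
have swE : swap i (stab_ext t) = stab_ext (swap i t).
  apply: stab_inj => j jN; rewrite rows_swap // -[LHS]/((rows _ \o _) j) ext_adj //.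
  rewrite rows_stab_ext // /add_two; case: ifP => // jn; by rewrite rows_swap.
have axE : axial i (stab_ext t) = axial i t.
  rewrite /axial; congr (_ - _); apply: eq_content => l li;
    rewrite rows_stab_ext ?add_two_lt //; lia.
have := congr1 (fun v : sw_sum C n.+1.*2 => v (swi (stab_ext t : stab n.+1.*2) (wt p)))
  (beta_transp hphi ha (delta C p') iN).
rewrite !(betaE hphi ha hom).
have tp : swi t (wt p) = p by apply: swiK.
have pp' : (p == p') = false.
  apply/negbTE; apply: contra (swap_neq iN sw) => /eqP/(congr1 (@tab _)).
  by rewrite tab_swi => <-.
have r1 : 1 - (axial i t)%:~R ^- 2 != 0 :> C.
  have := axial_swappable iN sw; rewrite -/t => r2; rewrite subr_eq0 eq_sym invr_eq1.
  rewrite -rmorphXn /= -[X in _ == X]/(1%:~R) eqr_int sqrf_eq1.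
  by apply/norP; split; apply/eqP; lia.
rewrite (@serp_fun_swi C n.*2) // ffunE tp (transp_swE _ _ iN) sw [RHS](transp_swE _ _ iN2).
rewrite tab_swi sw2 swE wt_swi ?(spin2_stab_ext t) // axE.
rewrite !(@serp_fun_swi C n.*2) // !ffunE tp -/p' pp' eqxx.
rewrite !mulr0 !mulr1 !add0r mulrC => /(mulfI _) -> //.
by rewrite sqrtC_eq0.
Qed.

End Phase.

Section Generation.

Lemma perm_tensor_comp (C : numClosedFieldType) N (s t : nat -> nat) (v : tensor C N) :
  (forall i, (i < N)%N -> (t i < N)%N) ->
  perm_tensor s (perm_tensor t v) = perm_tensor (s \o t) v.
Proof.
move=> ht; apply/ffunP => w; rewrite !ffunE; congr (v _).
apply: eq_from_tnth => i; rewrite !tnth_mktuple /=.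
have tN := ht i (ltn_ord i).
transitivity (tnth [tuple nth ord0 w (s k) | k < N] (Ordinal tN)).
  by rewrite [RHS](tnth_nth ord0).
by rewrite tnth_mktuple.
Qed.

Lemma perm_tensor_id (C : numClosedFieldType) N (s : nat -> nat) (v : tensor C N) :
  (forall i, (i < N)%N -> s i = i) -> perm_tensor s v = v.
Proof.
move=> hs; apply/ffunP => w; rewrite !ffunE; congr (v _).
by apply: eq_from_tnth => i; rewrite tnth_mktuple hs // [RHS](tnth_nth ord0).
Qed.

(** The adjacent transpositions generate the symmetric group. The induction is on
    the number M of points that s may move and then on M - s M, composing with
    the transposition that brings the image of the last point closer to M. *)
Lemma perm_tensor_equivariant (C : numClosedFieldType) N
    (T : tensor C N -> tensor C N) :
  (forall v i, (i.+1 < N)%N ->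
     T (perm_tensor (adj_transp i) v) = perm_tensor (adj_transp i) (T v)) ->
  forall s : nat -> nat, injective s -> (forall i, (N <= i)%N -> s i = i) ->
  forall v, T (perm_tensor s v) = perm_tensor s (T v).
Proof.
move=> Tadj.
suff gen M : (M <= N)%N -> forall s : nat -> nat, injective s ->
    (forall i, (M <= i)%N -> s i = i) ->
    forall v, T (perm_tensor s v) = perm_tensor s (T v).
  exact: gen.
elim: M => [|M IH] MN s sinj sM v; first by rewrite !perm_tensor_id // => i _; apply: sM.
have sle i : (i <= M)%N -> (s i <= M)%N.
  move=> iM; rewrite leqNgt; apply/negP => h.
  by have := sM _ h => /sinj e; rewrite e in h; lia.
have [d] := ubnP (M - s M)%N; elim: d s sinj sM sle v => [//|d IHd] s sinj sM sle v hd.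
have [e|ne] := eqVneq (s M) M.
  apply: IH => //; first exact: ltnW.
  by move=> i; rewrite leq_eqVlt => /predU1P[<- //|]; apply: sM.
have jM : (s M < M)%N by rewrite ltn_neqAle ne sle.
set j := s M in hd jM *.
have jN : (j.+1 < N)%N by lia.
pose s' := adj_transp j \o s.
have sE : s = adj_transp j \o s'.
  by apply/funext => i; rewrite /s' /= adj_transpK.
have s'lt i : (i < N)%N -> (s' i < N)%N.
  move=> iN; rewrite /s' /= adj_transp_lt //; have [iM|iM] := leqP i M.
    by have := sle i iM; lia.
  by rewrite sM.
rewrite sE -(perm_tensor_comp _ v s'lt) Tadj // -(perm_tensor_comp _ (T v) s'lt).
congr (perm_tensor _ _).
apply: IHd.
- by apply: inj_comp sinj; apply: inv_inj (adj_transpK j).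
- by move=> i iM; rewrite /s' /= sM // adj_transp_id //; apply/eqP; lia.
- by move=> i iM; rewrite /s' /= -ltnS adj_transp_lt // ltnS; apply: sle.
- by rewrite /s' /= -/j adj_transp_l; lia.
Qed.

End Generation.

Section Intertwiner.
Variables (C : numClosedFieldType) (phi : schur_weyl_family C).
Hypothesis hphi : forall n, schur_weyl_iso (phi n).
Variable alpha : chain C.
Hypothesis halpha : forall n, schur_weyl_embedding (N := n.*2) (alpha n).
Hypothesis hom : forall n d v, tensor_homog phi d v -> tensor_homog phi d (alpha n v).

Definition phase_at n (k j : nat) : C :=
  if [pick p : sw_index n.*2 | (spin2 n.*2 (rows (tab p)) == k) && (wt p == j)]
    is Some p then phase phi (alpha n) p else 1.

(** The phase depends only on the shape and on the weight vector, because the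
    embedding commutes with the symmetric group. *)
Lemma phase_atE n p :
  phase phi (alpha n) p = phase_at n (spin2 n.*2 (rows (tab p))) (wt p).
Proof.
rewrite /phase_at; case: pickP => [q /andP[/eqP qp /eqP wqp]|/(_ p)]; last by rewrite !eqxx.
have := @swap_connected n.*2 C (fun t => phase phi (alpha n) (swi t (wt p))) _ _
  (tab p) (tab q) erefl qp.
rewrite -{4}wqp !swiK; apply => t i tk iN sw.
have wp : (wt p <= spin2 n.*2 (rows t))%N by rewrite tk wt_le.
have := @phase_swap C phi hphi n (alpha n) (halpha n) (@hom n) (swi t (wt p)) i iN.
by rewrite tab_swi wt_swi //; apply.
Qed.

Lemma phase_at_norm n k j : phase_at n k j * (phase_at n k j)^* = 1.
Proof.
rewrite /phase_at; case: pickP => [p _|_]; last by rewrite conjC1 mulr1.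
exact: (phase_norm hphi (halpha n) (@hom n)).
Qed.

(** The conjugate of the product of the phases of the first n embeddings, which
    the twist has to undo. *)
Fixpoint twist n (k j : nat) : C :=
  if n is n'.+1 then twist n' k j * (phase_at n' k j)^* else 1.

Lemma twist_norm n k j : twist n k j * (twist n k j)^* = 1.
Proof.
elim: n => [|n IH] /=; first by rewrite conjC1 mulr1.
by rewrite rmorphM /= conjCK mulrACA IH mul1r mulrC phase_at_norm.
Qed.

Definition twist_sw n (v : sw_sum C n.*2) : sw_sum C n.*2 :=
  [ffun p => twist n (spin2 n.*2 (rows (tab p))) (wt p) * v p].

Definition tw n (u : tensor C n.*2) : tensor C n.*2 :=
  (phi n)^-1%VF (twist_sw (phi n u)).

Lemma phi_tw n u : phi n (tw u) = twist_sw (phi n u).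
Proof. exact: phi_invK. Qed.

Lemma phi_inj n : injective (phi n).
Proof. exact/bij_inj/swi_bij/hphi. Qed.

Lemma tw_is_linear n : linear (@tw n).
Proof.
move=> c u v; apply: (@phi_inj n); rewrite linearP !phi_tw linearP.
apply/ffunP => p; rewrite !ffunE.
rewrite -[X in _ = _ *: X + _]/(phi n (tw u) p) -[X in _ = _ + X]/(phi n (tw v) p).
by rewrite !phi_tw !ffunE -![_ *: _]/(_ * _) mulrDr mulrCA.
Qed.

Lemma tw_isometry n u v : hdot (@tw n u) (tw v) = hdot u v.
Proof.
rewrite -!(swi_isometry (hphi n)) !phi_tw; apply: eq_bigr => p _.
by rewrite !ffunE rmorphM /= mulrACA twist_norm mul1r.
Qed.

Lemma tw_surj n w : exists u, @tw n u = w.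
Proof.
pose v : sw_sum C n.*2 := [ffun p =>
  (twist n (spin2 n.*2 (rows (tab p))) (wt p))^* * phi n w p].
exists ((phi n)^-1%VF v); apply: (@phi_inj n); rewrite phi_tw phi_invK //.
by apply/ffunP => p; rewrite !ffunE mulrA twist_norm mul1r.
Qed.

Lemma tw_inj n : injective (@tw n).
Proof.
move=> u v uv; apply: hdot_eq0; rewrite -tw_isometry.
have -> : tw (u - v) = 0.
  by rewrite -scaleN1r addrC tw_is_linear uv scaleN1r addNr.
by rewrite /hdot big1 // => i _; rewrite ffunE mul0r.
Qed.

Lemma tw_chain n u : tw (alpha n u) = serpentine phi n (tw u).
Proof.
apply: (@phi_inj n.+1); rewrite phi_tw phi_serpentine // phi_tw -beta_phi //.
rewrite (betaE hphi (halpha n) (@hom n)); apply/ffunP => q; rewrite ffunE.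
have [[t tq]|nt] := pselect (exists t, tab q = stab_ext t); last first.
  by rewrite !serp_fun_notin ?mulr0 // => t; apply/eqP => tq; apply: nt; exists t.
have wq : (wt q <= spin2 n.*2 (rows t))%N by rewrite -spin2_stab_ext -tq wt_le.
have sq : spin2 n.+1.*2 (rows (tab q)) = spin2 n.*2 (rows t).
  by rewrite tq; apply: (spin2_stab_ext t).
have qE : q = swi (stab_ext t : stab n.+1.*2) (wt q) by rewrite -tq swiK.
rewrite sq {2 3}qE !(@serp_fun_swi C n.*2) // !ffunE tab_swi wt_swi //.
rewrite phase_atE tab_swi wt_swi // -[twist n.+1 _ _]/(twist n _ _ * (phase_at n _ _)^*).
rewrite -mulrA; congr (_ * _); rewrite mulrA [_^* * _]mulrC phase_at_norm.
by rewrite mul1r.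
Qed.

Lemma twist_transp n i (v : sw_sum C n.*2) : (i.+1 < n.*2)%N ->
  twist_sw (transp_sw i v) = transp_sw i (twist_sw v).
Proof.
move=> iN; apply/ffunP => p; rewrite ffunE !transp_swE // mulrDr ffunE mulrCA.
congr (_ + _); case: ifP => sw; last by rewrite mulr0.
rewrite ffunE tab_swi spin2_swap // wt_swi ?spin2_swap // ?wt_le //.
by rewrite mulrCA.
Qed.

Lemma tw_perm n (s : finperm) u : in_sym n.*2 s ->
  tw (perm_tensor s u) = perm_tensor s (@tw n u).
Proof.
case: s => s sbij sfin hs /=.
apply: perm_tensor_equivariant => // [v i iN|]; last exact: bij_inj.
apply: (@phi_inj n).
by rewrite phi_tw !(swi_sym (hphi n)) // phi_tw twist_transp.
Qed.

Definition lim_tw (p : indlim alpha) : indlim (serpentine phi) :=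
  germ (serpentine phi) (fun n => tw (seq_of p n)).

Lemma tw_compatible x : compatible alpha x ->
  compatible (serpentine phi) (fun n => tw (x n)).
Proof. by move=> [n0 h]; exists n0 => n /h ->; apply: tw_chain. Qed.

Lemma lim_twE p : ev_eq (seq_of (lim_tw p)) (fun n => tw (seq_of p n)).
Proof. exact/seq_of_germ/tw_compatible/seq_ofP. Qed.

Lemma lim_tw_germ x : compatible alpha x ->
  lim_tw (germ alpha x) = germ (serpentine phi) (fun n => tw (x n)).
Proof.
move=> cx; apply: germ_eq; first exact/tw_compatible/seq_ofP.
by have [n0 h] := seq_of_germ cx; exists n0 => n /h ->.
Qed.

Lemma lim_tw_is_linear : linear lim_tw.
Proof.
move=> c p q; rewrite -[RHS]seq_ofK; apply: germ_eq; first exact/tw_compatible/seq_ofP.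
have [n1 h1] := lim_addE (c *: p) q; have [n2 h2] := lim_scaleE c p.
have [n3 h3] := lim_addE (c *: lim_tw p) (lim_tw q).
have [n4 h4] := lim_scaleE c (lim_tw p).
have [n5 h5] := lim_twE p; have [n6 h6] := lim_twE q.
exists (n1 + n2 + n3 + n4 + n5 + n6)%N => n le.
by rewrite h1 ?h2 ?h3 ?h4 ?h5 ?h6 ?tw_is_linear //; lia.
Qed.

Lemma intertwiner_exists :
  exists T : {linear indlim alpha -> indlim (serpentine phi)}, unitary_intertwiner T.
Proof.
pose T : {linear indlim alpha -> indlim (serpentine phi)} :=
  HB.pack lim_tw (GRing.isLinear.Build C _ _ _ lim_tw lim_tw_is_linear).
exists T; split=> /=.
- have inj : injective lim_tw.
    move=> p q pq; rewrite -(seq_ofK p) -(seq_ofK q).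
    apply: germ_eq; first exact: seq_ofP.
    have [n1 h1] := lim_twE p; have [n2 h2] := lim_twE q.
    exists (n1 + n2)%N => n le; apply: tw_inj.
    by rewrite -h1 -?h2 ?pq //; lia.
  have surj q : exists p, lim_tw p = q.
    pose x n := projT1 (cid (tw_surj (seq_of q n))).
    have xE n : tw (x n) = seq_of q n by rewrite /x; case: cid.
    have cx : compatible alpha x.
      have [n0 h] := seq_ofP q; exists n0 => n le; apply: tw_inj.
      by rewrite tw_chain !xE h.
    exists (germ alpha x); rewrite lim_tw_germ // -[RHS]seq_ofK.
    by apply: germ_eq; [apply: tw_compatible | exists 0%N => n _; rewrite xE].
  exists (fun q => projT1 (cid (surj q))) => [p|q]; last by case: cid.
  by apply: inj; case: cid.
- move=> p q; have [n1 h1] := seq_ofP p; have [n2 h2] := seq_ofP q.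
  have [n3 h3] := lim_twE p; have [n4 h4] := lim_twE q.
  pose m := (n1 + n2 + n3 + n4)%N; pose c := hdot (seq_of p m) (seq_of q m).
  have hc n : (m <= n)%N -> hdot (seq_of p n) (seq_of q n) = c.
    elim: n => [|n IH]; first by rewrite leqn0 /c => /eqP ->.
    rewrite leq_eqVlt => /predU1P[<- //|]; rewrite ltnS => le.
    by rewrite h1 ?h2 ?(swe_isometry (halpha n)) ?IH //; move: le; rewrite /m; lia.
  rewrite [RHS](lim_dot_eq (c := c)); last by exists m.
  apply: lim_dot_eq; exists m => n le.
  by rewrite h3 ?h4 ?tw_isometry ?hc //; move: le; rewrite /m; lia.
- move=> s p; have [N0 hN] : exists N, forall i, (N <= i)%N -> s i = i by case: s.
  have sN n : (N0 <= n)%N -> in_sym n.*2 s by move=> le i hi; apply: hN; lia.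
  have [n1 h1] := seq_ofP p; have [n2 h2] := lim_twE p.
  have cp : compatible alpha (fun n => perm_tensor s (seq_of p n)).
    exists (N0 + n1)%N => n le; rewrite h1; last by lia.
    by rewrite (swe_sym (halpha n)) //; apply: sN; lia.
  rewrite /lim_perm lim_tw_germ //; apply: germ_eq; first exact: tw_compatible.
  exists (N0 + n2)%N => n le; rewrite h2; last by lia.
  by rewrite tw_perm //; apply: sN; lia.
Qed.

End Intertwiner.

Theorem theorem1 (R : realType)
    (* the Schur--Weyl identifications of the tensor powers *)
    (phi : schur_weyl_family R[i])
    (hphi : forall n, schur_weyl_iso (phi n))
    (* the basic module with its inner product *)
    (L : lmodType R[i]) (A : affine_module L) (vac : L)
    (hL : basic_module A vac)
    (form : {dot L for Num.conj}) (hform : invariant_form A form vac) :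
  (exists F : {linear L -> indlim (serpentine phi)},
     graded_unitary_iso form (fun x => loop A x 0) (affine_homog A vac)
       (@lim_dot _ (serpentine phi)) (@lim_sl2 _ (serpentine phi))
       (@serp_homog _ phi) F) /\
  (forall alpha : chain R[i],
     (forall n, schur_weyl_embedding (alpha n)) ->
     (forall n d v, tensor_homog phi d v -> tensor_homog phi d (alpha n v)) ->
     (exists F : {linear L -> indlim alpha},
        graded_unitary_iso form (fun x => loop A x 0) (affine_homog A vac)
          (@lim_dot _ alpha) (@lim_sl2 _ alpha)
          (@lim_homog _ alpha phi) F) ->
     exists T : {linear indlim alpha -> indlim (serpentine phi)},
       unitary_intertwiner T).
Proof.
have [hw hwP] := hw_family_exists hL hform.
split; first exact: (serp_iso hphi hL hform hwP).
by move=> alpha halpha homog _; apply: intertwiner_exists.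
Qed.
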